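(* Let $(\Omega,\mathfrak{F},\mathbb{P})$ be a complete probability space and let $X\in L^2[\Omega;\mathbb{F}]$ with $\mathbf{Ste}(X(\omega))=0$ for all $\omega\in\Omega$. Then there exist $H_X^{\bot}\in\mathbb{F}$ with $\mathbf{Ste}(H_X^{\bot})=0$ and $Y\in L^2[\Omega;\mathbb{F}]$ such that $$X(\omega)=H_X^{\bot}\oplus Y(\omega)\qquad\text{for }\mathbb{P}\text{-almost all }\omega\in\Omega .$$ In particular, $H_X^{\bot}$ is the unique element of $\mathbb{F}$ that satisfies such a decomposition and minimizes $\mathbb{E}[d_2(X,C)^2]$; i.e. there exists a unique $H_X^{\bot}\in\Theta_X$ such that $$H_X^{\bot}=\operatorname*{arg\,min}_{B\in\Theta_X}\mathbb{E}[d_2(X,B)^2].$$ Hence $Y$ is the unique (up to a $\mathbb{P}$-negligible set) fuzzy set-valued random variable whose support function is given by $s_Y=s_X-s_{H_X^{\bot}}$. Moreover, $H_X^{\bot}$ is a maximal element of $\Theta_X$ with respect to level-wise set inclusion: if $C\in\Theta_X$ and $(H_X^{\bot})_\alpha\subseteq C_\alpha$ for every $\alpha\in[0,1]$, then $H_X^{\bot}=C$.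
   Context: Fix $d\ge 1$. $\mathbb{F}$ denotes the set of all functions $\nu:\mathbb{R}^d\to[0,1]$ such that: (1) $\nu$ is upper semicontinuous, i.e. for each $\alpha\in(0,1]$ the level set $\nu_\alpha=\{x:\nu(x)\ge\alpha\}$ is closed; (2) $\nu_1\ne\emptyset$; (3) $\nu_0:=\overline{\{x:\nu(x)>0\}}$ is compact; (4) $\nu_\alpha$ is convex for every $\alpha\in[0,1]$. Thus all $\nu_\alpha$, $\alpha\in[0,1]$, are non-empty compact convex sets. Addition on $\mathbb{F}$: $(\nu^1\oplus\nu^2)_\alpha=\nu^1_\alpha+\nu^2_\alpha$ (Minkowski sum). $S^{d-1}$ is the unit sphere of $\mathbb{R}^d$. For a non-empty compact convex $A\subset\mathbb{R}^d$, $s_A(x)=\sup\{\langle x,a\rangle:a\in A\}$, $x\in S^{d-1}$. The support function of $\nu\in\mathbb{F}$ is $s_\nu(x,\alpha)=s_{\nu_\alpha}(x)$ for $(x,\alpha)\in S^{d-1}\times[0,1]$. Metric: $d_2(\nu^1,\nu^2)=\big(\int_0^1\int_{S^{d-1}}|s_{\nu^1}(u,\alpha)-s_{\nu^2}(u,\alpha)|^2\,du\,d\alpha\big)^{1/2}$, with $du$ the normalized Lebesgue measure on $S^{d-1}$. The Steiner point of $A$ is $\mathbf{ste}(A)=\frac1{v_d}\int_{S^{d-1}}s_A(x)\,x\,d\lambda(x)$, where $\lambda$ is the Lebesgue (surface) measure on $S^{d-1}$ and $v_d$ the volume of the unit ball. The generalized Steiner point of $\nu\in\mathbb{F}$ is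 $\mathbf{Ste}(\nu)=\int_0^1\mathbf{ste}(\nu_\alpha)\,d\alpha$. A fuzzy set-valued random variable (FRV) is a map $X:\Omega\to\mathbb{F}$ such that for every $\alpha\in(0,1]$ the map $\omega\mapsto X(\omega)_\alpha$ is measurable with respect to the Borel $\sigma$-algebra generated by the Hausdorff metric on the space of non-empty compact convex subsets of $\mathbb{R}^d$. $L^2[\Omega;\mathbb{F}]$ is the set of FRVs $X$ with $\mathbb{E}[(\sup_{x\in X_0}\|x\|)^2]<\infty$. For an FRV $X$, $s_X$ denotes $\omega\mapsto s_{X(\omega)}$. For $K\in\mathbb{F}$ with $\mathbf{Ste}(K)=0$, $\theta_K=\{B\in\mathbb{F}:\mathbf{Ste}(B)=0\text{ and there exists }A\in\mathbb{F}\text{ with }B\oplus A=K\}$. For an FRV $X$ with $\mathbf{Ste}(X)=0$, the Hukuhara set is $\Theta_X=\{B\in\mathbb{F}:\mathbb{P}(\{\omega:B\in\theta_{X(\omega)}\})=1\}$. *)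

(* Defs.v *)
From HB Require Import structures.
From mathcomp Require Import all_boot all_order all_algebra.
From mathcomp Require Import all_classical all_reals all_analysis.
From mathcomp Require Import measurable_realfun.

Set Implicit Arguments.
Unset Strict Implicit.
Unset Printing Implicit Defensive.

Import Order.TTheory GRing.Theory Num.Theory.
Import numFieldNormedType.Exports.

Local Open Scope classical_set_scope.
Local Open Scope ring_scope.

(* R^d is 'rV[R]_d.  The library norm `|x| on matrices is the sup norm (which
   induces the usual topology), so the Euclidean norm is defined here. *)
Section euclidean.
Context {R : realType} {d : nat}.
Implicit Types (x y u : 'rV[R]_d) (A B : set 'rV[R]_d).

Definition dot x y : R := \sum_i x 0 i * y 0 i.

Definition enorm x : R := Num.sqrt (dot x x).

Definition unit_sphere : set 'rV[R]_d := [set u | enorm u = 1].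

Definition unit_ball : set 'rV[R]_d := [set x | enorm x <= 1].

Definition minkowski_sum A B : set 'rV[R]_d :=
  [set z | exists x y, [/\ A x, B y & z = x + y]].

Definition support_set A u : R := sup [set dot u a | a in A].

Definition convex_body A : Prop :=
  [/\ A !=set0, compact A & convex_set (A : set (convex_lmodType 'rV[R]_d))].

Definition hausdorff_dist A B : R :=
  Num.max (sup [set inf [set enorm (a - b) | b in B] | a in A])
          (sup [set inf [set enorm (a - b) | a in A] | b in B]).

Definition hausdorff_open (U : set (set 'rV[R]_d)) : Prop :=
  U `<=` convex_body /\
  forall A, U A -> exists2 e : R, 0 < e &
    forall B, convex_body B -> hausdorff_dist A B < e -> U B.

Definition hausdorff_borel : set (set (set 'rV[R]_d)) :=
  <<s convex_body, hausdorff_open >>.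

End euclidean.

(* 'rV[R]_n carries the product sigma-algebra, as n.-tuple R in the library. *)
Definition row_display : measure_display. Proof. exact: default_measure_display. Qed.

Section measurable_row.
Context (R : realType) (n : nat).

Definition row_coord (i : 'I_n) (x : 'rV[R]_n) : R := x 0 i.

Let row0 : g_sigma_preimage row_coord set0.
Proof. exact: sigma_algebra0. Qed.

Let rowC A : g_sigma_preimage row_coord A -> g_sigma_preimage row_coord (~` A).
Proof. exact: sigma_algebraC. Qed.

Let row_bigcup (F : _^nat) : (forall i, g_sigma_preimage row_coord (F i)) ->
  g_sigma_preimage row_coord (\bigcup_i (F i)).
Proof. exact: sigma_algebra_bigcup. Qed.

HB.instance Definition _ := @isMeasurable.Build row_display
  'rV[R]_n (g_sigma_preimage row_coord) row0 rowC row_bigcup.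

End measurable_row.


Section measurability.
Context {R : realType} {n : nat}.

Lemma measurable_row_coord (i : 'I_n) :
  measurable_fun [set: 'rV[R]_n] (row_coord i).
Proof.
move=> _ A mA; rewrite setTI; apply: sub_sigma_algebra => /=.
rewrite -bigcup_seq/=; exists i => /=; first by rewrite mem_index_enum.
by exists A => //; rewrite setTI.
Qed.

Lemma measurable_fun_row d (T : measurableType d) (f : T -> 'rV[R]_n) :
  (forall i, measurable_fun [set: T] (row_coord i \o f)) ->
  measurable_fun [set: T] f.
Proof.
move=> mf; apply: measurability => //= _ [B + <-].
rewrite -bigcup_seq/= => -[i _ [C mC <-]].
by rewrite !setTI -comp_preimage -[X in measurable X]setTI; exact: mf.
Qed.

Lemma measurable_enorm : measurable_fun [set: 'rV[R]_n] (@enorm R n).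
Proof.
apply: (measurableT_comp (f := @Num.sqrt R)).
  exact: (continuous_measurable_fun (@sqrt_continuous R)).
by apply: measurable_sum => i; apply: measurable_funM; exact: measurable_row_coord.
Qed.

Definition direction (x : 'rV[R]_n) : 'rV[R]_n := (enorm x)^-1 *: x.

Lemma measurable_direction : measurable_fun [set: 'rV[R]_n] direction.
Proof.
apply: measurable_fun_row => i.
rewrite (_ : _ \o _ = (fun x : 'rV[R]_n => enorm x `^ (- 1) * row_coord i x)).
  apply: measurable_funM; last exact: measurable_row_coord.
  exact: (measurableT_comp (measurable_powR (- 1)) measurable_enorm).
by apply/funext => x; rewrite /= powR_inv1 ?sqrtr_ge0// /row_coord mxE.
Qed.

Definition punctured_ball : set 'rV[R]_n := [set x | 0 < enorm x <= 1].

Lemma measurable_punctured_ball : measurable punctured_ball.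
Proof.
rewrite (_ : punctured_ball = @enorm R n @^-1` `]0, 1]%classic).
  by rewrite -[X in measurable X]setTI; apply: measurable_enorm.
by apply/seteqP; split => x; rewrite /= in_itv.
Qed.

End measurability.

Definition image_measure d1 d2 (T1 : measurableType d1) (T2 : measurableType d2)
    (R : realType) (m : {measure set T1 -> \bar R}) (f : T1 -> T2)
    (mf : measurable_fun [set: T1] f) : {measure set T2 -> \bar R} :=
  measure_function_pushforward__canonical__measure_function_Measure m mf.

Section lebesgue_row.
Context {R : realType}.

Definition row_cons n (p : 'rV[R]_n * R) : 'rV[R]_n.+1 := row_mx p.2%:M p.1.

Lemma measurable_row_cons n :
  measurable_fun [set: 'rV[R]_n * measurableTypeR R] (@row_cons n).
Proof.
apply: measurable_fun_row => i; case: (splitP (i : 'I_(1 + n))) => j ij.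
  rewrite (_ : _ \o _ = snd) //; apply/funext => p; rewrite /= /row_coord.
  have -> : i = lshift n j by exact/val_inj.
  by rewrite /row_cons; apply: (etrans (row_mxEl _ _ _ _)); rewrite mxE ord1 eqxx.
rewrite (_ : _ \o _ = row_coord j \o fst); last first.
  apply/funext => p; rewrite /= /row_coord.
  have -> : i = rshift 1 j by exact/val_inj.
  by rewrite /row_cons; apply: (etrans (row_mxEr _ _ _ _)).
by apply: measurableT_comp => //; exact: measurable_row_coord.
Qed.

Fixpoint lebesgue_row n : {measure set 'rV[R]_n -> \bar R} :=
  if n is n'.+1 then
    image_measure (lebesgue_row n' \x @lebesgue_measure R)%E
      (@measurable_row_cons n')
  else \d_(0 : 'rV[R]_0).

End lebesgue_row.

Section sphere.
Context (R : realType) (d : nat).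

(* Surface measure of S^(d-1) as the cone measure:
   A |-> d * vol {x | 0 < |x| <= 1, x / |x| \in A}; this is the polar-coordinates
   formula, and for d = 1 it is the counting measure of {-1, 1}. *)
Definition surface_measure : {measure set 'rV[R]_d -> \bar R} :=
  mscale (d%:R)%:nng
    (image_measure (mrestr (lebesgue_row d) measurable_punctured_ball)
       measurable_direction).

Definition sphere_area : R := fine (surface_measure unit_sphere).

Definition ball_volume : R := fine (lebesgue_row d unit_ball).

Definition steiner (A : set 'rV[R]_d) : 'rV[R]_d :=
  \row_i (ball_volume^-1 *
    \int[surface_measure]_(u in unit_sphere) (support_set A u * u 0 i)).

End sphere.

Section fuzzy.
Context (R : realType) (d : nat).

Definition level (nu : 'rV[R]_d -> R) (a : R) : set 'rV[R]_d :=
  if a == 0 then closure [set x | 0 < nu x] else [set x | a <= nu x].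

Record fuzzy := Fuzzy {
  membership :> 'rV[R]_d -> R;
  membership01 : forall x, 0 <= membership x <= 1;
  fuzzy_usc : forall a, 0 < a <= 1 -> closed (level membership a);
  fuzzy_level1 : level membership 1 !=set0;
  fuzzy_level0 : compact (level membership 0);
  fuzzy_convex : forall a, 0 <= a <= 1 ->
    convex_set (level membership a : set (convex_lmodType 'rV[R]_d)) }.

Implicit Types (A B C K : fuzzy).

(* K = A (+) B: the sum is defined by its level sets, which determine it. *)
Definition is_fuzzy_sum A B K : Prop :=
  forall a, 0 <= a <= 1 -> level K a = minkowski_sum (level A a) (level B a).

Definition support (nu : fuzzy) (u : 'rV[R]_d) (a : R) : R :=
  support_set (level nu a) u.

Definition d2 A B : R :=
  Num.sqrt (\int[@lebesgue_measure R]_(a in `[0%R, 1%R])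
    ((sphere_area R d)^-1 * \int[surface_measure R d]_(u in unit_sphere)
      `|support A u a - support B u a| ^+ 2)).

Definition Steiner (nu : fuzzy) : 'rV[R]_d :=
  \row_i \int[@lebesgue_measure R]_(a in `[0%R, 1%R]) steiner (level nu a) 0 i.

(* Meaningful only for K with Steiner K = 0. *)
Definition theta K : set fuzzy :=
  [set B | Steiner B = 0 /\ exists A, is_fuzzy_sum B A K].

End fuzzy.

Section random.
Context (R : realType) (d : nat) (dO : measure_display)
  (Omega : measurableType dO) (P : probability Omega R).
Implicit Types X Y : Omega -> fuzzy R d.

Definition is_frv X : Prop :=
  forall a, 0 < a <= 1 -> forall V, hausdorff_borel V ->
    measurable [set w | V (level (X w) a)].

Definition in_L2 X : Prop :=
  is_frv X /\
  ('E_P[(fun w => sup [set enorm x | x in level (X w) 0] ^+ 2)%R] < +oo)%E.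

(* The value of P on a non-measurable set carries no meaning, hence the first
   conjunct. *)
Definition Theta X : set (fuzzy R d) :=
  [set B | measurable [set w | theta (X w) B] /\
           P [set w | theta (X w) B] = 1%E].

Definition decomposes X B Y : Prop :=
  in_L2 Y /\ {ae P, forall w, is_fuzzy_sum B (Y w) (X w)}.

Definition mean_sq_dist X B : \bar R := 'E_P[(fun w => d2 (X w) B ^+ 2)%R]%E.

Definition support_difference X (H : fuzzy R d) Y : Prop :=
  {ae P, forall w, forall u a, unit_sphere u -> 0 <= a <= 1 ->
     support (Y w) u a = support (X w) u a - support H u a}.

End random.

Definition unique_argmin (T : Type) (R : realType) (S : set T)
    (f : T -> \bar R) (x : T) : Prop :=
  [/\ S x, forall y, S y -> (f x <= f y)%E &
      forall z, S z -> (forall y, S y -> (f z <= f y)%E) -> z = x].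

(* Main.v *)
Require Import Defs.
From mathcomp Require Import all_boot all_order all_algebra.
From mathcomp Require Import all_classical all_reals all_analysis.
From mathcomp Require Import measurable_realfun ring lra.

Import Defs.
Import Order.TTheory GRing.Theory Num.Theory.
Import numFieldNormedType.Exports.

Local Open Scope classical_set_scope.
Local Open Scope ring_scope.

(** Sending a fuzzy set to its support function [(u, a) |-> support A u a] turns
    sums of fuzzy sets into sums of functions, and [d2] into the distance of
    [L^2(sphere x [0, 1])].  The Hukuhara set of [X] becomes a bounded convex set
    of functions, and the theorem is about the point of that set closest to [X] in
    mean square.

    Uniqueness is the parallelogram identity ([sqdist_midpoint]): the midpoint of
    two minimizers is again a summand of almost every [X w] and would be strictly
    better.  This needs that functions at distance [0] come from the same fuzzy set
    ([sqdist_eq0]), which holds because the surface measure charges every open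
    part of the sphere and because a fuzzy set is determined by a dense set of its
    levels.

    For existence ([Theta_minimizer_exists]), a minimizing sequence [B_n] is
    bounded: all its terms are summands, with Steiner point [0], of one and the
    same [X w] ([summand_bounded]).  It is then passed to the limit along an
    ultrafilter.  At a fixed level the limit consists of the limits of sequences
    with terms in [B_n]; as every bounded sequence converges along an ultrafilter,
    a decomposition [X w = B_n + A_n] for all [n] passes to the limit without any
    separation argument ([ulim_sum], [fuzzy_limit_sum]), for all [w] of a set of
    probability [1] at once.  The limits of the level sets must be made
    left-continuous in the level ([fuzzy_regularization]).  The distances converge
    nevertheless ([sqdist_cvg]): inner products of support functions are integrals
    of differences of monotone functions of the level, so that Riemann sums
    approximate them uniformly and do not see the regularization
    ([int01_cvg_monotone]).  The same Riemann sums give the measurability in [w] of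
    [sqdist (X w) B], without a joint measurability argument.

    The remainder [Y] is a random fuzzy set because adding a fixed convex body is an
    isometry for the Hausdorff distance, which is the uniform distance of support
    functions on the sphere ([hausdorff_dist_le], [support_hausdorff_dist],
    [frv_summand]).

    Maximality comes from [sqdist_summand_le]: if [H] is contained in [C], then at
    almost every [w] the remainder [Z] for [C] is contained in the remainder [Y]
    for [H].  With [p] in the core of [Z], the shifts of [Y] and [Z] by [- p] have
    support functions [0 <= s_Z <= s_Y], and shifting changes both squared norms by the
    same amount since the Steiner points vanish.  Hence [C] is at least as close to
    [X] as [H], and [C = H] by uniqueness. *)

Set Implicit Arguments.
Unset Strict Implicit.
Unset Printing Implicit Defensive.

(** * Euclidean geometry of row vectors *)

Section geometry.
Context {R : realType} {d : nat}.
Implicit Types (x y z u : 'rV[R]_d) (A B C : set 'rV[R]_d).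

Lemma dotC x y : dot x y = dot y x.
Proof. by apply: eq_bigr => i _; rewrite mulrC. Qed.

Lemma dotDr x y z : dot x (y + z) = dot x y + dot x z.
Proof. by rewrite -big_split; apply: eq_bigr => i _; rewrite mxE mulrDr. Qed.

Lemma dotZr a x y : dot x (a *: y) = a * dot x y.
Proof. by rewrite big_distrr; apply: eq_bigr => i _; rewrite mxE mulrCA. Qed.

Lemma dotNr x y : dot x (- y) = - dot x y.
Proof. by rewrite -scaleN1r dotZr mulN1r. Qed.

Lemma dotBr x y z : dot x (y - z) = dot x y - dot x z.
Proof. by rewrite dotDr dotNr. Qed.

Lemma dotDl x y z : dot (x + y) z = dot x z + dot y z.
Proof. by rewrite !(dotC _ z) dotDr. Qed.

Lemma dotZl a x y : dot (a *: x) y = a * dot x y.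
Proof. by rewrite !(dotC _ y) dotZr. Qed.

Lemma dotBl x y z : dot (x - y) z = dot x z - dot y z.
Proof. by rewrite !(dotC _ z) dotBr. Qed.

Lemma dot0r x : dot x 0 = 0.
Proof. by rewrite -(scale0r 0) dotZr mul0r. Qed.

Lemma dot_delta x i : dot x (delta_mx 0 i) = x 0 i.
Proof.
rewrite /dot (bigD1 i) //= big1 ?mxE ?eqxx ?mulr1 ?addr0 // => j ji.
by rewrite mxE (negbTE ji) mulr0.
Qed.

Lemma dot_ge0 x : 0 <= dot x x.
Proof. by apply: sumr_ge0 => i _; rewrite -expr2 sqr_ge0. Qed.

Lemma sqr_enorm x : enorm x ^+ 2 = dot x x.
Proof. by rewrite sqr_sqrtr // dot_ge0. Qed.

Lemma enorm_ge0 x : 0 <= enorm x.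
Proof. exact: sqrtr_ge0. Qed.

Lemma enorm0 : enorm (0 : 'rV[R]_d) = 0.
Proof. by rewrite /enorm dot0r sqrtr0. Qed.

Lemma coord_le_enorm x i : `|x 0 i| <= enorm x.
Proof.
rewrite -(ler_pXn2r (n := 2)) ?nnegrE ?enorm_ge0 // sqr_enorm real_normK ?num_real //.
rewrite /dot (bigD1 i) //= -expr2 lerDl.
by apply: sumr_ge0 => j _; rewrite -expr2 sqr_ge0.
Qed.

Lemma enorm_eq0 x : enorm x = 0 -> x = 0.
Proof.
move=> x0; apply/rowP => i; rewrite mxE; apply/eqP.
by rewrite -normr_le0 -x0 coord_le_enorm.
Qed.

Lemma enormZ a x : enorm (a *: x) = `|a| * enorm x.
Proof.
by rewrite /enorm dotZl dotZr mulrA -expr2 sqrtrM ?sqr_ge0 // sqrtr_sqr.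
Qed.

Lemma enormN x : enorm (- x) = enorm x.
Proof. by rewrite -scaleN1r enormZ normrN1 mul1r. Qed.

Lemma enormBC x y : enorm (x - y) = enorm (y - x).
Proof. by rewrite -enormN opprB. Qed.

Lemma dot_le_enorm x y : dot x y <= enorm x * enorm y.
Proof.
have [/enorm_eq0 ->|x0] := eqVneq (enorm x) 0.
  by rewrite enorm0 mul0r dotC dot0r.
have [/enorm_eq0 ->|y0] := eqVneq (enorm y) 0.
  by rewrite enorm0 mulr0 dot0r.
have x_gt0 : 0 < enorm x by rewrite lt0r x0 enorm_ge0.
have y_gt0 : 0 < enorm y by rewrite lt0r y0 enorm_ge0.
have := dot_ge0 (enorm y *: x - enorm x *: y).
rewrite dotBl !dotBr !dotZl !dotZr -!sqr_enorm (dotC y x).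
set a := enorm x; set b := enorm y; set c := dot x y => h.
have ab : 0 < a * b by rewrite mulr_gt0.
have : 0 <= (a * b) * ((a * b - c) *+ 2).
  by apply: le_trans h _; rewrite le_eqVlt; apply/orP; left; apply/eqP; ring.
by rewrite pmulr_rge0 // pmulrn_lge0 // subr_ge0.
Qed.

Lemma ler_enormD x y : enorm (x + y) <= enorm x + enorm y.
Proof.
rewrite -(ler_pXn2r (n := 2)) ?nnegrE ?addr_ge0 ?enorm_ge0 //.
rewrite sqrrD !sqr_enorm dotDl !dotDr (dotC y x).
have := dot_le_enorm x y; rewrite mulr2n; lra.
Qed.

Lemma ler_enormB x y : enorm (x - y) <= enorm x + enorm y.
Proof. by rewrite -(enormN y) ler_enormD. Qed.

Lemma norm_dot_le x y : `|dot x y| <= enorm x * enorm y.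
Proof. by rewrite ler_norml dot_le_enorm lerNl -dotNr -(enormN y) dot_le_enorm. Qed.

Lemma norm_le_enorm x : `|x| <= enorm x.
Proof.
rewrite [leLHS]/Num.norm /= mx_normrE; apply: bigmax_le => [|[i j] _ /=].
  exact: enorm_ge0.
by rewrite ord1 coord_le_enorm.
Qed.

Lemma coord_le_norm x i : `|x 0 i| <= `|x|.
Proof.
by rewrite [leRHS]/Num.norm /= mx_normrE; apply/bigmax_geP; right => /=; exists (0, i).
Qed.

Lemma enorm_le_norm x : enorm x <= d%:R * `|x|.
Proof.
case: (posnP d) => [d0|d0].
  by rewrite /enorm /dot big1 ?sqrtr0 ?mulr_ge0 ?normr_ge0 // => i _; have := ltn_ord i; rewrite [X in (_ < X)%N]d0.
rewrite -(ler_pXn2r (n := 2)) ?nnegrE ?enorm_ge0 ?mulr_ge0 // sqr_enorm.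
apply: (@le_trans _ _ (\sum_(i < d) `|x| ^+ 2)).
  apply: ler_sum => i _; rewrite -expr2 -(real_normK (num_real _)).
  by rewrite ler_pXn2r ?nnegrE // coord_le_norm.
rewrite sumr_const card_ord exprMn -[leLHS]mulr_natl ler_wpM2r ?sqr_ge0 //.
by rewrite expr2 ler_peMr ?ler0n // ler1n.
Qed.

(** Topology comes from the sup norm; this and [lipschitz_continuous] are the
    bridge to Euclidean estimates. *)
Lemma cvg_enormP {I : Type} (F : set_system I) {FF : Filter F}
    (f : I -> 'rV[R]_d) x :
  f @ F --> x <-> (forall e, 0 < e -> \forall i \near F, enorm (f i - x) < e).
Proof.
split => [fx e e0|fx].
- have d0 : 0 < d%:R + 1 :> R by rewrite ltr_wpDl // ler0n.
  have e1 : 0 < e / (d%:R + 1) by rewrite divr_gt0.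
  move/cvgrPdist_lt : fx => /(_ _ e1); apply: filterS => i.
  rewrite distrC ltr_pdivlMr // => h.
  apply: le_lt_trans h; apply: le_trans (enorm_le_norm _) _.
  by rewrite mulrC ler_wpM2l // lerDl.
- apply/cvgrPdist_lt => e e0; move: (fx e e0); apply: filterS => i h.
  by rewrite distrC; apply: le_lt_trans h; exact: norm_le_enorm.
Qed.

Lemma lipschitz_continuous (c : R) (f : 'rV[R]_d -> R) :
  (forall x y, `|f x - f y| <= c * enorm (x - y)) -> continuous f.
Proof.
move=> hf x; apply/(@cvgrPdist_lt _ _ _ _ (nbhs_filter x)) => e e0.
have c0 : 0 < `|c| + 1 by rewrite ltr_wpDl.
have e1 : 0 < e / (`|c| + 1) by rewrite divr_gt0.
have /(_ _ e1) := (@cvg_enormP _ _ (nbhs_filter x) id x).1 (@cvg_id _ _).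
apply: filterS => y; rewrite ltr_pdivlMr // => h.
rewrite distrC; apply: le_lt_trans h; apply: le_trans (hf _ _) _.
rewrite mulrC ler_wpM2l ?enorm_ge0 //.
by apply: le_trans (ler_norm _) _; rewrite lerDl.
Qed.

Lemma continuous_enorm : continuous (@enorm R d).
Proof.
apply: (@lipschitz_continuous 1) => x y; rewrite mul1r ler_norml.
rewrite lerNl opprB !lerBlDr; apply/andP; split.
  by rewrite enormBC -{1}(subrK x y) ler_enormD.
by rewrite -{1}(subrK y x) ler_enormD.
Qed.

Lemma continuous_dot u : continuous (dot u).
Proof.
apply: (@lipschitz_continuous (enorm u)) => x y.
by rewrite -dotBr norm_dot_le.
Qed.

Lemma compact_enorm_bounded A : compact A -> exists M, forall x, A x -> enorm x <= M.
Proof.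
move=> /compact_bounded [M [_ hM]]; exists (d%:R * (`|M| + 1)) => x Ax.
apply: le_trans (enorm_le_norm x) _; rewrite ler_wpM2l // hM //.
by rewrite ltr_pwDr // ler_norm.
Qed.

Lemma enorm_bounded_compact A M :
  closed A -> (forall x, A x -> enorm x <= M) -> compact A.
Proof.
move=> cA hM; apply: bounded_closed_compact => //.
exists M; split; first exact: num_real.
move=> N MN x Ax; apply: le_trans (norm_le_enorm x) _.
exact: le_trans (hM x Ax) (ltW MN).
Qed.

Lemma closed_unit_sphere : closed (@unit_sphere R d).
Proof.
have -> : @unit_sphere R d = @enorm R d @^-1` [set 1] by [].
by apply: closed_comp => [x _|]; [exact: continuous_enorm|exact: closed_eq].
Qed.

Lemma compact_unit_sphere : compact (@unit_sphere R d).
Proof.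
by apply: (enorm_bounded_compact closed_unit_sphere) => x ->; exact: lexx.
Qed.

Lemma unit_sphere_normalize x : x != 0 -> unit_sphere ((enorm x)^-1 *: x).
Proof.
move=> x0; have x1 : enorm x != 0 by apply: contra_neq x0; exact: enorm_eq0.
by rewrite /unit_sphere /= enormZ ger0_norm ?invr_ge0 ?enorm_ge0 // mulVf.
Qed.

Lemma dot_sphere_le u x : unit_sphere u -> `|dot u x| <= enorm x.
Proof. by move=> u1; rewrite -[leRHS]mul1r -[in leRHS]u1 norm_dot_le. Qed.

(** ** Convexity in coordinates *)

Lemma convex_setP A : convex_set (A : set (convex_lmodType 'rV[R]_d)) <->
  (forall x y t, A x -> A y -> 0 <= t <= 1 -> A (t *: x + (1 - t) *: y)).
Proof.
split => [cA x y t Ax Ay t01|cA x y l /set_mem Ax /set_mem Ay]; last first.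
  apply/mem_set; have := cA x y l%:num Ax Ay.
  by apply; rewrite ge0 le1.
have := cA x y (Itv01 (andP t01).1 (andP t01).2) (mem_set Ax) (mem_set Ay).
by move=> /set_mem.
Qed.

End geometry.

(** * Convex bodies and their support functions *)

Section bodies.
Context {R : realType} {d : nat}.
Implicit Types (x y z u : 'rV[R]_d) (A B C : set 'rV[R]_d).

Definition eball (M : R) : set 'rV[R]_d := [set x | enorm x <= M].

Lemma body_bounded A : convex_body A -> exists2 M, 0 <= M & A `<=` eball M.
Proof.
move=> [_ /compact_enorm_bounded [M hM] _]; exists `|M| => // x Ax.
exact: le_trans (hM x Ax) (ler_norm M).
Qed.

Lemma body_dot_ubound A u : convex_body A -> has_ubound [set dot u a | a in A].
Proof.
move=> /body_bounded [M M0 hM]; exists (enorm u * M) => _ [a /hM aM <-].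
apply: le_trans (dot_le_enorm u a) _.
by rewrite ler_wpM2l ?enorm_ge0.
Qed.

Lemma support_ub A u a : convex_body A -> A a -> dot u a <= support_set A u.
Proof. by move=> bA Aa; apply: ub_le_sup; [exact: body_dot_ubound|exists a]. Qed.

Lemma support_le A u c : convex_body A ->
  (forall a, A a -> dot u a <= c) -> support_set A u <= c.
Proof.
move=> [[a Aa] _ _] h; apply: ge_sup; first by exists (dot u a), a.
by move=> _ [b /h hb <-].
Qed.

Lemma support_attained A u : convex_body A ->
  exists2 a, A a & support_set A u = dot u a.
Proof.
move=> bA; have [A0 cA _] := bA.
have [//|a /set_mem Aa amax] := @EVT_max_rV R d (dot u) A A0 cA.
  exact/continuous_subspaceT/continuous_dot.
exists a => //; apply/le_anti; rewrite support_ub // andbT.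
by apply: support_le => // b Ab; apply: amax; apply/mem_set.
Qed.

Lemma support_subset A B u : convex_body A -> convex_body B -> A `<=` B ->
  support_set A u <= support_set B u.
Proof. by move=> bA bB AB; apply: support_le => // a /AB; exact: support_ub. Qed.

Lemma support_norm A M u : convex_body A -> A `<=` eball M -> unit_sphere u ->
  `|support_set A u| <= M.
Proof.
move=> bA AM u1; have [a Aa ->] := support_attained u bA.
by apply: le_trans (dot_sphere_le _ u1) _; exact: AM.
Qed.

Lemma support_lipschitz A M u v : convex_body A -> A `<=` eball M ->
  `|support_set A u - support_set A v| <= M * enorm (u - v).
Proof.
move=> bA AM.
have half x y : support_set A x - support_set A y <= M * enorm (x - y).
  rewrite lerBlDr; apply: support_le => // a Aa.
  have := support_ub y bA Aa; have := AM a Aa; rewrite /eball /= => aM.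
  have : dot (x - y) a <= M * enorm (x - y).
    apply: le_trans (dot_le_enorm _ _) _.
    by rewrite mulrC ler_wpM2r ?enorm_ge0.
  rewrite dotBl; lra.
by rewrite ler_norml half lerNl opprB enormBC half.
Qed.

Lemma continuous_support A : convex_body A -> continuous (support_set A).
Proof.
move=> bA; have [M _ hM] := body_bounded bA.
by apply: (@lipschitz_continuous _ _ M) => u v; exact: support_lipschitz.
Qed.

Lemma support_point p u : support_set [set p] u = dot u p.
Proof. by rewrite /support_set image_set1 sup1. Qed.

(** ** Minkowski sums and midpoints *)

(** Stated for an arbitrary linear combination, so that it gives both the
    Minkowski sum and the midpoint of two bodies. *)
Definition combine_set (s t : R) A B : set 'rV[R]_d :=
  [set z | exists x y, [/\ A x, B y & z = s *: x + t *: y]].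

Lemma combine_set11 A B : combine_set 1 1 A B = minkowski_sum A B.
Proof.
by apply/seteqP; split => z [x [y [Ax By ->]]]; exists x, y; rewrite !scale1r.
Qed.

Lemma body_combine s t A B : convex_body A -> convex_body B ->
  convex_body (combine_set s t A B).
Proof.
move=> [[a Aa] cA /convex_setP xA] [[b Bb] cB /convex_setP xB]; split.
- by exists (s *: a + t *: b), a, b.
- have -> : combine_set s t A B = (fun p => s *: p.1 + t *: p.2) @` (A `*` B).
    apply/seteqP; split => [z [x [y [Ax By ->]]]|_ [[x y] [Ax By] <-]].
      by exists (x, y).
    by exists x, y.
  apply: continuous_compact; last exact: compact_setX.
  apply: continuous_subspaceT => p.
  by apply: cvgD; (apply: cvgZ; first exact: cvg_cst); [exact: cvg_fst|exact: cvg_snd].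
- apply/convex_setP => _ _ k [x [y [Ax By ->]]] [x' [y' [Ax' By' ->]]] k01.
  exists (k *: x + (1 - k) *: x'), (k *: y + (1 - k) *: y'); split.
  + exact: xA.
  + exact: xB.
  + by rewrite !scalerDr !scalerA !(mulrC k) !(mulrC (1 - k)) addrACA.
Qed.

Lemma support_combine s t A B u : 0 <= s -> 0 <= t ->
  convex_body A -> convex_body B ->
  support_set (combine_set s t A B) u = s * support_set A u + t * support_set B u.
Proof.
move=> s0 t0 bA bB; have bAB := body_combine s t bA bB.
apply/le_anti/andP; split.
  apply: support_le => // _ [x [y [Ax By ->]]].
  by rewrite dotDr !dotZr lerD // ler_wpM2l // support_ub.
have [a Aa ->] := support_attained u bA; have [b Bb ->] := support_attained u bB.
by rewrite -!dotZr -dotDr; apply: support_ub => //; exists a, b.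
Qed.

Lemma body_sum A B : convex_body A -> convex_body B ->
  convex_body (minkowski_sum A B).
Proof. by rewrite -combine_set11; exact: body_combine. Qed.

Lemma support_sum A B u : convex_body A -> convex_body B ->
  support_set (minkowski_sum A B) u = support_set A u + support_set B u.
Proof.
by move=> bA bB; rewrite -combine_set11 support_combine // !mul1r.
Qed.

(** ** Nearest points, and the Hausdorff distance through support functions *)

(** The nearest point [b] of [B] to [x]: moving from [b] towards any other point
    of [B] does not decrease the distance, to first order. *)
Lemma nearest_point B x : convex_body B ->
  exists2 b, B b & forall c, B c -> dot (x - b) (c - b) <= 0.
Proof.
move=> [B0 cB /convex_setP xB].
have [|b /set_mem Bb bmin] := @EVT_min_rV R d (fun b => enorm (b - x)) B B0 cB.
  apply: continuous_subspaceT; apply: (@lipschitz_continuous _ _ 1) => y z.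
  rewrite mul1r ler_norml lerNl opprB !lerBlDr; apply/andP; split.
    by have := ler_enormD (z - y) (y - x); rewrite addrA subrK (enormBC z y).
  by have := ler_enormD (y - z) (z - x); rewrite addrA subrK.
exists b => // c Bc.
have small t : 0 < t <= 1 -> 2 * dot (x - b) (c - b) <= t * enorm (c - b) ^+ 2.
  move=> /andP [t0 t1]; have t01 : 0 <= t <= 1 by rewrite (ltW t0).
  have /bmin : t *: c + (1 - t) *: b \in B by apply/mem_set; exact: xB.
  rewrite -(ler_pXn2r (n := 2)) ?nnegrE ?enorm_ge0 // !sqr_enorm.
  have -> : t *: c + (1 - t) *: b - x = (b - x) + t *: (c - b).
    apply/rowP => i; rewrite !mxE; ring.
  rewrite -(opprB x b); move: (x - b) (c - b) => v w.
  rewrite dotDl !dotDr !dotZl !dotZr !dotNr !(dotC (- v)) !dotNr (dotC w v) => h.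
  rewrite -(ler_pM2l t0); move: h;
 set p := dot v w; set q := dot w w; lra.
rewrite leNgt; apply/negP => h.
set e := dot (x - b) (c - b) in small h.
set q := enorm (c - b) ^+ 2 in small; have q0 : 0 <= q by exact: sqr_ge0.
have k0 : 0 < q + e by rewrite ltr_wpDl.
(* this step size is at most 1, and shorter than [2 * e / q] *)
have : 2 * e <= e / (q + e) * q.
  apply: small; rewrite divr_gt0 //= ler_pdivrMr // mul1r; lra.
rewrite mulrAC ler_pdivlMr // => h2.
have : 0 < e * e by exact: mulr_gt0.
have := mulr_ge0 (ltW h) q0; lra.
Qed.

(** Inclusion of [x] in the [e]-neighbourhood of [B] is tested by the support
    function, in the direction from the nearest point to [x]. *)
Lemma support_near B x e : convex_body B -> 0 <= e ->
  (forall u, unit_sphere u -> dot u x <= support_set B u + e) ->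
  exists2 b, B b & enorm (x - b) <= e.
Proof.
move=> bB e0 h; have [b Bb hb] := nearest_point x bB; exists b => //.
have [->|xb] := eqVneq (x - b) 0; first by rewrite enorm0.
have := h _ (unit_sphere_normalize xb).
set r := enorm (x - b); set u := r^-1 *: (x - b).
have r0 : 0 < r.
  by rewrite lt0r enorm_ge0 andbT; apply: contra_neq xb; exact: enorm_eq0.
have -> : support_set B u = dot u b.
  apply/le_anti; rewrite support_ub // andbT; apply: support_le => // c Bc.
  rewrite -subr_le0 -dotBr dotZl pmulr_rle0 ?invr_gt0 //; exact: hb.
rewrite -lerBlDl -dotBr dotZl -sqr_enorm -/r expr2 mulrA mulVf ?mul1r //.
by rewrite gt_eqF.
Qed.

(** A point outside [B] is separated from [B] by the direction to its nearest point. *)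
Lemma support_le_subset A B : convex_body A -> convex_body B ->
  (forall u, unit_sphere u -> support_set A u <= support_set B u) -> A `<=` B.
Proof.
move=> bA bB h x Ax; have [|b Bb] := @support_near B x 0 bB (lexx 0).
  move=> u u1; rewrite addr0; apply: le_trans (h u u1); exact: support_ub.
move=> xb; have /eqP := enorm_eq0 (le_anti (introT andP (conj xb (enorm_ge0 _)))).
by rewrite subr_eq0 => /eqP ->.
Qed.

Lemma support_inj A B : convex_body A -> convex_body B ->
  (forall u, unit_sphere u -> support_set A u = support_set B u) -> A = B.
Proof.
by move=> bA bB h; apply/seteqP; split; apply: support_le_subset => // u /h ->.
Qed.

Lemma hausdorff_distC A B : hausdorff_dist A B = hausdorff_dist B A.
Proof.
rewrite /hausdorff_dist maxC; congr (Num.max (sup _) (sup _)).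
  by apply: eq_imagel => b _; congr inf; apply: eq_imagel => a _; rewrite enormBC.
by apply: eq_imagel => b _; congr inf; apply: eq_imagel => a _; rewrite enormBC.
Qed.

Let dist_lbound A x : has_lbound [set enorm (x - b) | b in A].
Proof. by exists 0 => _ [b _ <-]; exact: enorm_ge0. Qed.

(** Together with [support_hausdorff_dist]: the Hausdorff distance is the uniform
    distance of support functions on the sphere. *)
Lemma hausdorff_dist_le A B e : convex_body A -> convex_body B -> 0 <= e ->
  (forall u, unit_sphere u -> `|support_set A u - support_set B u| <= e) ->
  hausdorff_dist A B <= e.
Proof.
have half A' B' : convex_body A' -> convex_body B' -> 0 <= e ->
  (forall u, unit_sphere u -> `|support_set A' u - support_set B' u| <= e) ->
  sup [set inf [set enorm (a - b) | b in B'] | a in A'] <= e.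
  move=> bA bB e0 h; have [[a0 Aa0] _ _] := bA.
  apply: ge_sup; first by eexists; exists a0.
  move=> _ [a Aa <-]; have [|b Bb] := @support_near B' a e bB e0.
    move=> u u1; have := support_ub u bA Aa.
    by have := h u u1; rewrite ler_norml => /andP[_]; lra.
  by apply: le_trans; apply: ge_inf => //; exists b.
move=> bA bB e0 h; rewrite ge_max half //=.
have := half B A bB bA e0; under eq_imagel => b _ do
  under eq_imagel => a _ do rewrite enormBC.
by apply => u u1; rewrite distrC h.
Qed.

Lemma support_hausdorff_dist A B u : convex_body A -> convex_body B ->
  unit_sphere u -> `|support_set A u - support_set B u| <= hausdorff_dist A B.
Proof.
have half A' B' : convex_body A' -> convex_body B' -> unit_sphere u ->
    support_set A' u - support_set B' u <= hausdorff_dist A' B'.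
  move=> bA bB u1; have [a Aa ->] := support_attained u bA.
  have [[b0 Bb0] _ _] := bB; have [M _ hM] := body_bounded bA.
  set D := hausdorff_dist _ _.
  have aD : inf [set enorm (a - b) | b in B'] <= D.
    rewrite /D /hausdorff_dist le_max; apply/orP; left.
    apply: ub_le_sup; last by exists a.
    exists (M + enorm b0) => _ [c Ac <-].
    apply: le_trans (ge_inf _ _) _; [by []|by exists b0|].
    by apply: le_trans (ler_enormB _ _) _; rewrite lerD2r; exact: hM.
  apply/ler_addgt0Pr => e e0.
  have [|_ [b Bb <-] hb] := @inf_adherent R [set enorm (a - b) | b in B'] e e0.
    by split => //; eexists; exists b0.
  have := support_ub u bB Bb; have := dot_sphere_le (a - b) u1.
  rewrite dotBr ler_norml => /andP[_]; lra.
move=> bA bB u1; rewrite ler_norml half // lerNl opprB hausdorff_distC half //.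
Qed.

End bodies.

(** * Lebesgue measure of boxes, and measurability of continuous functions *)

Section boxes.
Context {R : realType}.

Definition box n (x : 'rV[R]_n) (r : R) : set 'rV[R]_n :=
  [set y | forall i, `|y 0 i - x 0 i| <= r].

Lemma measurable_box n (x : 'rV[R]_n) r : measurable (box x r).
Proof.
have -> : box x r =
    \bigcap_(i in [set: 'I_n]) (@row_coord R n i @^-1` `[x 0 i - r, x 0 i + r]).
  apply/seteqP; split => [y yx i _|y yx i].
    by rewrite /row_coord /= in_itv /=; have := yx i; rewrite ler_distl.
  by have := yx i Logic.I; rewrite /row_coord /= in_itv /= ler_distl.
apply: fin_bigcap_measurable; first exact: finite_finset.
move=> i _; rewrite -[X in measurable X]setTI.
by apply: measurable_row_coord => //; exact: measurable_itv.
Qed.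

(** Boxes are the balls of the sup norm; comparison with them gives all the bounds
    on volumes that are needed, from above and from below. *)
Lemma lebesgue_row_box n (x : 'rV[R]_n) r : 0 <= r ->
  lebesgue_row n (box x r) = ((r *+ 2) ^+ n)%:E.
Proof.
move=> r0; elim: n x => [|n IH] x.
  by rewrite expr0 /= diracE mem_set // => -[].
have -> : lebesgue_row n.+1 (box x r) =
    (lebesgue_row n \x @lebesgue_measure R)%E (@row_cons R n @^-1` box x r) by [].
have -> : @row_cons R n @^-1` box x r =
    box (\row_j x 0 (lift ord0 j)) r `*` `[x 0 0 - r, x 0 0 + r]%classic.
  apply/seteqP; split => [[y t] h|[y t] [h1 h2] i].
    split => [j|]; rewrite /= ?mxE.
      have := h (lift ord0 j); rewrite /row_cons /=.
      have -> : lift ord0 j = rshift 1 j by exact/val_inj.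
      by rewrite (@row_mxEr _ 1 1 n).
    rewrite in_itv /=; have := h 0; rewrite /row_cons /=.
    have -> : 0 = lshift n 0 :> 'I_(1 + n) by exact/val_inj.
    by rewrite (@row_mxEl _ 1 1 n) mxE eqxx mulr1n ler_distl.
  have [j ->|j ->] := split_ordP (i : 'I_(1 + n)).
    rewrite /row_cons /= (@row_mxEl _ 1 1 n) ord1 mxE eqxx mulr1n.
    move: h2; rewrite /= in_itv /= -ler_distl.
    by have -> : lshift n 0 = 0 :> 'I_(1 + n) by exact/val_inj.
  rewrite /row_cons /= (@row_mxEr _ 1 1 n); have := h1 j; rewrite mxE.
  by have -> : lift ord0 j = rshift 1 j by exact/val_inj.
rewrite product_measure1E; [|exact: measurable_box|exact: measurable_itv].
rewrite IH; apply: etrans (congr1 (mule _) (lebesgue_measure_itv _)) _.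
rewrite /= lte_fin.
have [rr|] := ltP (x 0 0 - r) (x 0 0 + r).
  by rewrite -EFinD -EFinM exprSr; congr (_ * _)%:E; rewrite mulr2n; ring.
move=> rr; have -> : r = 0 by lra.
by rewrite mule0 mul0rn exprS mul0r.
Qed.

Lemma nbhs_box n (x : 'rV[R]_n) (U : set 'rV[R]_n) :
  nbhs x U -> exists2 r, 0 < r & box x r `<=` U.
Proof.
move=> /nbhs_ballP [e /= e0 eU]; exists (e / 2); first exact: divr_gt0.
move=> y yx; apply: eU; split => // i j; rewrite !ord1 -ball_normE /= distrC.
by apply: le_lt_trans (yx j) _; rewrite ltr_pdivrMr // ltr_pMr // ltr1n.
Qed.

(** Open sets are countable unions of rational boxes, hence belong to the
    sigma-algebra generated by the coordinates. *)
Lemma open_measurable_row n (U : set 'rV[R]_n) : open U -> measurable U.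
Proof.
move=> oU; pose c (q : 'rV[rat]_n * nat) : 'rV[R]_n := \row_i ratr (q.1 0 i).
pose F q := if pselect (box (c q) q.2.+1%:R^-1 `<=` U)
  then box (c q) q.2.+1%:R^-1 else set0.
suff -> : U = \bigcup_q F q.
  apply: countable_bigcupT_measurable => [|q]; first exact: countableP.
  rewrite /F; case: (pselect _) => h; [exact: measurable_box|exact: measurable0].
apply/seteqP; split => [x Ux|x [q _]]; last first.
  by rewrite /F; case: (pselect _) => h //; exact: h.
have [r r0 rU] := nbhs_box (open_nbhs_nbhs (conj oU Ux)).
have [k kr] : exists k, k.+1%:R^-1 < r / 2 :> R.
  have [|k] := @ltr_add_invr R 0 (r / 2); first by rewrite divr_gt0.
  by rewrite add0r; exists k.
have k0 : 0 < k.+1%:R^-1 :> R by rewrite invr_gt0 ltr0n.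
have /choice [q hq] : forall i, exists q : rat, `|x 0 i - ratr q| < k.+1%:R^-1.
  move=> i; have [|q] := @rat_in_itvoo R (x 0 i - k.+1%:R^-1) (x 0 i + k.+1%:R^-1).
    by rewrite ltrD2l (lt_trans _ k0) // oppr_lt0.
  by rewrite in_itv /= -ltr_distl distrC; exists q.
exists (\row_i q i, k) => //; rewrite /F; case: (pselect _) => [h i|[]].
  by rewrite !mxE ltW.
move=> y hy; apply: rU => i; have := hy i; have := hq i; rewrite !mxE /= => h1 h2.
rewrite -(subrK (ratr (q i)) (y 0 i)) -addrA; apply: le_trans (ler_normD _ _) _.
rewrite (distrC (ratr _)); move: h1 h2 kr.
move: `|_| `|_| k.+1%:R^-1 => a b w; lra.
Qed.

Lemma continuous_measurable_row n (f : 'rV[R]_n -> R) :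
  continuous f -> measurable_fun [set: 'rV[R]_n] f.
Proof.
move=> /continuousP cf; apply: (measurability _ (RGenOpens.measurableE R)).
move=> _ [_ [a [b ->] <-]]; rewrite setTI; apply: open_measurable_row.
by apply: cf; exact: interval_open.
Qed.

End boxes.

(** * Integration of continuous functions over the sphere *)

Section sphere_integral.
Context (R : realType) (d : nat).
Implicit Types f g : 'rV[R]_d -> R.
Local Notation sigma := (@surface_measure R d).
Local Notation S := (@unit_sphere R d).

Lemma measurable_unit_sphere : measurable S.
Proof.
have -> : S = setT `&` (@enorm R d @^-1` [set 1]) by rewrite setTI.
by apply: measurable_enorm => //; exact: measurable_set1.
Qed.

Lemma surface_measureE (A : set 'rV[R]_d) :
  sigma A = (d%:R%:E * lebesgue_row d
     ((@direction R d @^-1` A) `&` @punctured_ball R d))%E.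
Proof. by []. Qed.

Lemma unit_ball_box (x : 'rV[R]_d) : enorm x <= 1 -> box 0 1 x.
Proof.
by move=> x1 i; rewrite mxE subr0; apply: le_trans x1; exact: coord_le_enorm.
Qed.

Lemma surface_measure_lty : (sigma S < +oo)%E.
Proof.
rewrite surface_measureE; apply: (@le_lt_trans _ _ (d%:R%:E * (2 ^+ d)%:E)%E).
  rewrite lee_wpmul2l ?lee_fin // -[leRHS](@lebesgue_row_box R d 0 1 ler01).
  apply: le_measure; rewrite ?inE.
  - apply: measurableI; last exact: measurable_punctured_ball.
    rewrite -[X in measurable X]setTI.
    by apply: measurable_direction => //; exact: measurable_unit_sphere.
  - exact: measurable_box.
  - by move=> x [_ /andP[_ x1]]; exact: unit_ball_box.
by rewrite -EFinM ltry.
Qed.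

Definition sphere_int f : R := \int[sigma]_(u in S) f u.

Lemma sphere_integrable f : continuous f -> sigma.-integrable S (EFin \o f).
Proof.
move=> cf; apply: measurable_bounded_integrable.
- exact: measurable_unit_sphere.
- exact: surface_measure_lty.
- by apply: measurable_funTS; exact: continuous_measurable_row.
- have /compact_bounded [M [_ hM]] :=
    continuous_compact (continuous_subspaceT cf) (@compact_unit_sphere R d).
  by exists M; split; rewrite ?num_real // => a aM u Su; apply: hM => //; exists u.
Qed.

Lemma sphere_intD f g : continuous f -> continuous g ->
  sphere_int (fun u => f u + g u) = sphere_int f + sphere_int g.
Proof.
by move=> cf cg; apply: RintegralD;
  [exact: measurable_unit_sphere|exact: sphere_integrable|exact: sphere_integrable].
Qed.

Lemma sphere_intZ c f : continuous f ->
  sphere_int (fun u => c * f u) = c * sphere_int f.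
Proof.
by move=> cf; apply: RintegralZl;
  [exact: measurable_unit_sphere|exact: sphere_integrable].
Qed.

Lemma sphere_int_cst c : sphere_int (fun=> c) = c * sphere_area R d.
Proof. by rewrite /sphere_int Rintegral_cst //; exact: measurable_unit_sphere. Qed.

Lemma le_sphere_int f g : continuous f -> continuous g ->
  (forall u, S u -> f u <= g u) -> sphere_int f <= sphere_int g.
Proof.
by move=> cf cg fg; apply: le_Rintegral => //;
  [exact: measurable_unit_sphere|exact: sphere_integrable|exact: sphere_integrable].
Qed.

Lemma eq_sphere_int f g : (forall u, S u -> f u = g u) ->
  sphere_int f = sphere_int g.
Proof. by move=> fg; apply: eq_Rintegral => u /set_mem; exact: fg. Qed.

Lemma sphere_int_ge0 f : (forall u, S u -> 0 <= f u) -> 0 <= sphere_int f.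
Proof. exact: Rintegral_ge0. Qed.

Lemma sphere_area_ge0 : 0 <= sphere_area R d.
Proof. by rewrite -[leRHS]mul1r -sphere_int_cst; exact: sphere_int_ge0. Qed.

(** The cone over an open part of the sphere contains a small box around the midpoint
    of each of its rays. *)
Lemma surface_measure_open_gt0 (V : set 'rV[R]_d) u :
  (0 < d)%N -> open V -> V u -> S u -> (0 < sigma (S `&` V))%E.
Proof.
move=> d0 oV Vu Su; pose x := 2^-1 *: u.
have ex : enorm x = 2^-1 by rewrite enormZ Su mulr1 ger0_norm // invr_ge0.
have dx : direction x = u.
  by rewrite /direction ex invrK /x scalerA divff ?pnatr_eq0 // scale1r.
have cd : direction y @[y --> x] --> direction x.
  apply: (@cvgZ _ _ _ _ (nbhs_filter x) (fun y => (enorm y)^-1) id); last exact: cvg_id.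
  apply: (@cvgV _ _ _ (nbhs_filter x)); first by rewrite ex invr_eq0 pnatr_eq0.
  exact: continuous_enorm.
have : \forall y \near x, V (direction y) /\ (0 < enorm y <= 1).
  apply: filterI; first by apply: cd; rewrite dx; exact: open_nbhs_nbhs.
  have : \forall y \near x, `|enorm x - enorm y| < 2^-1.
    apply: ((@cvgrPdist_lt _ _ _ _ (nbhs_filter x) _ _).1 (@continuous_enorm R d x)).
    by rewrite invr_gt0.
  apply: filterS => y; rewrite ex ltr_distl => /andP[h1 h2].
  by apply/andP; split; lra.
move=> /nbhs_box [r r0 hr]; rewrite surface_measureE mule_gt0 ?lte_fin ?ltr0n //.
apply: (@lt_le_trans _ _ (lebesgue_row d (box x r))).
  by rewrite lebesgue_row_box ?(ltW r0) // lte_fin exprn_gt0 // pmulrn_lgt0.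
apply: le_measure; rewrite ?inE.
- exact: measurable_box.
- apply: measurableI; last exact: measurable_punctured_ball.
  rewrite -[X in measurable X]setTI; apply: measurable_direction => //.
  apply: measurableI; first exact: measurable_unit_sphere.
  exact: open_measurable_row.
- move=> y /hr [Vy /andP[y0 y1]]; split; last by rewrite /punctured_ball /= y0.
  split => //; apply: unit_sphere_normalize; apply: contraTneq y0 => ->.
  by rewrite enorm0 ltxx.
Qed.

(** If [f] is positive at a point of the sphere, it is bounded below by a positive
    constant on an open set around it, which has positive surface measure. *)
Lemma sphere_int_eq0 f : (0 < d)%N -> continuous f ->
  (forall u, S u -> 0 <= f u) -> sphere_int f = 0 -> forall u, S u -> f u = 0.
Proof.
move=> d0 cf f0 If u Su; apply/eqP; apply: contrapT => /negP fu.
have fu0 : 0 < f u by rewrite lt0r fu f0.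
pose V := [set v | f u / 2 < f v].
have oV : open V.
  have -> : V = f @^-1` [set y | f u / 2 < y] by [].
  by move/continuousP : cf; apply; exact: open_gt.
have Vu : V u by rewrite /V /= ltr_pdivrMr // ltr_pMr // ltr1n.
have := surface_measure_open_gt0 d0 oV Vu Su.
have mV := open_measurable_row oV; have mS := measurable_unit_sphere.
have I0 : (\int[sigma]_(v in S) (f v)%:E = 0)%E.
  rewrite -[LHS]fineK; first by rewrite [fine _]If.
  exact: integrable_fin_num (sphere_integrable cf).
have : ((f u / 2)%:E * sigma (S `&` V) <= 0)%E.
  rewrite -I0 -integral_cst; last exact: measurableI.
  apply: (@le_trans _ _ (\int[sigma]_(v in S `&` V) (f v)%:E)%E).
    apply: ge0_le_integral => //.
    - exact: measurableI.
    - by move=> v _; rewrite lee_fin divr_ge0 // ltW.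
    - apply/measurable_EFinP/measurable_funTS; exact: continuous_measurable_row.
    - by move=> v [_ /ltW]; rewrite lee_fin.
  apply: ge0_subset_integral => //.
  - exact: measurableI.
  - apply/measurable_EFinP/measurable_funTS; exact: continuous_measurable_row.
rewrite pmule_rle0 ?lte_fin ?divr_gt0 // => h1 h2.
by have := lt_le_trans h2 h1; rewrite ltxx.
Qed.

Lemma unit_sphere_nonempty : (0 < d)%N -> S !=set0.
Proof.
move=> d0; exists (delta_mx 0 (Ordinal d0)).
by rewrite /unit_sphere /= /enorm dot_delta mxE !eqxx sqrtr1.
Qed.

Lemma sphere_area_gt0 : (0 < d)%N -> 0 < sphere_area R d.
Proof.
move=> d0; rewrite lt0r sphere_area_ge0 andbT; apply/eqP => a0.
have [u Su] := unit_sphere_nonempty d0.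
have := @sphere_int_eq0 (fun=> 1) d0 (fun x => @cvg_cst _ _ _ _ (nbhs_filter x)).
rewrite sphere_int_cst a0 mulr0 => /(_ (fun _ _ => ler01) erefl u Su) /eqP.
by rewrite oner_eq0.
Qed.

Lemma ball_volume_gt0 : 0 < ball_volume R d.
Proof.
rewrite /ball_volume; pose r : R := d.+1%:R^-1.
have r0 : 0 < r by rewrite invr_gt0 ltr0n.
have mB : measurable (@unit_ball R d).
  have -> : @unit_ball R d = setT `&` (@enorm R d @^-1` `]-oo, 1]%classic).
    by apply/seteqP; split => x /=; rewrite in_itv /= => // -[].
  by apply: measurable_enorm => //; exact: measurable_itv.
apply: fine_gt0; apply/andP; split; last first.
  apply: (@le_lt_trans _ _ (lebesgue_row d (box 0 1))).
    by apply: le_measure; rewrite ?inE //; [exact: measurable_box|exact: unit_ball_box].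
  by rewrite lebesgue_row_box // ltry.
apply: (@lt_le_trans _ _ (lebesgue_row d (box 0 r))).
  by rewrite lebesgue_row_box ?(ltW r0) // lte_fin exprn_gt0 // pmulrn_lgt0.
apply: le_measure; rewrite ?inE //; first exact: measurable_box.
move=> x hx; rewrite /unit_ball /=; apply: le_trans (enorm_le_norm x) _.
apply: (@le_trans _ _ (d%:R * r)).
  rewrite ler_wpM2l // [leLHS]/Num.norm /= mx_normrE; apply: bigmax_le => [|[i j] _].
    exact: ltW.
  by have := hx j; rewrite mxE subr0 ord1.
by rewrite ler_pdivrMr ?ltr0n // mul1r ler_nat.
Qed.

End sphere_integral.

(** * Monotone functions on the unit interval and their Riemann sums *)

Section monotone.
Context {R : realType}.
Implicit Types f g p : R -> R.
Local Notation mu := (@lebesgue_measure R).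

Definition nonincreasing01 f : Prop :=
  forall x y, 0 <= x -> x <= y -> y <= 1 -> f y <= f x.

Definition int01 f : R := \int[mu]_(a in `[0%R, 1%R]) f a.

Definition riemann (N : nat) f : R := N.+1%:R^-1 * \sum_(0 <= k < N.+1) f (k.+1%:R / N.+1%:R).

Let mu_itv (b1 b2 : bool) (x y : R) : x <= y ->
  mu [set` Interval (BSide b1 x) (BSide b2 y)] = (y - x)%:E.
Proof.
move=> xy; apply: etrans (lebesgue_measure_itv _) _; rewrite /= lte_fin.
have [_|yx] := ltP x y; first by rewrite -EFinB.
by have -> : y = x; [apply/le_anti; rewrite yx|rewrite subrr].
Qed.

Lemma nonincreasing01_integrable f : nonincreasing01 f ->
  mu.-integrable `[0%R, 1%R] (EFin \o f).
Proof.
move=> hf; apply: measurable_bounded_integrable => //.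
- by rewrite [ltLHS](mu_itv true false ler01) ltry.
- pose clamp x : R := Num.max 0 (Num.min x 1).
  apply: (@eq_measurable_fun _ _ _ _ _ (f \o clamp)).
    move=> x; rewrite inE /= in_itv /= /clamp => /andP[x0 x1].
    by rewrite (min_idPl x1) (max_idPr x0).
  apply: nonincreasing_measurable => // x y xy; apply: hf.
  - by rewrite le_max lexx.
  - rewrite /clamp ge_max !le_max lexx /=; apply/orP; right.
    by rewrite le_min !ge_min xy lexx orbT.
  - by rewrite ge_max ler01 ge_min lexx orbT.
- exists (`|f 0| + `|f 1|); split; first exact: num_real.
  move=> M hM x /=; rewrite in_itv /= => /andP[x0 x1].
  apply: le_trans (ltW hM); have := hf x 1 x0 x1 (lexx _); have := hf 0 x (lexx _) x0 x1.
  have := ler_norm (f 0); have := ler_norm (- f 1); rewrite normrN.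
  have := normr_ge0 (f 0); have := normr_ge0 (f 1).
  by rewrite ler_norml; move: `|f 0| `|f 1| => a b h1 h2 h3 h4 h5 h6; apply/andP; split; lra.
Qed.

Lemma int01_between f x y : nonincreasing01 f -> 0 <= x -> x <= y -> y <= 1 ->
  (y - x) * f y <= \int[mu]_(a in `[0%R, y]) f a - \int[mu]_(a in `[0%R, x]) f a
    <= (y - x) * f x.
Proof.
move=> hf x0 xy y1.
have iy : mu.-integrable `[0%R, y] (EFin \o f).
  apply: integrableS (nonincreasing01_integrable hf) => //.
  by apply: subset_itvl; rewrite bnd_simp.
have ixy : mu.-integrable `]x, y] (EFin \o f).
  apply: integrableS iy => //.
  by apply: subset_itvr; rewrite bnd_simp.
rewrite Rintegral_itvB // ?bnd_simp //.
have cst c : \int[mu]_(a in `]x, y]) c = (y - x) * c.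
  by rewrite Rintegral_cst // [X in _ * fine X](mu_itv false false xy) mulrC.
have ic c : mu.-integrable `]x, y] (EFin \o fun=> c).
  apply: measurable_bounded_integrable => //.
  - by rewrite [ltLHS](mu_itv false false xy) ltry.
  - exact: bounded_cst.
apply/andP; split; rewrite -cst; apply: le_Rintegral => // a /=;
  rewrite in_itv /= => /andP[xa ay].
- by apply: hf => //; rewrite ?(le_trans x0) // ltW.
- by apply: hf => //; rewrite ?(ltW xa) // (le_trans ay).
Qed.

(** Telescoping over the primitive of [f]. *)
Lemma riemann_bounds f N : nonincreasing01 f ->
  riemann N f <= int01 f <= riemann N f + N.+1%:R^-1 * (f 0 - f 1).
Proof.
move=> hf; have N0 : 0 < N.+1%:R :> R by rewrite ltr0n.
pose t k : R := k%:R / N.+1%:R; pose F x := \int[mu]_(a in `[0%R, x]) f a.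
have t0 : t 0 = 0 by rewrite /t mul0r.
have tN : t N.+1 = 1 by rewrite /t divff // gt_eqF.
have dt k : t k.+1 - t k = N.+1%:R^-1.
  by rewrite /t -mulrBl -natr1 addrAC subrr add0r mul1r.
have F0 : F 0 = 0 by rewrite /F set_itv1 Rintegral_set1.
have sumF : int01 f = \sum_(0 <= k < N.+1) (F (t k.+1) - F (t k)).
  by rewrite (telescope_sumr (F \o t)) //= tN t0 F0 subr0.
have step k : (0 <= k < N.+1)%N ->
    N.+1%:R^-1 * f (t k.+1) <= F (t k.+1) - F (t k) <= N.+1%:R^-1 * f (t k).
  move=> /andP[_ kN]; rewrite -(dt k); apply: int01_between => //.
  - by rewrite /t divr_ge0.
  - by rewrite -subr_ge0 dt invr_ge0 ltW.
  - by rewrite /t ler_pdivrMr // mul1r ler_nat.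
rewrite sumF /riemann big_distrr /=; apply/andP; split.
  by rewrite !big_nat; apply: ler_sum => k /step /andP[].
apply: (@le_trans _ _ (\sum_(0 <= k < N.+1) N.+1%:R^-1 * f (t k))).
  by rewrite !big_nat; apply: ler_sum => k /step /andP[].
rewrite -!big_distrr /= -mulrDr ler_wpM2l ?invr_ge0 ?(ltW N0) //.
rewrite -lerBlDl -sumrB.
have <- : \sum_(0 <= k < N.+1) (f (t k) - f (t k.+1)) = f 0 - f 1.
  have -> : f 0 - f 1 = - ((f \o t) N.+1 - (f \o t) 0%N).
    by rewrite /= tN t0 opprB.
  rewrite -telescope_sumr // -sumrN.
  by apply: eq_bigr => k _; rewrite opprB.
exact: lexx.
Qed.

(** Jordan decomposition of a function of bounded variation. *)
Definition monotone_difference f : Prop :=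
  exists p q, [/\ nonincreasing01 p, nonincreasing01 q &
    forall a, 0 <= a <= 1 -> f a = p a - q a].

Lemma monotone_difference_integrable f : monotone_difference f ->
  mu.-integrable `[0%R, 1%R] (EFin \o f).
Proof.
move=> [p [q [hp hq fE]]].
apply: (@eq_integrable _ _ _ mu _ _ ((EFin \o p) \- (EFin \o q))%E) => //.
  by move=> a; rewrite inE /= in_itv /= => /fE ->; rewrite EFinB.
by apply: integrableB => //; exact: nonincreasing01_integrable.
Qed.

Lemma monotone_differenceD f g : monotone_difference f -> monotone_difference g ->
  monotone_difference (fun a => f a + g a).
Proof.
move=> [p [q [hp hq fE]]] [p' [q' [hp' hq' gE]]].
exists (fun a => p a + p' a), (fun a => q a + q' a); split.
- by move=> x y x0 xy y1; apply: lerD; [exact: hp|exact: hp'].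
- by move=> x y x0 xy y1; apply: lerD; [exact: hq|exact: hq'].
- by move=> a a01; rewrite fE // gE // opprD addrACA.
Qed.

Lemma monotone_differenceZ c f : monotone_difference f ->
  monotone_difference (fun a => c * f a).
Proof.
move=> [p [q [hp hq fE]]]; have [c0|c0] := leP 0 c.
  exists (fun a => c * p a), (fun a => c * q a); split.
  - by move=> x y x0 xy y1; rewrite ler_wpM2l //; exact: hp.
  - by move=> x y x0 xy y1; rewrite ler_wpM2l //; exact: hq.
  - by move=> a a01; rewrite fE // mulrBr.
have Nc0 : 0 <= - c by rewrite oppr_ge0 ltW.
exists (fun a => - c * q a), (fun a => - c * p a); split.
- by move=> x y x0 xy y1; rewrite ler_wpM2l //; exact: hq.
- by move=> x y x0 xy y1; rewrite ler_wpM2l //; exact: hp.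
- move=> a a01; rewrite fE //; ring.
Qed.

Lemma int01D f g : monotone_difference f -> monotone_difference g ->
  int01 (fun a => f a + g a) = int01 f + int01 g.
Proof. by move=> hf hg; apply: RintegralD => //; exact: monotone_difference_integrable. Qed.

Lemma int01Z c f : monotone_difference f -> int01 (fun a => c * f a) = c * int01 f.
Proof. by move=> hf; apply: RintegralZl => //; exact: monotone_difference_integrable. Qed.

Lemma int01_cst c : int01 (fun=> c) = c.
Proof.
rewrite /int01 Rintegral_cst // [X in _ * fine X](mu_itv true false ler01).
by rewrite /= subr0 mulr1.
Qed.

Lemma eq_int01 f g : (forall a, 0 <= a <= 1 -> f a = g a) -> int01 f = int01 g.
Proof. by move=> fg; apply: eq_Rintegral => a; rewrite inE /= in_itv /=; exact: fg. Qed.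

Lemma le_int01 f g : monotone_difference f -> monotone_difference g ->
  (forall a, 0 <= a <= 1 -> f a <= g a) -> int01 f <= int01 g.
Proof.
move=> hf hg fg; apply: le_Rintegral => //.
- exact: monotone_difference_integrable.
- exact: monotone_difference_integrable.
Qed.

Lemma int01_ge0 f : (forall a, 0 <= a <= 1 -> 0 <= f a) -> 0 <= int01 f.
Proof. by move=> f0; apply: Rintegral_ge0 => a /=; rewrite in_itv /=; exact: f0. Qed.

Lemma cvg_invSn c : (N.+1%:R^-1 * c) @[N --> \oo] --> (0 : R).
Proof.
rewrite -(mul0r c); apply: cvgMr_tmp; exact: cvg_harmonic.
Qed.

Lemma riemann_cvg_nonincreasing f : nonincreasing01 f ->
  riemann N f @[N --> \oo] --> int01 f.
Proof.
move=> hf; pose e N := N.+1%:R^-1 * (f 0 - f 1).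
apply: (@squeeze_cvgr _ _ _ _ (fun N => int01 f - e N) (fun=> int01 f)).
- near=> N; have /andP[h1 h2] := riemann_bounds N hf.
  by rewrite h1 andbT lerBlDr.
- by rewrite -[X in _ --> X]subr0; apply: cvgB; [exact: cvg_cst|exact: cvg_invSn].
- exact: cvg_cst.
Unshelve. all: by end_near. Qed.

Lemma riemann_cvg f : monotone_difference f -> riemann N f @[N --> \oo] --> int01 f.
Proof.
move=> [p [q [hp hq fE]]].
have -> : int01 f = int01 p - int01 q.
  rewrite (eq_int01 fE); apply: RintegralB => //; exact: nonincreasing01_integrable.
have -> : (fun N => riemann N f) = (fun N => riemann N p - riemann N q).
  apply/funext => N; rewrite /riemann -mulrBr -sumrB; congr (_ * _).
  rewrite !big_nat; apply: eq_bigr => k /andP[_ kN]; apply: fE.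
  by rewrite divr_ge0 //= ler_pdivrMr ?ltr0n // mul1r ler_nat.
by apply: cvgB; exact: riemann_cvg_nonincreasing.
Qed.

(** Helly's selection principle without the selection: along a filter, uniformly
    bounded monotone functions that converge pointwise to [p] have integrals
    converging to that of any [f] squeezed between [p] and its left limits.  The
    point is that Riemann sums approximate all these integrals uniformly. *)
Lemma int01_cvg_monotone (F : set_system nat) {FF : ProperFilter F}
    (fn : nat -> R -> R) p f c :
  (forall n, nonincreasing01 (fn n)) -> nonincreasing01 f ->
  (forall n a, 0 <= a <= 1 -> 0 <= fn n a <= c) ->
  (forall a, 0 <= a <= 1 -> 0 <= f a <= c) ->
  (forall a, 0 < a <= 1 -> fn n a @[n --> F] --> p a) ->
  (forall a, 0 < a <= 1 -> p a <= f a) ->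
  (forall a b, 0 < a -> a < b -> b <= 1 -> f b <= p a) ->
  int01 (fn n) @[n --> F] --> int01 f.
Proof.
move=> hfn hf fnc fc fnp pf fp.
have c0 : 0 <= c by have /andP[] := fc 0 (introT andP (conj (lexx 0) ler01)); exact: le_trans.
apply/cvgrPdist_lt => e e0.
have e4 : 0 < e / 4 by rewrite divr_gt0.
have [N hN] : exists N, N.+1%:R^-1 * c < e / 4.
  have [N _ hN] := (@cvgrPdist_lt _ _ _ _ _ _ _).1 (@cvg_invSn c) _ e4.
  exists N; have := hN N (leqnn N); rewrite sub0r normrN.
  exact: le_lt_trans (ler_norm _).
have N0 : 0 < N.+1%:R :> R by rewrite ltr0n.
have grid k : (k <= N)%N -> 0 < (k.+1%:R / N.+1%:R : R) <= 1.
  by move=> kN; rewrite divr_gt0 //= ler_pdivrMr // mul1r ler_nat.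
have pc a : 0 < a <= 1 -> 0 <= p a <= c.
  move=> /andP[a0 a1]; have a01 : 0 <= a <= 1 by rewrite ltW.
  apply/andP; split.
    apply: (cvgr_to_ge (fnp a (introT andP (conj a0 a1)))).
    by apply: nearW => n; have /andP[] := fnc n a a01.
  by apply: le_trans (pf a _) _; rewrite ?a0 //; have /andP[] := fc a a01.
have Rp : riemann N (fn n) @[n --> F] --> riemann N p.
  apply: cvgMl_tmp; rewrite [X in _ --> X]big_nat.
  under eq_cvg do rewrite big_nat.
  apply: (@cvg_big R nat +%R 0 (fun k => 0 <= k < N.+1)%N); first exact: add_continuous.
  by move=> k /andP[_ kN]; apply: fnp; exact: grid.
have close g : nonincreasing01 g -> (forall a, 0 <= a <= 1 -> 0 <= g a <= c) ->
    riemann N g <= int01 g < riemann N g + e / 4.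
  move=> hg gc; have /andP[h1 h2] := riemann_bounds N hg; rewrite h1 /=.
  apply: le_lt_trans h2 _; rewrite ltrD2l; apply: le_lt_trans hN.
  rewrite ler_wpM2l ?invr_ge0 ?(ltW N0) //.
  have /andP[_ g0] := gc 0 (introT andP (conj (lexx 0) ler01)).
  have /andP[g1 _] := gc 1 (introT andP (conj ler01 (lexx 1))); lra.
have Rpf : riemann N p <= riemann N f <= riemann N p + e / 4.
  rewrite /riemann; apply/andP; split.
    rewrite ler_wpM2l ?invr_ge0 ?(ltW N0) // !big_nat.
    by apply: ler_sum => k /andP[_ kN]; apply: pf; exact: grid.
  apply: le_trans (lerD (lexx _) (ltW hN)); rewrite -mulrDr.
  rewrite ler_wpM2l ?invr_ge0 ?(ltW N0) //.
  rewrite big_nat_recl // big_nat_recr //= addrC.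
  have gN := grid N (leqnn N).
  have pN : 0 <= p (N.+1%:R / N.+1%:R) by have /andP[] := pc _ gN.
  have f1 : f (1%:R / N.+1%:R) <= c.
    by have /andP[a0 a1] := grid 0 (leq0n N); have /andP[] := fc _ (introT andP (conj (ltW a0) a1)).
  have : \sum_(0 <= k < N) f (k.+2%:R / N.+1%:R) <=
         \sum_(0 <= k < N) p (k.+1%:R / N.+1%:R).
    rewrite !big_nat; apply: ler_sum => k /andP[_ kN].
    have /andP[a0 _] := grid k (ltnW kN); have /andP[_ b1] := grid k.+1 kN.
    by apply: fp => //; rewrite ltr_pM2r ?invr_gt0 // ltr_nat.
  lra.
move/cvgrPdist_lt : Rp => /(_ _ e4); apply: filterS => n.
have /andP[h1 h2] := close f hf fc; have /andP[h3 h4] := close (fn n) (hfn n) (fnc n).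
move: Rpf => /andP[h5 h6]; rewrite !ltr_distl => /andP[h7 h8].
apply/andP; split; lra.
Unshelve. all: by end_near. Qed.

End monotone.

(** * Fuzzy sets and their level sets *)

Section topology.
Context {R : realType} {d : nat}.
Implicit Types (x y : 'rV[R]_d) (A B : set 'rV[R]_d).

Lemma nbhs_enormP x A :
  nbhs x A <-> exists2 e, 0 < e & forall y, enorm (y - x) < e -> A y.
Proof.
split => [/nbhs_ballP [e /= e0 eA]|[e e0 eA]].
  exists e => // y yx; apply: eA; rewrite -ball_normE /= distrC.
  by apply: le_lt_trans yx; exact: norm_le_enorm.
have h : id @ nbhs x --> x by exact: cvg_id.
apply: filterS eA _.
by have := (@cvg_enormP _ _ _ _ (nbhs_filter x) id x).1 h e e0.
Qed.

Lemma closure_enormP x A :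
  closure A x <-> forall e, 0 < e -> exists2 y, A y & enorm (y - x) < e.
Proof.
split => [Ax e e0|h B /nbhs_enormP [e e0 eB]].
  have [|y [Ay yx]] := Ax [set y | enorm (y - x) < e]; last by exists y.
  by apply/nbhs_enormP; exists e.
by have [y Ay yx] := h e e0; exists y; split => //; exact: eB.
Qed.

Lemma closure_convex A :
  (forall x y t, A x -> A y -> 0 <= t <= 1 -> A (t *: x + (1 - t) *: y)) ->
  forall x y t, closure A x -> closure A y -> 0 <= t <= 1 ->
    closure A (t *: x + (1 - t) *: y).
Proof.
move=> xA x y t /closure_enormP Ax /closure_enormP Ay t01.
apply/closure_enormP => e e0.
have [x' Ax' xx] := Ax e e0; have [y' Ay' yy] := Ay e e0.
exists (t *: x' + (1 - t) *: y'); first exact: xA.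
rewrite opprD addrACA -!scalerBr; apply: le_lt_trans (ler_enormD _ _) _.
move: t01 => /andP[t0 t1]; have t2 : 0 <= 1 - t by lra.
rewrite !enormZ !ger0_norm //; move: xx yy; move: (enorm (x' - x)) (enorm (y' - y)) => a b ha hb.
have [->|tn0] := eqVneq t 0; first by rewrite mul0r add0r subr0 mul1r.
have tp : 0 < t by rewrite lt0r tn0.
have h1 : t * a < t * e by rewrite ltr_pM2l.
have h2 : (1 - t) * b <= (1 - t) * e by rewrite ler_wpM2l // ltW.
by have -> : e = t * e + (1 - t) * e; [ring|exact: ltr_leD].
Qed.

End topology.

Section levels.
Context {R : realType} {d : nat}.
Implicit Types (A B C K : fuzzy R d) (x y : 'rV[R]_d) (a b : R).

Lemma level_gt0E A a : 0 < a -> level A a = [set x | a <= A x].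
Proof. by move=> a0; rewrite /level gt_eqF. Qed.

Lemma level0E A : level A 0 = closure [set x | 0 < A x].
Proof. by rewrite /level eqxx. Qed.

Lemma level_anti A a b : 0 <= a -> a <= b -> level A b `<=` level A a.
Proof.
move=> a0 ab; have [b0|b0] := ltP 0 b; last first.
  by have -> : b = a by lra.
rewrite (level_gt0E _ b0) => x /= bx.
have [a1|a1] := ltP 0 a; first by rewrite level_gt0E //=; exact: le_trans bx.
have -> : a = 0 by lra.
by rewrite level0E; apply: subset_closure => /=; exact: (lt_le_trans b0 bx).
Qed.

Lemma level_body A a : 0 <= a <= 1 -> convex_body (level A a).
Proof.
move=> /andP[a0 a1]; split.
- have [x Ax] := fuzzy_level1 A; exists x; exact: level_anti Ax.
- have [a2|a2] := ltP 0 a; last first.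
    by have -> : a = 0; [lra|exact: fuzzy_level0].
  apply: (@subclosed_compact _ (level A a) (level A 0)); [|exact: fuzzy_level0|exact: level_anti].
  by apply: fuzzy_usc; rewrite a2.
- by apply: fuzzy_convex; rewrite a0.
Qed.

Lemma level_body_gt0 A a : 0 < a <= 1 -> convex_body (level A a).
Proof. by move=> /andP[a0 a1]; apply: level_body; rewrite ltW. Qed.

Definition fuzzy_bounded A (M : R) : Prop := level A 0 `<=` eball M.

Lemma fuzzy_boundedP A : exists2 M, 0 <= M & fuzzy_bounded A M.
Proof. by apply/body_bounded/level_body; rewrite lexx ler01. Qed.

Lemma level_bounded A M a : 0 <= a -> fuzzy_bounded A M -> level A a `<=` eball M.
Proof. by move=> a0 hM; apply: subset_trans hM; exact: level_anti. Qed.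

Lemma closed_eball M : closed (@eball R d M).
Proof.
have -> : @eball R d M = @enorm R d @^-1` [set t | t <= M] by [].
by apply: closed_comp => [x _|]; [exact: continuous_enorm|exact: closed_le].
Qed.

Lemma fuzzy_bounded_gt0 A M :
  (forall a, 0 < a <= 1 -> level A a `<=` eball M) -> fuzzy_bounded A M.
Proof.
move=> h; rewrite /fuzzy_bounded level0E.
rewrite [X in _ `<=` X]((closure_id _).1 (@closed_eball M)).
apply: closureS => x /= x0; apply: (h (A x)); last by rewrite level_gt0E //=.
by rewrite x0; have /andP[] := membership01 A x.
Qed.

Lemma level_left A a x : 0 < a -> (forall b, 0 < b -> b < a -> level A b x) ->
  level A a x.
Proof.
move=> a0 h; rewrite level_gt0E //= leNgt; apply/negP => xa.
have /andP[x0 _] := membership01 A x.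
have := h ((A x + a) / 2); rewrite level_gt0E; last by lra.
by move=> /= /(_ _ _); lra.
Qed.

Lemma fuzzy_ext A B : (forall a, 0 < a <= 1 -> level A a = level B a) -> A = B.
Proof.
have half A' B' : (forall a, 0 < a <= 1 -> level A' a = level B' a) ->
    forall x, A' x <= B' x.
  move=> h x; have /andP[x0 x1] := membership01 A' x.
  have [xp|xn] := ltP 0 (A' x); last first.
    by apply: le_trans xn _; have /andP[] := membership01 B' x.
  have : level A' (A' x) x by rewrite level_gt0E //=.
  by rewrite h ?xp // level_gt0E.
move=> h; have AB : membership A = membership B.
  by apply/funext => x; apply/le_anti; rewrite !half // => a /h ->.
case: A B AB {h half} => m h1 h2 h3 h4 h5 [m' h1' h2' h3' h4' h5'] /= mm.
by case: m' / mm in h1' h2' h3' h4' h5' *; congr Fuzzy; exact: Prop_irrelevance.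
Qed.

(** The membership degree of [x] is the largest level whose set contains [x];
    left-continuity in the level says that this supremum is attained. *)
Lemma fuzzy_of_levels (L : R -> set 'rV[R]_d) (M : R) :
  (forall a, 0 < a <= 1 -> [/\ L a !=set0, closed (L a) &
     forall x y t, L a x -> L a y -> 0 <= t <= 1 -> L a (t *: x + (1 - t) *: y)]) ->
  (forall a, 0 < a <= 1 -> L a `<=` eball M) ->
  (forall a b, 0 < a -> a <= b -> b <= 1 -> L b `<=` L a) ->
  (forall a x, 0 < a <= 1 -> (forall b, 0 < b -> b < a -> L b x) -> L a x) ->
  exists A, forall a, 0 < a <= 1 -> level A a = L a.
Proof.
move=> hL hM anti left.
pose D x := [set a | a = 0 \/ 0 < a <= 1 /\ L a x].
pose nu x : R := sup (D x).
have D1 x a : D x a -> a <= 1 by move=> [->|[/andP[]]//]; exact: ler01.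
have ubD x : has_ubound (D x) by exists 1 => a /D1.
have D0 x : D x 0 by left.
have nu01 x : 0 <= nu x <= 1.
  apply/andP; split; first exact: ub_le_sup.
  by apply: ge_sup; [exists 0|move=> a /D1].
have nuL a x : 0 < a <= 1 -> (a <= nu x) <-> L a x.
  move=> a01; split => [ax|Lx]; last by apply: ub_le_sup => //; right.
  apply: left => // b b0 ba.
  have [c] := sup_gt (ex_intro _ 0 (D0 x)) (lt_le_trans ba ax).
  move=> [->|[/andP[c0 c1] Lc]]; first by rewrite ltNge (ltW b0).
  by move=> bc; exact: (anti b c b0 (ltW bc) c1 _ Lc).
have levE a : 0 < a <= 1 -> level nu a = L a.
  move=> a01; rewrite /level gt_eqF ?(andP a01).1 //.
  by apply/seteqP; split => x /nuL; apply.
have pos x : 0 < nu x -> exists2 a, 0 < a <= 1 & L a x.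
  move=> x0; exists (nu x); last by apply/nuL; rewrite ?x0 //; have /andP[] := nu01 x.
  by rewrite x0; have /andP[] := nu01 x.
have lev0 : level nu 0 = closure [set x | 0 < nu x] by rewrite /level eqxx.
have one : 0 < (1 : R) <= 1 by rewrite ltr01 lexx.
have usc a : 0 < a <= 1 -> closed (level nu a).
  by move=> a01; rewrite levE //; have [] := hL a a01.
have l1 : level nu 1 !=set0 by rewrite levE //; have [] := hL 1 one.
have l0 : compact (level nu 0).
  rewrite lev0; apply: (@enorm_bounded_compact _ _ _ M); first exact: closed_closure.
  have : closure [set x | 0 < nu x] `<=` eball M.
    rewrite [X in _ `<=` X]((closure_id _).1 (@closed_eball M)).
    by apply: closureS => y /= /pos [a a01]; exact: hM.
  exact.
have lc a : 0 <= a <= 1 -> convex_set (level nu a : set (convex_lmodType 'rV[R]_d)).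
  move=> /andP[a0 a1]; apply/convex_setP; have [ap|an] := ltP 0 a.
    by rewrite levE ?ap //; have [] := hL a; rewrite ?ap.
  have -> : a = 0 by lra.
  rewrite lev0; apply: closure_convex => x y t.
  move=> /pos [b b01 Lb] /pos [c c01 Lc] t01 /=.
  move: (b01) (c01) => /andP[b0 b1] /andP[c0 c1].
  have m01 : 0 < Num.min b c <= 1 by rewrite lt_min b0 c0 ge_min b1.
  apply: (@lt_le_trans _ _ (Num.min b c)); first by case/andP: m01.
  apply/nuL => //; have [_ _] := hL _ m01; apply => //.
    by apply: anti Lb => //; [case/andP: m01|rewrite ge_min lexx].
  by apply: anti Lc => //; [case/andP: m01|rewrite ge_min lexx orbT].
by exists (Fuzzy nu01 usc l1 l0 lc).
Qed.

(** Intersecting over all lower levels makes a nonincreasing family left-continuous;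
    this turns limits computed level by level into fuzzy sets. *)
Lemma fuzzy_regularization (L : R -> set 'rV[R]_d) (M : R) :
  (forall a, 0 < a <= 1 -> convex_body (L a)) ->
  (forall a, 0 < a <= 1 -> L a `<=` eball M) ->
  (forall a b, 0 < a -> a <= b -> b <= 1 -> L b `<=` L a) ->
  exists A, forall a x, 0 < a <= 1 ->
    level A a x <-> (forall b, 0 < b -> b < a -> L b x).
Proof.
move=> bL hM anti.
pose H a : set 'rV[R]_d := [set x | forall b, 0 < b -> b < a -> L b x].
have HM a : 0 < a <= 1 -> H a `<=` eball M.
  move=> /andP[a0 a1] x /(_ (a / 2)) h.
  by apply: (hM (a / 2)); [lra|apply: h; lra].
have [|a b a0 ab b1 x h c c0 ca|a x /andP[a0 a1] h b b0 ba|A hA] :=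
    @fuzzy_of_levels H M _ HM.
- move=> a /andP[a0 a1]; split.
  + have [[x Lx] _ _] := bL a (introT andP (conj a0 a1)).
    by exists x => b b0 ba; exact: anti (ltW ba) _ _ Lx.
  + rewrite (_ : H a = \bigcap_(b in [set b | 0 < b /\ b < a]) L b).
      apply: closed_bigI => b [b0 ba]; apply: compact_closed; first exact: norm_hausdorff.
      by have [] := bL b; [lra|].
    by apply/seteqP; split => x h b; [move=> []; exact: h|move=> b0 ba; exact: h].
  + move=> x y t Hx Hy t01 b b0 ba.
    have [_ _ /convex_setP xL] : convex_body (L b) by apply: bL; lra.
    by apply: xL => //; [exact: Hx|exact: Hy].
- by apply: h => //; exact: lt_le_trans ab.
- have := h ((a + b) / 2); apply; lra.
- by exists A => a x a01; rewrite hA.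
Qed.

Lemma fuzzy_point (p : 'rV[R]_d) :
  exists A : fuzzy R d, forall a, 0 <= a <= 1 -> level A a = [set p].
Proof.
have [||||A hA] := @fuzzy_of_levels (fun=> [set p]) (enorm p).
- move=> a _; split; first by exists p.
    by apply: compact_closed; [exact: norm_hausdorff|exact: compact_set1].
  by move=> x y t -> -> _ /=; rewrite -scalerDl addrCA subrr addr0 scale1r.
- by move=> a _ x ->; exact: lexx.
- by move=> a b _ _ _ x.
- by move=> a x /andP[a0 a1] /(_ (a / 2)) h; apply: h; lra.
exists A => a /andP[a0 a1]; have [ap|an] := ltP 0 a; first by rewrite hA ?ap.
have -> : a = 0 by lra.
have one : 0 < (1 : R) <= 1 by rewrite ltr01 lexx.
rewrite level0E (_ : [set x | 0 < A x] = [set p]).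
  apply/esym/closure_id; apply: compact_closed; [exact: norm_hausdorff|exact: compact_set1].
apply/seteqP; split => x /=.
  move=> x0; have x01 : 0 < A x <= 1 by rewrite x0; have /andP[] := membership01 A x.
  have : level A (A x) x by rewrite level_gt0E /=.
  by rewrite hA.
move=> ->; apply: (@lt_le_trans _ _ 1) => //.
by have : level A 1 p by [rewrite hA]; rewrite level_gt0E.
Qed.

(** The level [0] is the closure of the union of the others, and a sum of two
    compact sets is closed. *)
Lemma is_fuzzy_sum_gt0 A B K :
  (forall a, 0 < a <= 1 -> level K a = minkowski_sum (level A a) (level B a)) ->
  is_fuzzy_sum A B K.
Proof.
move=> h a /andP[a0 a1]; have [ap|an] := ltP 0 a; first by rewrite h ?ap.
have -> : a = 0 by lra.
have zero : 0 <= (0 : R) <= 1 by rewrite lexx ler01.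
have self C x : 0 < C x -> 0 < C x <= 1 /\ level C (C x) x.
  move=> x0; rewrite level_gt0E //=; split => //.
  by rewrite x0; have /andP[] := membership01 C x.
apply/seteqP; split.
  have /(closure_id _).1 -> : closed (minkowski_sum (level A 0) (level B 0)).
    apply: compact_closed; first exact: norm_hausdorff.
    by have [] := body_sum (level_body A zero) (level_body B zero).
  rewrite (level0E K); apply: closureS => z /= /self [z01]; rewrite h //.
  move=> [x [y [Ax By ->]]]; exists x, y.
  by move: z01 => /andP[/ltW z0 _]; split => //; exact: level_anti z0 _ _.
move=> z [x [y []]]; rewrite !level0E => /closure_enormP Ax /closure_enormP By ->.
apply/closure_enormP => e e0; have e2 : 0 < e / 2 by rewrite divr_gt0.
have [x' /= /self [/andP[x0 x1] Ax'] xx] := Ax _ e2.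
have [y' /= /self [/andP[y0 y1] By'] yy] := By _ e2.
set c := Num.min (A x') (B y').
have c0 : 0 < c by rewrite lt_min x0.
exists (x' + y').
  apply: (@lt_le_trans _ _ c) => //.
  have : level K c (x' + y').
    rewrite h; last by rewrite c0 ge_min x1.
    exists x', y'; split => //.
      by apply: level_anti Ax'; [exact: ltW|rewrite ge_min lexx].
    by apply: level_anti By'; [exact: ltW|rewrite ge_min lexx orbT].
  by rewrite level_gt0E.
rewrite opprD addrACA; apply: le_lt_trans (ler_enormD _ _) _; lra.
Qed.

End levels.

(** * Limits of convex bodies along an ultrafilter *)

Section ultralimit.
Context {R : realType} {d : nat} (U : set_system nat) {UU : UltraFilter U}.
Implicit Types (x y : 'rV[R]_d) (b : nat -> 'rV[R]_d) (B : nat -> set 'rV[R]_d).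

Lemma ultra_cvg b (K : set 'rV[R]_d) : compact K -> (\forall n \near U, K (b n)) ->
  exists2 x, K x & b @ U --> x.
Proof.
move=> cK bK; have [x [Kx cx]] := cK (b @ U) _ bK.
exists x => // V Vx; have [//|UV] := in_ultra_setVsetC (b @^-1` V) UU.
have [y [yV Vy]] := cx (~` V) V UV Vx.
by have := yV Vy.
Qed.

Lemma compact_eball (M : R) : compact (@eball R d M).
Proof. by apply: (@enorm_bounded_compact _ _ _ M); [exact: closed_eball|move=> x]. Qed.

(** The set of limits along [U] of sequences with terms in the [B n].  In terms of
    distances, it is closed by definition. *)
Definition ulim B : set 'rV[R]_d :=
  [set x | forall e, 0 < e -> \forall n \near U, exists2 y, B n y & enorm (y - x) < e].

Lemma ulim_cvg B b x : (\forall n \near U, B n (b n)) -> b @ U --> x -> ulim B x.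
Proof.
move=> Bb /cvg_enormP bx e e0; have h := bx e e0.
by apply: filterS2 Bb h => n; exists (b n).
Qed.

Lemma ulim_closed B : closed (ulim B).
Proof.
move=> x /closure_enormP h e e0; have e2 : 0 < e / 2 by rewrite divr_gt0.
have [y By yx] := h _ e2; have := By _ e2; apply: filterS => n [z Bz zy].
exists z => //; rewrite -(subrK y z) -addrA; apply: le_lt_trans (ler_enormD _ _) _.
lra.
Qed.

Lemma ulim_bounded B (M : R) : (forall n, B n `<=` eball M) -> ulim B `<=` eball M.
Proof.
move=> hM x h; rewrite /eball /=; apply/ler_addgt0Pr => e e0.
have [n [y /hM yM yx]] := filter_ex (h e e0).
rewrite -(subrK y x); apply: le_trans (ler_enormD _ _) _.
by rewrite addrC lerD // enormBC ltW.
Qed.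

Lemma ulim_subset B B' : (forall n, B n `<=` B' n) -> ulim B `<=` ulim B'.
Proof.
move=> h x Bx e e0; apply: filterS (Bx e e0) => n [y By yx].
by exists y => //; exact: h.
Qed.

Lemma ulim_body B (M : R) : (forall n, convex_body (B n)) ->
  (forall n, B n `<=` eball M) -> convex_body (ulim B).
Proof.
move=> bB hM; split.
- have /choice [b hb] : forall n, exists x, B n x by move=> n; have [] := bB n.
  have [|x _ bx] := @ultra_cvg b _ (@compact_eball M).
    by apply: nearW => n; exact: hM.
  by exists x; apply: ulim_cvg bx; exact: nearW.
- apply: enorm_bounded_compact; first exact: ulim_closed.
  exact: ulim_bounded hM.
- apply/convex_setP => x y t Bx By t01 e e0.
  have : \forall n \near U, (exists2 z, B n z & enorm (z - x) < e) /\
                           (exists2 z, B n z & enorm (z - y) < e).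
    by apply: filterI; [exact: Bx|exact: By].
  apply: filterS => n [[z Bz zx] [w Bw wy]].
  have [_ _ /convex_setP xB] := bB n.
  exists (t *: z + (1 - t) *: w); first exact: xB.
  rewrite opprD addrACA -!scalerBr; apply: le_lt_trans (ler_enormD _ _) _.
  move: t01 => /andP[t0 t1]; have t2 : 0 <= 1 - t by lra.
  rewrite !enormZ !ger0_norm //.
  move: zx wy; move: (enorm (z - x)) (enorm (w - y)) => p q hp hq.
  have [->|tn0] := eqVneq t 0; first by rewrite mul0r add0r subr0 mul1r.
  have tp : 0 < t by rewrite lt0r tn0.
  have h1 : t * p < t * e by rewrite ltr_pM2l.
  have h2 : (1 - t) * q <= (1 - t) * e by rewrite ler_wpM2l // ltW.
  by have -> : e = t * e + (1 - t) * e; [ring|exact: ltr_leD].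
Qed.

(** Both terms of a decomposition of a fixed point of [K] are bounded sequences, hence
    converge along [U]: with an ultrafilter one limit serves all points and all
    summands at once, where subsequences would depend on them. *)
Lemma ulim_sum B C (K : set 'rV[R]_d) (M : R) :
  closed K -> (forall n, B n `<=` eball M) -> (forall n, C n `<=` eball M) ->
  (\forall n \near U, minkowski_sum (B n) (C n) = K) ->
  minkowski_sum (ulim B) (ulim C) = K.
Proof.
move=> cK hB hC hK; apply/seteqP; split.
  move=> _ [x [y [Bx Cy ->]]].
  rewrite ((closure_id K).1 cK); apply/closure_enormP => e e0.
  have e2 : 0 < e / 2 by rewrite divr_gt0.
  have h : \forall n \near U, (exists2 z, B n z & enorm (z - x) < e / 2) /\
       (exists2 z, C n z & enorm (z - y) < e / 2).
    by apply: filterI; [exact: Bx|exact: Cy].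
  have [n [[[z Bz zx] [w Cw wy]] Kn]] := filter_ex (filterI h hK).
  exists (z + w); first by rewrite -Kn; exists z, w.
  by rewrite opprD addrACA; apply: le_lt_trans (ler_enormD _ _) _; lra.
move=> k Kk.
have /choice [p hp] : forall n, exists p : 'rV[R]_d * 'rV[R]_d,
    minkowski_sum (B n) (C n) = K -> [/\ B n p.1, C n p.2 & k = p.1 + p.2].
  move=> n; have [E|?] := pselect (minkowski_sum (B n) (C n) = K); last by exists (0, 0).
  by move: (Kk); rewrite -E => -[x [y [Bx Cy ->]]]; exists (x, y).
have nB : \forall n \near U, B n (p n).1 by apply: filterS hK => n /hp [].
have nC : \forall n \near U, C n (p n).2 by apply: filterS hK => n /hp [].
have [|x _ px] := @ultra_cvg (fst \o p) _ (@compact_eball M).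
  by apply: filterS nB => n; exact: hB.
have [|y _ py] := @ultra_cvg (snd \o p) _ (@compact_eball M).
  by apply: filterS nC => n; exact: hC.
exists x, y; split; [exact: ulim_cvg nB px|exact: ulim_cvg nC py|].
have pk : (fun n => (p n).1 + (p n).2) @ U --> x + y by apply: cvgD.
apply/eqP; rewrite -subr_eq0; apply/eqP; apply: enorm_eq0.
apply/le_anti; rewrite enorm_ge0 andbT; apply/ler_addgt0Pr => e e0; rewrite add0r.
move/cvg_enormP : pk => /(_ _ e0) h.
by have [n [/hp [_ _ <-] /ltW]] := filter_ex (filterI hK h).
Qed.

(** The two bodies are contained in the [e]-neighbourhoods of each other, by
    compactness: a sequence of points violating one of the inclusions would converge
    along [U] to a point of the limit. *)
Lemma ulim_support B (M e : R) : (forall n, convex_body (B n)) ->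
  (forall n, B n `<=` eball M) -> 0 < e ->
  \forall n \near U, forall u, unit_sphere u ->
    `|support_set (B n) u - support_set (ulim B) u| <= e.
Proof.
move=> bB hM e0; have bL := ulim_body bB hM; set L := ulim B in bL *.
have near_le (A A' : set 'rV[R]_d) : convex_body A -> convex_body A' ->
    (forall x, A x -> exists2 y, A' y & enorm (x - y) <= e) ->
    forall u, unit_sphere u -> support_set A u <= support_set A' u + e.
  move=> bA bA' h u u1; apply: support_le => // x /h [y Ay xy].
  rewrite -(subrK y x) dotDr addrC; apply: lerD; first exact: support_ub.
  by apply: le_trans xy; apply: le_trans (dot_sphere_le _ u1); exact: ler_norm.
have BL : \forall n \near U, forall x, B n x -> exists2 y, L y & enorm (x - y) <= e.
  have [//|bad] := in_ultra_setVsetC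
    [set n | forall x, B n x -> exists2 y, L y & enorm (x - y) <= e] UU.
  have /choice [b hb] : forall n, exists x, ~ (forall x, B n x ->
      exists2 y, L y & enorm (x - y) <= e) ->
      B n x /\ forall y, L y -> e < enorm (x - y).
    move=> n; have [h|] := pselect (forall x, B n x -> exists2 y, L y & enorm (x - y) <= e).
      by exists 0.
    move=> /existsNP [x /not_implyP [Bx h]]; exists x => _; split => // y Ly.
    by rewrite ltNge; apply/negP => xy; apply: h; exists y.
  have [|x _ bx] := @ultra_cvg b _ (@compact_eball M).
    by apply: filterS bad => n /hb [/hM].
  have Lx : L x by apply: ulim_cvg bx; apply: filterS bad => n /hb [].
  move/cvg_enormP : bx => /(_ _ e0) h.
  have [n [/hb [_ /(_ _ Lx)]]] := filter_ex (filterI bad h).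
  by move=> h1 h2; have := lt_trans h1 h2; rewrite ltxx.
have LB : \forall n \near U, forall x, L x -> exists2 y, B n y & enorm (x - y) <= e.
  have [//|bad] := in_ultra_setVsetC
    [set n | forall x, L x -> exists2 y, B n y & enorm (x - y) <= e] UU.
  have /choice [b hb] : forall n, exists x, ~ (forall x, L x ->
      exists2 y, B n y & enorm (x - y) <= e) ->
      L x /\ forall y, B n y -> e < enorm (x - y).
    move=> n; have [h|] := pselect (forall x, L x -> exists2 y, B n y & enorm (x - y) <= e).
      by exists 0.
    move=> /existsNP [x /not_implyP [Lx h]]; exists x => _; split => // y By.
    by rewrite ltNge; apply/negP => xy; apply: h; exists y.
  have cL : compact L by have [] := bL.
  have [|x Lx bx] := @ultra_cvg b _ cL; first by apply: filterS bad => n /hb [].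
  have e2 : 0 < e / 2 by rewrite divr_gt0.
  move/cvg_enormP : bx => /(_ _ e2) h.
  have [n [[/hb [_ far] bxn] [y By yx]]] :=
    filter_ex (filterI (filterI bad h) (Lx _ e2)).
  have := far y By; have := ler_enormB (b n - x) (y - x).
  by rewrite opprB addrA subrK; move: bxn yx; lra.
apply: filterS2 BL LB => n BLn LBn u u1.
have h1 := near_le _ _ (bB n) bL BLn u u1; have h2 := near_le _ _ bL (bB n) LBn u u1.
by rewrite ler_norml; apply/andP; split; lra.
Qed.

End ultralimit.

(** * The inner product of support functions *)

Section body_pairing.
Context {R : realType} {d : nat}.
Implicit Types (A B C : set 'rV[R]_d) (f g : 'rV[R]_d -> R).
Local Notation S := (@unit_sphere R d).
Local Notation area := (sphere_area R d).
Local Notation sphere_int := (@sphere_int R d).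

Lemma continuous_addf f g : continuous f -> continuous g ->
  continuous (fun u => f u + g u).
Proof. by move=> cf cg u; exact: (cvgD (cf u) (cg u)). Qed.

Lemma continuous_mulf f g : continuous f -> continuous g ->
  continuous (fun u => f u * g u).
Proof. by move=> cf cg u; exact: (cvgM (cf u) (cg u)). Qed.

Lemma continuous_cstf (c : R) : continuous (fun _ : 'rV[R]_d => c).
Proof. by move=> u; exact: (@cvg_cst _ _ _ _ (nbhs_filter u)). Qed.

Lemma continuous_normf f : continuous f -> continuous (fun u => `|f u|).
Proof. by move=> cf u; exact: (cvg_norm (cf u)). Qed.

Definition pairing A B : R := sphere_int (fun u => support_set A u * support_set B u).

Lemma continuous_pairing A B : convex_body A -> convex_body B ->
  continuous (fun u => support_set A u * support_set B u).
Proof. by move=> bA bB; apply: continuous_mulf; exact: continuous_support. Qed.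

Lemma pairingC A B : pairing A B = pairing B A.
Proof. by apply: eq_sphere_int => u _; rewrite mulrC. Qed.

Lemma pairing_linear (s t : R) A B C K : convex_body A -> convex_body B ->
  convex_body K ->
  (forall u, S u -> support_set C u = s * support_set A u + t * support_set B u) ->
  pairing C K = s * pairing A K + t * pairing B K.
Proof.
move=> bA bB bK h; have cA := continuous_pairing bA bK.
have cB := continuous_pairing bB bK.
rewrite -!sphere_intZ // -sphere_intD; first by
  apply: eq_sphere_int => u u1; rewrite h //; ring.
- by apply: continuous_mulf => //; exact: continuous_cstf.
- by apply: continuous_mulf => //; exact: continuous_cstf.
Qed.

Lemma norm_sphere_int_le f (c : R) : continuous f ->
  (forall u, S u -> `|f u| <= c) -> `|sphere_int f| <= c * area.
Proof.
move=> cf h; have cc := continuous_cstf; rewrite ler_norml -mulNr -!sphere_int_cst.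
by apply/andP; split; apply: le_sphere_int => // u /h; rewrite ler_norml => /andP[].
Qed.

(** Support functions shifted by a bound [M] of the bodies are nonnegative, so
    that their products are monotone in both bodies. *)
Definition shifted_pairing (M : R) A B : R :=
  sphere_int (fun u => (support_set A u + M) * (support_set B u + M)).

Definition shifted_mean (M : R) A : R := sphere_int (fun u => support_set A u + M).

Lemma continuous_shift (M : R) A : convex_body A ->
  continuous (fun u => support_set A u + M).
Proof.
by move=> bA; apply: continuous_addf; [exact: continuous_support|exact: continuous_cstf].
Qed.

Lemma pairing_shift M A B : convex_body A -> convex_body B ->
  pairing A B = shifted_pairing M A B - M * shifted_mean M A - M * shifted_mean M B
                + M ^+ 2 * area.
Proof.
move=> bA bB; have cA := continuous_shift (M := M) bA; have cB := continuous_shift (M := M) bB.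
have cAB := continuous_mulf cA cB.
rewrite -!mulNr /shifted_mean -!sphere_intZ // -sphere_int_cst.
have cMA := continuous_mulf (@continuous_cstf (- M)) cA; have cMB := continuous_mulf (@continuous_cstf (- M)) cB.
have c1 := continuous_addf cAB cMA; have c2 := continuous_addf c1 cMB.
have c3 := @continuous_cstf (M ^+ 2); rewrite -!sphere_intD //.
by apply: eq_sphere_int => u _; ring.
Qed.

Lemma shifted_ge0 M A u : convex_body A -> A `<=` eball M -> S u ->
  0 <= support_set A u + M <= 2 * M.
Proof.
move=> bA AM u1; have := support_norm bA AM u1; rewrite ler_norml.
by move=> /andP[h1 h2]; apply/andP; split; lra.
Qed.

Lemma shifted_pairing_bounds M A B : convex_body A -> convex_body B ->
  A `<=` eball M -> B `<=` eball M ->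
  0 <= shifted_pairing M A B <= (2 * M) ^+ 2 * area.
Proof.
move=> bA bB AM BM; apply/andP; split.
  apply: sphere_int_ge0 => u u1; have /andP[h1 _] := shifted_ge0 bA AM u1.
  by have /andP[h2 _] := shifted_ge0 bB BM u1; exact: mulr_ge0.
rewrite -sphere_int_cst; apply: le_sphere_int.
- by apply: continuous_mulf; exact: continuous_shift.
- exact: continuous_cstf.
- move=> u u1; have /andP[h1 h3] := shifted_ge0 bA AM u1.
  by have /andP[h2 h4] := shifted_ge0 bB BM u1; rewrite expr2; exact: ler_pM.
Qed.

Lemma shifted_mean_bounds M A : convex_body A -> A `<=` eball M ->
  0 <= shifted_mean M A <= 2 * M * area.
Proof.
move=> bA AM; apply/andP; split.
  by apply: sphere_int_ge0 => u u1; have /andP[] := shifted_ge0 bA AM u1.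
rewrite -sphere_int_cst; apply: le_sphere_int.
- exact: continuous_shift.
- exact: continuous_cstf.
- by move=> u u1; have /andP[] := shifted_ge0 bA AM u1.
Qed.

Lemma le_shifted_pairing M A A' B B' :
  convex_body A -> convex_body A' -> convex_body B -> convex_body B' ->
  A `<=` A' -> B `<=` B' -> A' `<=` eball M -> B' `<=` eball M ->
  shifted_pairing M A B <= shifted_pairing M A' B'.
Proof.
move=> bA bA' bB bB' AA BB AM BM; apply: le_sphere_int.
- by apply: continuous_mulf; exact: continuous_shift.
- by apply: continuous_mulf; exact: continuous_shift.
- move=> u u1; have /andP[h1 _] := shifted_ge0 bA (subset_trans AA AM) u1.
  have /andP[h2 _] := shifted_ge0 bB (subset_trans BB BM) u1.
  by apply: ler_pM => //; rewrite lerD2r; exact: support_subset.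
Qed.

Lemma le_shifted_mean M A A' : convex_body A -> convex_body A' -> A `<=` A' ->
  shifted_mean M A <= shifted_mean M A'.
Proof.
move=> bA bA' AA; apply: le_sphere_int; [exact: continuous_shift..|].
by move=> u u1; rewrite lerD2r; exact: support_subset.
Qed.

Lemma pairing_lipschitz M e A A' B B' :
  convex_body A -> convex_body A' -> convex_body B -> convex_body B' ->
  A `<=` eball M -> B' `<=` eball M ->
  (forall u, S u -> `|support_set A u - support_set A' u| <= e) ->
  (forall u, S u -> `|support_set B u - support_set B' u| <= e) ->
  `|pairing A B - pairing A' B'| <= 2 * M * e * area.
Proof.
move=> bA bA' bB bB' AM BM hA hB.
have cAB := continuous_pairing bA bB; have cAB' := continuous_pairing bA' bB'.
rewrite -[X in _ - X]mul1r -mulNr /pairing -sphere_intZ // -sphere_intD //; last first.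
  by apply: continuous_mulf => //; exact: continuous_cstf.
apply: norm_sphere_int_le.
  by apply: continuous_addf => //; apply: continuous_mulf => //; exact: continuous_cstf.
move=> u u1.
have -> : support_set A u * support_set B u + -1 * (support_set A' u * support_set B' u) =
  support_set A u * (support_set B u - support_set B' u) +
  support_set B' u * (support_set A u - support_set A' u) by ring.
apply: le_trans (ler_normD _ _) _; rewrite !normrM.
have h1 := support_norm bA AM u1; have h2 := support_norm bB' BM u1.
have -> : 2 * M * e = M * e + M * e by ring.
by apply: lerD; apply: ler_pM => //; [exact: hB|exact: hA].
Qed.

End body_pairing.

Section pairing_ulim.
Context {R : realType} {d : nat} (U : set_system nat) {UU : UltraFilter U}.
Implicit Types (A B : nat -> set 'rV[R]_d).
Local Notation area := (sphere_area R d).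

Lemma cvg_le_mul (f : nat -> R) (l k : R) : 0 <= k ->
  (forall e, 0 < e -> \forall n \near U, `|f n - l| <= k * e) -> f @ U --> l.
Proof.
move=> k0 h; apply/cvgrPdist_lt => e e0.
have k1 : 0 < k + 1 by lra.
have e1 : 0 < e / (k + 1) by rewrite divr_gt0.
apply: filterS (h _ e1) => n hn; rewrite distrC; apply: le_lt_trans hn _.
by rewrite mulrCA gtr_pMr // ltr_pdivrMr // mul1r ltrDl.
Qed.

Lemma pairing_ulim A B (M : R) : 0 <= M ->
  (forall n, convex_body (A n)) -> (forall n, convex_body (B n)) ->
  (forall n, A n `<=` eball M) -> (forall n, B n `<=` eball M) ->
  pairing (A n) (B n) @[n --> U] --> pairing (ulim U A) (ulim U B).
Proof.
move=> M0 bA bB AM BM; apply: (@cvg_le_mul _ _ (2 * M * area)).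
  by rewrite !mulr_ge0 // sphere_area_ge0.
have bLA := ulim_body (UU := UU) bA AM; have bLB := ulim_body (UU := UU) bB BM.
move=> e e0; have hA := ulim_support (UU := UU) bA AM e0; have hB := ulim_support (UU := UU) bB BM e0.
apply: filterS2 hA hB => n hAn hBn; rewrite mulrAC.
apply: (pairing_lipschitz (bA n) bLA (bB n) bLB) => //.
exact: ulim_bounded.
Qed.

Lemma shifted_mean_ulim A (M : R) : 0 <= M ->
  (forall n, convex_body (A n)) -> (forall n, A n `<=` eball M) ->
  shifted_mean M (A n) @[n --> U] --> shifted_mean M (ulim U A).
Proof.
move=> M0 bA AM; apply: (@cvg_le_mul _ _ area); first exact: sphere_area_ge0.
move=> e e0; have hA := ulim_support (UU := UU) bA AM e0; have bL := ulim_body (UU := UU) bA AM.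
apply: filterS hA => n hAn; rewrite mulrC -[X in _ - X]mul1r -mulNr /shifted_mean.
have cA := continuous_shift (M := M) (bA n); have cL := continuous_shift (M := M) bL.
have cL1 := continuous_mulf (@continuous_cstf R d (-1)) cL.
rewrite -sphere_intZ // -sphere_intD //.
apply: norm_sphere_int_le; first exact: continuous_addf.
by move=> u /hAn; rewrite mulN1r opprD addrACA subrr addr0.
Qed.

Lemma shifted_pairing_ulim A B (M : R) : 0 <= M ->
  (forall n, convex_body (A n)) -> (forall n, convex_body (B n)) ->
  (forall n, A n `<=` eball M) -> (forall n, B n `<=` eball M) ->
  shifted_pairing M (A n) (B n) @[n --> U] -->
  shifted_pairing M (ulim U A) (ulim U B).
Proof.
move=> M0 bA bB AM BM.
have bLA := ulim_body (UU := UU) bA AM; have bLB := ulim_body (UU := UU) bB BM.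
have E (X Y : set 'rV[R]_d) : convex_body X -> convex_body Y -> shifted_pairing M X Y =
    pairing X Y + M * shifted_mean M X + M * shifted_mean M Y - M ^+ 2 * area.
  by move=> bX bY; rewrite (pairing_shift M bX bY); ring.
rewrite E //; under eq_cvg do rewrite E //.
apply: cvgB; last exact: cvg_cst.
apply: cvgD; last by apply: cvgMl_tmp; exact: shifted_mean_ulim.
apply: cvgD; last by apply: cvgMl_tmp; exact: shifted_mean_ulim.
exact: (pairing_ulim M0 bA bB AM BM).
Qed.

End pairing_ulim.

(** * The inner product of fuzzy sets, the metric and the Steiner point *)

Section fuzzy_pairing.
Context {R : realType} {d : nat}.
Implicit Types (A B C K : fuzzy R d) (p q : 'rV[R]_d).
Local Notation S := (@unit_sphere R d).
Local Notation area := (sphere_area R d).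

Lemma fuzzy_pairing_subproof : {f : fuzzy R d -> fuzzy R d -> R |
  forall A B, f A B = int01 (fun a => pairing (level A a) (level B a))}.
Proof. by eexists. Qed.

(** Given through an opaque existence proof, so that conversion never compares two
    such integrals by unfolding them. *)
Definition fuzzy_pairing A B : R := sval fuzzy_pairing_subproof A B.

Lemma fuzzy_pairingE A B :
  fuzzy_pairing A B = int01 (fun a => pairing (level A a) (level B a)).
Proof. exact: (svalP fuzzy_pairing_subproof). Qed.

Lemma fuzzy_bounded2 A B : exists2 M, 0 <= M & fuzzy_bounded A M /\ fuzzy_bounded B M.
Proof.
have [M M0 hA] := fuzzy_boundedP A; have [N N0 hB] := fuzzy_boundedP B.
exists (Num.max M N); first by rewrite le_max M0.
split => x; [move=> /hA|move=> /hB] => h; apply: le_trans h _.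
  by rewrite le_max lexx.
by rewrite le_max lexx orbT.
Qed.

Lemma nonincreasing_shifted_pairing A B (M : R) :
  fuzzy_bounded A M -> fuzzy_bounded B M ->
  nonincreasing01 (fun a => shifted_pairing M (level A a) (level B a)).
Proof.
move=> hA hB x y x0 xy y1; have y0 := le_trans x0 xy; have x1 := le_trans xy y1.
by apply: le_shifted_pairing; [apply: level_body; rewrite ?x0 ?y0..|
  exact: level_anti|exact: level_anti|exact: level_bounded|exact: level_bounded].
Qed.

Lemma nonincreasing_shifted_mean A (M : R) :
  nonincreasing01 (fun a => shifted_mean M (level A a)).
Proof.
move=> x y x0 xy y1; have y0 := le_trans x0 xy; have x1 := le_trans xy y1.
by apply: le_shifted_mean; [apply: level_body; rewrite ?x0 ?y0..|exact: level_anti].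
Qed.

Lemma nonincreasing01_difference (f : R -> R) : nonincreasing01 f -> monotone_difference f.
Proof. by move=> hf; exists f, (fun=> 0); split => // a _; rewrite subr0. Qed.

Lemma monotone_difference_eq (f g : R -> R) :
  (forall a, 0 <= a <= 1 -> f a = g a) -> monotone_difference g -> monotone_difference f.
Proof. by move=> fg [p [q [hp hq gE]]]; exists p, q; split => // a a01; rewrite fg // gE. Qed.

Lemma monotone_difference_cst (c : R) : monotone_difference (fun=> c).
Proof. by apply: nonincreasing01_difference => x y *. Qed.

Lemma pairing_level_shift A B (M a : R) : 0 <= a <= 1 ->
  pairing (level A a) (level B a) =
  (shifted_pairing M (level A a) (level B a) + - M * shifted_mean M (level A a)) +
  (- M * shifted_mean M (level B a) + M ^+ 2 * area).
Proof.
move=> a01; rewrite (pairing_shift M (level_body A a01) (level_body B a01)); ring.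
Qed.

Lemma monotone_difference_pairing A B :
  monotone_difference (fun a => pairing (level A a) (level B a)).
Proof.
have [M M0 [hA hB]] := fuzzy_bounded2 A B.
apply: (monotone_difference_eq (fun a => @pairing_level_shift A B M a)).
apply: monotone_differenceD; apply: monotone_differenceD.
- by apply: nonincreasing01_difference; exact: nonincreasing_shifted_pairing.
- by apply/monotone_differenceZ/nonincreasing01_difference; exact: nonincreasing_shifted_mean.
- by apply/monotone_differenceZ/nonincreasing01_difference; exact: nonincreasing_shifted_mean.
- exact: monotone_difference_cst.
Qed.

Lemma fuzzy_pairing_shift A B (M : R) : fuzzy_bounded A M -> fuzzy_bounded B M ->
  fuzzy_pairing A B =
  (int01 (fun a => shifted_pairing M (level A a) (level B a)) +
    - M * int01 (fun a => shifted_mean M (level A a))) +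
  (- M * int01 (fun a => shifted_mean M (level B a)) + M ^+ 2 * area).
Proof.
move=> hA hB; rewrite fuzzy_pairingE (eq_int01 (fun a => @pairing_level_shift A B M a)).
have h1 := nonincreasing01_difference (nonincreasing_shifted_pairing hA hB).
have h2 := monotone_differenceZ (- M)
  (nonincreasing01_difference (@nonincreasing_shifted_mean A M)).
have h3 := monotone_differenceZ (- M)
  (nonincreasing01_difference (@nonincreasing_shifted_mean B M)).
have h4 := monotone_difference_cst (M ^+ 2 * area).
rewrite int01D; [|exact: monotone_differenceD|exact: monotone_differenceD].
rewrite int01D // int01D // int01_cst.
by rewrite !int01Z //; apply: nonincreasing01_difference; exact: nonincreasing_shifted_mean.
Qed.

(** Riemann sums ignore the level [0], where sums and limits of level sets are
    harder to describe. *)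
Lemma eq_int01_gt0 (f g : R -> R) : monotone_difference f -> monotone_difference g ->
  (forall a, 0 < a <= 1 -> f a = g a) -> int01 f = int01 g.
Proof.
move=> hf hg fg; have cf := riemann_cvg hf; have cg := riemann_cvg hg.
suff E : (fun N => riemann N f) = (fun N => riemann N g).
  by rewrite E in cf; rewrite -(cvg_lim (@Rhausdorff R) cf) (cvg_lim (@Rhausdorff R) cg).
apply/funext => N; rewrite /riemann; congr (_ * _); rewrite !big_nat.
apply: eq_bigr => k /andP[_ kN]; apply: fg.
by rewrite divr_gt0 ?ltr0n //= ler_pdivrMr ?ltr0n // mul1r ler_nat.
Qed.

Lemma fuzzy_pairingC A B : fuzzy_pairing A B = fuzzy_pairing B A.
Proof. by rewrite !fuzzy_pairingE; apply: eq_int01 => a _; exact: pairingC. Qed.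

Lemma fuzzy_pairing_linear (s t : R) A B C K :
  (forall a u, 0 < a <= 1 -> S u ->
     support C u a = s * support A u a + t * support B u a) ->
  fuzzy_pairing C K = s * fuzzy_pairing A K + t * fuzzy_pairing B K.
Proof.
move=> h; have hA := monotone_difference_pairing A K.
have hB := monotone_difference_pairing B K.
have hsA := monotone_differenceZ s hA; have htB := monotone_differenceZ t hB.
rewrite !fuzzy_pairingE -!int01Z // -int01D //; apply: eq_int01_gt0.
- exact: monotone_difference_pairing.
- exact: monotone_differenceD.
- move=> a a01; apply: pairing_linear; [exact: level_body_gt0..|].
  by move=> u; exact: h.
Qed.

Definition sqdist A B : R :=
  fuzzy_pairing A A - 2 * fuzzy_pairing A B + fuzzy_pairing B B.

Definition level_sqdist A B a : R := sphere_int (fun u => `|support A u a - support B u a| ^+ 2).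

Lemma level_sqdistE A B a : 0 <= a <= 1 -> level_sqdist A B a =
  (pairing (level A a) (level A a) + -2 * pairing (level A a) (level B a)) +
  pairing (level B a) (level B a).
Proof.
move=> a01; have bA := level_body A a01; have bB := level_body B a01.
have cAA := continuous_pairing bA bA; have cAB := continuous_pairing bA bB.
have cBB := continuous_pairing bB bB.
have c1 := continuous_mulf (@continuous_cstf R d (-2)) cAB.
have c2 := continuous_addf cAA c1.
rewrite /level_sqdist /pairing -sphere_intZ // -sphere_intD // -sphere_intD //.
apply: eq_sphere_int => u _; rewrite real_normK ?num_real // /support; ring.
Qed.

Lemma monotone_difference_level_sqdist A B : monotone_difference (level_sqdist A B).
Proof.
apply: (monotone_difference_eq (@level_sqdistE A B)); apply: monotone_differenceD; last first.
  exact: monotone_difference_pairing.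
apply: monotone_differenceD; first exact: monotone_difference_pairing.
by apply: monotone_differenceZ; exact: monotone_difference_pairing.
Qed.

Lemma sqdistE A B : sqdist A B = int01 (level_sqdist A B).
Proof.
rewrite (eq_int01 (@level_sqdistE A B)) /sqdist -mulNr !fuzzy_pairingE.
have hAA := monotone_difference_pairing A A; have hBB := monotone_difference_pairing B B.
have hAB := monotone_difference_pairing A B; have h := monotone_differenceZ (-2) hAB.
rewrite int01D //; last exact: monotone_differenceD.
by rewrite int01D // int01Z.
Qed.

Lemma sqdist_ge0 A B : 0 <= sqdist A B.
Proof.
rewrite sqdistE; apply: int01_ge0 => a _; apply: sphere_int_ge0 => u _.
exact: sqr_ge0.
Qed.

Lemma sqr_d2 A B : d2 A B ^+ 2 = area^-1 * sqdist A B.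
Proof.
rewrite /d2 sqr_sqrtr.
  by rewrite sqdistE -int01Z //; exact: monotone_difference_level_sqdist.
apply: int01_ge0 => a _; rewrite mulr_ge0 ?invr_ge0 ?sphere_area_ge0 //.
by apply: sphere_int_ge0 => u _; exact: sqr_ge0.
Qed.

Lemma sqdistC A B : sqdist A B = sqdist B A.
Proof.
rewrite /sqdist (fuzzy_pairingC B A).
by move: (fuzzy_pairing A A) (fuzzy_pairing B B) => p q; rewrite addrAC (addrC p) addrAC.
Qed.

Lemma fuzzy_support_ext A B :
  (forall a u, 0 < a <= 1 -> S u -> support A u a = support B u a) -> A = B.
Proof.
move=> h; apply: fuzzy_ext => a a01; apply: support_inj.
- exact: level_body_gt0.
- exact: level_body_gt0.
- by move=> u; exact: h.
Qed.

(** If the distance vanishes then so does [level_sqdist] at almost every level, hence on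
    a dense set of levels, and these determine all the others. *)
Lemma sqdist_eq0 A B : (0 < d)%N -> sqdist A B = 0 -> A = B.
Proof.
move=> d0; rewrite sqdistE => I0.
have D_ge0 a : 0 <= level_sqdist A B a by apply: sphere_int_ge0 => u _; exact: sqr_ge0.
have lev a : 0 <= a <= 1 -> level_sqdist A B a = 0 -> level A a = level B a.
  move=> a01 D0; have bA := level_body A a01; have bB := level_body B a01.
  apply: support_inj => // u u1; apply/eqP; rewrite -subr_eq0 -normr_eq0 -sqrf_eq0.
  apply/eqP; apply: (sphere_int_eq0 d0 _ _ D0) => [|v _|//]; last exact: sqr_ge0.
  have cAB := continuous_addf (continuous_support bA)
    (continuous_mulf (@continuous_cstf R d (-1)) (continuous_support bB)).
  have := continuous_normf cAB => cn; have := continuous_mulf cn cn.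
  by rewrite /support; under eq_fun do rewrite mulN1r -expr2.
have dense c a : 0 <= c -> c < a -> a <= 1 ->
    exists2 b, c < b < a & level_sqdist A B b = 0.
  move=> c0 ca a1; apply: contrapT => noz.
  have int := monotone_difference_integrable (monotone_difference_level_sqdist A B).
  have mI : measurable (`[0%R, 1%R] : set R) by exact: measurable_itv.
  have [zae _] := ae_eq_integral_abs (@lebesgue_measure R) mI (measurable_int _ int).
  have [|N [mN N0 hN]] := zae.
    under eq_integral => x _ do rewrite /= ger0_norm //.
    by rewrite -[LHS]fineK ?integrable_fin_num // [fine _]I0.
  have sub : `]c, a[%classic `<=` N.
    move=> x /=; rewrite in_itv /= => xca; apply: hN => /= h; apply: noz; exists x => //.
    have x01 : `[0%R, 1%R]%classic x.
      by rewrite /= in_itv /=; case/andP: xca => h1 h2; apply/andP; split; lra.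
    by case: (h x01).
  have : (@lebesgue_measure R `]c, a[%classic <= 0)%E.
    by rewrite -N0; apply: le_measure => //; rewrite inE //; exact: measurable_itv.
  by rewrite lebesgue_measure_itv /= lte_fin ca -EFinB lee_fin leNgt subr_gt0 ca.
have half A' B' : (forall b, 0 <= b <= 1 -> level_sqdist A B b = 0 -> level A' b = level B' b) ->
    forall a, 0 < a <= 1 -> level A' a `<=` level B' a.
  move=> h a /andP[a0 a1] x Ax; apply: level_left => // c c0 ca.
  have [b /andP[cb ba] Db] := dense c a (ltW c0) ca a1.
  have b0 : 0 < b := lt_trans c0 cb.
  apply: (level_anti (ltW c0) (ltW cb)); rewrite -h //; last first.
    by rewrite (ltW b0) (le_trans (ltW ba)).
  exact: level_anti (ltW b0) (ltW ba) _ Ax.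
apply: fuzzy_ext => a a01; apply/seteqP; split; apply: half => // b b01 Db.
by rewrite lev.
Qed.

(** ** Points, and the Steiner point *)

Lemma point_subproof p : {A : fuzzy R d | forall a, 0 <= a <= 1 -> level A a = [set p]}.
Proof. exact: cid (fuzzy_point p). Qed.

Definition point p : fuzzy R d := sval (point_subproof p).

Lemma level_point p a : 0 <= a <= 1 -> level (point p) a = [set p].
Proof. exact: (svalP (point_subproof p)). Qed.

Lemma support_point_fuzzy p u a : 0 <= a <= 1 -> support (point p) u a = dot u p.
Proof. by move=> a01; rewrite /support level_point // support_point. Qed.

Lemma gt0_01 (a : R) : 0 < a <= 1 -> 0 <= a <= 1.
Proof. by move=> /andP[a0 ->]; rewrite ltW. Qed.

Lemma pairing_pointD A p q :
  fuzzy_pairing (point (p + q)) A = fuzzy_pairing (point p) A + fuzzy_pairing (point q) A.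
Proof.
have -> : fuzzy_pairing (point (p + q)) A =
    1 * fuzzy_pairing (point p) A + 1 * fuzzy_pairing (point q) A.
  apply: fuzzy_pairing_linear => a u /gt0_01 a01 _.
  by rewrite !support_point_fuzzy // dotDr !mul1r.
by rewrite !mul1r.
Qed.

Lemma pairing_pointZ A c p :
  fuzzy_pairing (point (c *: p)) A = c * fuzzy_pairing (point p) A.
Proof.
have -> : fuzzy_pairing (point (c *: p)) A =
    c * fuzzy_pairing (point p) A + 0 * fuzzy_pairing (point p) A.
  apply: fuzzy_pairing_linear => a u /gt0_01 a01 _.
  by rewrite !support_point_fuzzy // dotZr mul0r addr0.
by rewrite mul0r addr0.
Qed.

Lemma Steiner_coord A i :
  Steiner A 0 i = (ball_volume R d)^-1 * fuzzy_pairing A (point (delta_mx 0 i)).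
Proof.
rewrite mxE fuzzy_pairingE -int01Z; last exact: monotone_difference_pairing.
apply: eq_int01 => a a01; rewrite mxE; congr (_ * _).
by apply: eq_sphere_int => u _; rewrite level_point // support_point dot_delta.
Qed.

(** The support function of the point [p] is the linear function [u |-> dot u p], and
    the coordinates of the Steiner point are the inner products with the coordinate
    functions. *)
Lemma Steiner_eq0P A : Steiner A = 0 <-> forall p, fuzzy_pairing A (point p) = 0.
Proof.
split => [A0 p|h]; last first.
  by apply/rowP => i; rewrite Steiner_coord h mulr0 mxE.
have e0 i : fuzzy_pairing A (point (delta_mx 0 i)) = 0.
  have /rowP/(_ i) := A0; rewrite Steiner_coord mxE => /eqP.
  by rewrite mulf_eq0 invr_eq0 gt_eqF ?ball_volume_gt0 //= => /eqP.
rewrite (row_sum_delta p) fuzzy_pairingC.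
elim/big_ind: _ => [|x y hx hy|i _].
- by rewrite -(scale0r 0) pairing_pointZ mul0r.
- by rewrite pairing_pointD hx hy addr0.
- by rewrite pairing_pointZ fuzzy_pairingC e0 mulr0.
Qed.

(** ** Sums and midpoints *)

Lemma support_fuzzy_sum A B K u a : is_fuzzy_sum A B K -> 0 <= a <= 1 ->
  support K u a = support A u a + support B u a.
Proof.
by move=> h a01; rewrite /support h // support_sum //; exact: level_body.
Qed.

Lemma is_fuzzy_sum_support A B K :
  (forall a u, 0 < a <= 1 -> S u -> support K u a = support A u a + support B u a) ->
  is_fuzzy_sum A B K.
Proof.
move=> h; apply: is_fuzzy_sum_gt0 => a a01; have bA := level_body_gt0 A a01.
have bB := level_body_gt0 B a01; apply: support_inj.
- exact: level_body_gt0.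
- exact: body_sum.
- by move=> u u1; rewrite support_sum //; exact: h.
Qed.

Lemma fuzzy_pairing_sum A B K C : is_fuzzy_sum A B K ->
  fuzzy_pairing K C = fuzzy_pairing A C + fuzzy_pairing B C.
Proof.
move=> h.
have -> : fuzzy_pairing K C = 1 * fuzzy_pairing A C + 1 * fuzzy_pairing B C.
  apply: fuzzy_pairing_linear => a u /gt0_01 a01 _.
  by rewrite (support_fuzzy_sum _ h) // !mul1r.
by rewrite !mul1r.
Qed.

Lemma Steiner_sum A B K : is_fuzzy_sum A B K -> Steiner A = 0 -> Steiner K = 0 ->
  Steiner B = 0.
Proof.
move=> h /Steiner_eq0P A0 /Steiner_eq0P K0; apply/Steiner_eq0P => p.
by have := fuzzy_pairing_sum (point p) h; rewrite A0 K0 add0r.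
Qed.

Lemma is_fuzzy_sum_zero A : is_fuzzy_sum (point 0) A A.
Proof.
apply: is_fuzzy_sum_support => a u /gt0_01 a01 _.
by rewrite support_point_fuzzy // dot0r add0r.
Qed.

Lemma ultra_oo : exists U : set_system nat, UltraFilter U /\ \oo `<=` U.
Proof. exact: (@ultraFilterLemma nat \oo). Qed.

(** The averages of the level sets are left-continuous in the level by compactness:
    given decompositions of a point at levels increasing to [a], their terms converge
    along an ultrafilter to points of the level sets at [a]. *)
Lemma fuzzy_midpoint A B : exists C, forall a u, 0 < a <= 1 -> S u ->
  support C u a = 2^-1 * support A u a + 2^-1 * support B u a.
Proof.
have h0 : 0 <= 2^-1 :> R by rewrite invr_ge0.
pose L a := combine_set 2^-1 2^-1 (level A a) (level B a).
have bL a : 0 < a <= 1 -> convex_body (L a).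
  by move=> a01; apply: body_combine; exact: level_body_gt0.
have [M M0 [hA hB]] := fuzzy_bounded2 A B.
have [|||a x /andP[a0 a1] Lx|C hC] := @fuzzy_of_levels R d L M.
- move=> a /bL [L0 cL /convex_setP xL]; split => //.
  by apply: compact_closed => //; exact: norm_hausdorff.
- move=> a /andP[/ltW a0 a1] _ [x [y [Ax By ->]]].
  have := level_bounded a0 hA Ax; have := level_bounded a0 hB By; rewrite /eball /= => h1 h2.
  by apply: le_trans (ler_enormD _ _) _; rewrite !enormZ !ger0_norm //; lra.
- move=> a b /ltW a0 ab b1 _ [x [y [Ax By ->]]].
  by exists x, y; split => //; exact: (level_anti a0 ab).
- have [U [UU ooU]] := ultra_oo.
  (* positive levels tending to [a] from strictly below *)
  pose b n : R := a * (1 - n.+1%:R^-1 * 2^-1).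
  have b01 n : 0 < b n /\ b n < a.
    have n0 : 0 < n.+1%:R^-1 * 2^-1 :> R by rewrite mulr_gt0 ?invr_gt0 ?ltr0n.
    have n1 : n.+1%:R^-1 * 2^-1 < 1 :> R.
      by rewrite -invfM invf_lt1 -?natrM ?ltr0n ?ltr1n // mulSn.
    by rewrite /b; split; [rewrite mulr_gt0 // subr_gt0|rewrite gtr_pMr // ltrBlDr ltrDl].
  have /choice [z hz] n : exists z : 'rV[R]_d * 'rV[R]_d,
      [/\ level A (b n) z.1, level B (b n) z.2 & x = 2^-1 *: z.1 + 2^-1 *: z.2].
    by have [b0 ba] := b01 n; have [p [q [? ? ?]]] := Lx _ b0 ba; exists (p, q).
  have ev c : 0 < c -> c < a -> \forall n \near U, c <= b n.
    move=> c0 ca; apply: ooU.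
    have bcvg : b n @[n --> \oo] --> a * (1 - 0).
      apply: cvgMl_tmp; apply: cvgB; first exact: cvg_cst.
      exact: cvg_invSn.
    rewrite subr0 mulr1 in bcvg.
    move/cvgrPdist_lt : bcvg => /(_ (a - c)); rewrite subr_gt0 => /(_ ca).
    by apply: filterS => n; rewrite ltr_distlC => /andP[+ _]; rewrite subKr => /ltW.
  have lim (D : fuzzy R d) (w : nat -> 'rV[R]_d) : fuzzy_bounded D M ->
      (forall n, level D (b n) (w n)) -> exists2 y, level D a y & w @ U --> y.
    move=> hD hw; have [|y _ wy] := @ultra_cvg R d U UU w _ (@compact_eball R d M).
      apply: nearW => n; have [/ltW b0 _] := b01 n; exact: (level_bounded b0 hD).
    exists y => //; apply: level_left => // c c0 ca.
    have cD : closed (level D c) by apply: fuzzy_usc; rewrite c0 (le_trans (ltW ca)).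
    apply: (closed_cvg _ cD _ _ wy).
    by apply: filterS (ev c c0 ca) => n cb; exact: (level_anti (ltW c0) cb).
  have [p Ap zp] := lim A (fst \o z) hA (fun n => let: And3 h _ _ := hz n in h).
  have [q Bq zq] := lim B (snd \o z) hB (fun n => let: And3 _ h _ := hz n in h).
  exists p, q; split => //.
  have xc : (fun=> x) @ U --> 2^-1 *: p + 2^-1 *: q.
    rewrite (_ : (fun=> x) = (fun n => 2^-1 *: (z n).1 + 2^-1 *: (z n).2)); last first.
      by apply/funext => n; have [] := hz n.
    by apply: cvgD; apply: cvgZ => //; exact: cvg_cst.
  by apply: (cvg_unique _ _ xc); [exact: norm_hausdorff|exact: cvg_cst].
exists C => a u a01 u1; rewrite /support hC // support_combine //; exact: level_body_gt0.
Qed.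

(** The parallelogram identity in the space of support functions. *)
Lemma sqdist_midpoint A B C K :
  (forall a u, 0 < a <= 1 -> S u ->
     support C u a = 2^-1 * support A u a + 2^-1 * support B u a) ->
  sqdist K C = 2^-1 * sqdist K A + 2^-1 * sqdist K B - 4^-1 * sqdist A B.
Proof.
move=> h; have e := fuzzy_pairing_linear _ h.
rewrite /sqdist !(fuzzy_pairingC K) !e !(fuzzy_pairingC _ C) !e.
rewrite (fuzzy_pairingC B A).
move: (fuzzy_pairing A A) (fuzzy_pairing A B) (fuzzy_pairing B B).
move: (fuzzy_pairing K K) (fuzzy_pairing A K) (fuzzy_pairing B K) => a b c p q r.
by field.
Qed.

End fuzzy_pairing.

(** * Limits of fuzzy sets along an ultrafilter *)

Section fuzzy_limit.
Context {R : realType} {d : nat} (U : set_system nat) {UU : UltraFilter U}.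
Implicit Types (A B C : nat -> fuzzy R d) (H K : fuzzy R d).
Local Notation area := (sphere_area R d).

(** The ultralimits of the level sets need not be left-continuous in the level;
    the limit is their regularization. *)
Definition fuzzy_limit A H : Prop := forall a x, 0 < a <= 1 ->
  level H a x <-> (forall b, 0 < b -> b < a -> ulim U (fun n => level (A n) b) x).

Let levels_body A a : 0 < a <= 1 -> forall n, convex_body (level (A n) a).
Proof. by move=> a01 n; exact: level_body_gt0. Qed.

Let levels_bounded A M a : 0 < a <= 1 -> (forall n, fuzzy_bounded (A n) M) ->
  forall n, level (A n) a `<=` eball M.
Proof. by move=> /andP[/ltW a0 _] h n; exact: level_bounded (h n). Qed.

Lemma fuzzy_limit_exists A (M : R) : (forall n, fuzzy_bounded (A n) M) ->
  exists2 H, fuzzy_limit A H & fuzzy_bounded H M.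
Proof.
move=> hM; pose L a := ulim U (fun n => level (A n) a).
have LM a : 0 < a <= 1 -> L a `<=` eball M.
  by move=> a01; apply: ulim_bounded => n; exact: levels_bounded.
have [|//|a b a0 ab b1|H hH] := @fuzzy_regularization R d L M.
- by move=> a a01; apply: (@ulim_body _ _ _ _ _ M) => n;
    [exact: levels_body|exact: levels_bounded].
- by apply: ulim_subset => n; exact: (level_anti (ltW a0) ab).
exists H => //; apply: fuzzy_bounded_gt0 => a a01 x /(hH a x a01) h.
have /andP[a0 a1] := a01; apply: (LM (a / 2)); [lra|apply: h; lra].
Qed.

Lemma ulim_level_sub A H a : fuzzy_limit A H -> 0 < a <= 1 ->
  ulim U (fun n => level (A n) a) `<=` level H a.
Proof.
move=> hH a01 x Lx; apply/(hH a x a01) => b b0 ba; move: x Lx.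
by apply: ulim_subset => n; exact: (level_anti (ltW b0) (ltW ba)).
Qed.

Lemma level_sub_ulim A H a b : fuzzy_limit A H -> 0 < a -> a < b -> b <= 1 ->
  level H b `<=` ulim U (fun n => level (A n) a).
Proof. by move=> hH a0 ab b1 x /hH; apply => //; rewrite (lt_trans a0). Qed.

Lemma fuzzy_limit_cst K : fuzzy_limit (fun=> K) K.
Proof.
have ulimE b : 0 < b <= 1 -> ulim U (fun=> level K b) = level K b.
  move=> b01; apply/seteqP; split => x; last first.
    by move=> Kx; apply: (ulim_cvg (b := fun=> x)); [exact: nearW|exact: cvg_cst].
  have /(closure_id _).1 cK : closed (level K b) by exact: fuzzy_usc.
  by move=> h; rewrite cK; apply/closure_enormP => e e0; have [n] := filter_ex (h e e0).
move=> a x /andP[a0 a1]; split => [Kx b b0 ba|h].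
  by rewrite ulimE; [exact: (level_anti (ltW b0) (ltW ba))|rewrite b0 (le_trans (ltW ba))].
apply: level_left => // b b0 ba; have := h b b0 ba.
by rewrite ulimE // b0 (le_trans (ltW ba)).
Qed.

(** The regularized limits lie between the ultralimit at the same level and the
    ultralimits at all lower levels.  The first bound decomposes the points of [K],
    the second puts the sums into all lower levels of [K]. *)
Lemma fuzzy_limit_sum A B H H' K (M : R) :
  (forall n, fuzzy_bounded (A n) M) -> (forall n, fuzzy_bounded (B n) M) ->
  fuzzy_limit A H -> fuzzy_limit B H' ->
  (forall n, is_fuzzy_sum (A n) (B n) K) -> is_fuzzy_sum H H' K.
Proof.
move=> hA hB lA lB hK; apply: is_fuzzy_sum_gt0 => a a01.
have sumE b : 0 < b <= 1 -> minkowski_sum (ulim U (fun n => level (A n) b))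
    (ulim U (fun n => level (B n) b)) = level K b.
  move=> b01; apply: (@ulim_sum _ _ _ _ _ _ _ M).
  - exact: fuzzy_usc.
  - exact: levels_bounded.
  - exact: levels_bounded.
  - by apply: nearW => n; rewrite (hK n) //; exact: gt0_01.
have /andP[a0 a1] := a01; apply/seteqP; split => [z|_ [x [y [Hx Hy ->]]]].
  rewrite -sumE // => -[x [y [Ax By ->]]].
  by exists x, y; split => //; [exact: ulim_level_sub Ax|exact: ulim_level_sub By].
apply: level_left => // b b0 ba.
rewrite -sumE; last by rewrite b0 (le_trans (ltW ba)).
by exists x, y; split => //; [exact: (level_sub_ulim lA b0 ba)|exact: (level_sub_ulim lB b0 ba)].
Qed.

(** The inner product is a combination of integrals of monotone functions of the
    level, to each of which [int01_cvg_monotone] applies. *)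
Lemma fuzzy_pairing_cvg A B H H' (M : R) : 0 <= M ->
  (forall n, fuzzy_bounded (A n) M) -> (forall n, fuzzy_bounded (B n) M) ->
  fuzzy_bounded H M -> fuzzy_bounded H' M ->
  fuzzy_limit A H -> fuzzy_limit B H' ->
  fuzzy_pairing (A n) (B n) @[n --> U] --> fuzzy_pairing H H'.
Proof.
move=> M0 hA hB bH bH' lA lB.
have bL (D : nat -> fuzzy R d) a : (forall n, fuzzy_bounded (D n) M) -> 0 < a <= 1 ->
    convex_body (ulim U (fun n => level (D n) a)) /\
    ulim U (fun n => level (D n) a) `<=` eball M.
  move=> hD a01; split; last by apply: ulim_bounded => n; exact: levels_bounded.
  by apply: (@ulim_body _ _ _ _ _ M) => n; [exact: levels_body|exact: levels_bounded].
have mean (D : nat -> fuzzy R d) (G : fuzzy R d) : (forall n, fuzzy_bounded (D n) M) -> fuzzy_bounded G M ->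
    fuzzy_limit D G ->
    int01 (fun a => shifted_mean M (level (D n) a)) @[n --> U] -->
    int01 (fun a => shifted_mean M (level G a)).
  move=> hD hG lD.
  apply: (@int01_cvg_monotone _ _ _ _ (fun a => shifted_mean M (ulim U (fun n => level (D n) a)))
    _ (2 * M * area)).
  - by move=> n; exact: nonincreasing_shifted_mean.
  - exact: nonincreasing_shifted_mean.
  - move=> n a a01; apply: shifted_mean_bounds; first exact: level_body.
    by apply: (level_bounded _ (hD n)); case/andP: a01.
  - move=> a a01; apply: shifted_mean_bounds; first exact: level_body.
    by apply: (level_bounded _ hG); case/andP: a01.
  - move=> a a01; apply: shifted_mean_ulim => // n; first exact: levels_body.
    exact: levels_bounded.
  - move=> a a01; have [b1 _] := bL D a hD a01.
    by apply: le_shifted_mean => //; [exact: level_body_gt0|exact: ulim_level_sub].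
  - move=> a b a0 ab b1; have a01 : 0 < a <= 1 by rewrite a0 (le_trans (ltW ab)).
    have [bu _] := bL D a hD a01; apply: le_shifted_mean => //.
      by apply: level_body_gt0; rewrite (lt_trans a0).
    exact: level_sub_ulim.
have pair : int01 (fun a => shifted_pairing M (level (A n) a) (level (B n) a)) @[n --> U] -->
    int01 (fun a => shifted_pairing M (level H a) (level H' a)).
  apply: (@int01_cvg_monotone _ _ _ _ (fun a => shifted_pairing M
    (ulim U (fun n => level (A n) a)) (ulim U (fun n => level (B n) a)))
    _ ((2 * M) ^+ 2 * area)).
  - by move=> n; exact: nonincreasing_shifted_pairing.
  - exact: nonincreasing_shifted_pairing.
  - move=> n a a01; have /andP[a0 _] := a01.
    by apply: shifted_pairing_bounds; [exact: level_body|exact: level_body|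
      exact: (level_bounded a0 (hA n))|exact: (level_bounded a0 (hB n))].
  - move=> a a01; have /andP[a0 _] := a01.
    by apply: shifted_pairing_bounds; [exact: level_body|exact: level_body|
      exact: (level_bounded a0 bH)|exact: (level_bounded a0 bH')].
  - by move=> a a01; apply: shifted_pairing_ulim => // n;
      [exact: levels_body|exact: levels_body|exact: levels_bounded|exact: levels_bounded].
  - move=> a a01; have [bA _] := bL A a hA a01; have [bB _] := bL B a hB a01.
    have /andP[/ltW a0 _] := a01; apply: le_shifted_pairing => //.
    + exact: level_body_gt0.
    + exact: level_body_gt0.
    + exact: ulim_level_sub.
    + exact: ulim_level_sub.
    + exact: level_bounded.
    + exact: level_bounded.
  - move=> a b a0 ab b1; have a01 : 0 < a <= 1 by rewrite a0 (le_trans (ltW ab)).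
    have b01 : 0 < b <= 1 by rewrite (lt_trans a0).
    have [bA AM] := bL A a hA a01; have [bB BM] := bL B a hB a01.
    apply: le_shifted_pairing => //.
    + exact: level_body_gt0.
    + exact: level_body_gt0.
    + exact: level_sub_ulim.
    + exact: level_sub_ulim.
rewrite (fuzzy_pairing_shift bH bH').
rewrite (_ : (fun n => _) = (fun n =>
  (int01 (fun a => shifted_pairing M (level (A n) a) (level (B n) a)) +
    - M * int01 (fun a => shifted_mean M (level (A n) a))) +
  (- M * int01 (fun a => shifted_mean M (level (B n) a)) + M ^+ 2 * area))); last first.
  by apply/funext => n; exact: fuzzy_pairing_shift.
apply: cvgD; apply: cvgD.
- exact: pair.
- by apply: cvgMl_tmp; exact: mean.
- by apply: cvgMl_tmp; exact: mean.
- exact: cvg_cst.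
Qed.

Lemma fuzzy_bounded_le K (M N : R) : M <= N -> fuzzy_bounded K M -> fuzzy_bounded K N.
Proof. by move=> MN h x /h xM; exact: le_trans MN. Qed.

Lemma sqdist_cvg B H K (M : R) : 0 <= M ->
  (forall n, fuzzy_bounded (B n) M) -> fuzzy_bounded H M -> fuzzy_limit B H ->
  sqdist K (B n) @[n --> U] --> sqdist K H.
Proof.
move=> M0 hB bH lB; have [N N0 bK] := fuzzy_boundedP K.
have MN0 : 0 <= M + N by exact: addr_ge0.
have hB' n : fuzzy_bounded (B n) (M + N) by apply: fuzzy_bounded_le (hB n); rewrite lerDl.
have bH' : fuzzy_bounded H (M + N) by apply: fuzzy_bounded_le bH; rewrite lerDl.
have bK' : fuzzy_bounded K (M + N) by apply: fuzzy_bounded_le bK; rewrite lerDr.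
apply: cvgD; last exact: (fuzzy_pairing_cvg MN0 hB' hB' bH' bH' lB lB).
apply: cvgB; first exact: cvg_cst.
apply: cvgMl_tmp; apply: (fuzzy_pairing_cvg MN0 (fun=> bK') hB' bK' bH' _ lB).
exact: fuzzy_limit_cst.
Qed.

Lemma Steiner_limit B H (M : R) : 0 <= M ->
  (forall n, fuzzy_bounded (B n) M) -> fuzzy_bounded H M -> fuzzy_limit B H ->
  (forall n, Steiner (B n) = 0) -> Steiner H = 0.
Proof.
move=> M0 hB bH lB B0; apply/Steiner_eq0P => p.
have [N N0 bp] := fuzzy_boundedP (point p).
have MN0 : 0 <= M + N by exact: addr_ge0.
have hB' n : fuzzy_bounded (B n) (M + N) by apply: fuzzy_bounded_le (hB n); rewrite lerDl.
have bH' : fuzzy_bounded H (M + N) by apply: fuzzy_bounded_le bH; rewrite lerDl.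
have bp' : fuzzy_bounded (point p) (M + N) by apply: fuzzy_bounded_le bp; rewrite lerDr.
have := fuzzy_pairing_cvg MN0 hB' (fun=> bp') bH' bp' lB (@fuzzy_limit_cst (point p)).
rewrite (_ : (fun n => _) = (fun=> 0)); last first.
  by apply/funext => n; have /Steiner_eq0P := B0 n; apply.
move=> h; apply: (cvg_unique _ h); [exact: norm_hausdorff|exact: cvg_cst].
Qed.

End fuzzy_limit.

(** * Summands with vanishing Steiner point are bounded *)

Section summand_bound.
Context (R : realType) (d : nat).
Local Notation S := (@unit_sphere R d).
Local Notation area := (sphere_area R d).
Local Notation sphere_int := (@sphere_int R d).

Lemma continuous_dotl (p : 'rV[R]_d) : continuous (fun u => dot u p).
Proof.
by rewrite (_ : (fun u => _) = dot p);
  [exact: continuous_dot|apply/funext => u; rewrite dotC].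
Qed.

(** The mean of [`|dot u p|] is a norm of [p], since it vanishes only if [dot u p]
    does on the whole sphere; [c] is its minimum over the unit vectors. *)
Lemma mean_abs_dot : (0 < d)%N ->
  exists2 c, 0 < c & forall p : 'rV[R]_d, c * enorm p <= sphere_int (fun u => `|dot u p|).
Proof.
move=> d0; pose g (p : 'rV[R]_d) := sphere_int (fun u => `|dot u p|).
have cd (p : 'rV[R]_d) : continuous (fun u => `|dot u p|) by apply: continuous_normf; exact: continuous_dotl.
have gc : continuous g.
  apply: (@lipschitz_continuous _ _ area) => p q.
  have half p' q' : g p' - g q' <= area * enorm (p' - q').
    rewrite lerBlDl mulrC -sphere_int_cst -sphere_intD //; last exact: continuous_cstf.
    apply: le_sphere_int => //.
      by apply: continuous_addf => //; exact: continuous_cstf.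
    move=> u u1; rewrite -{1}(subrK q' p') dotDr; apply: le_trans (ler_normD _ _) _.
    by rewrite addrC lerD2l; exact: dot_sphere_le.
  by rewrite ler_norml half lerNl opprB enormBC half.
have [|p /set_mem p1 pmin] := @EVT_min_rV R d g S (unit_sphere_nonempty R d0)
  (@compact_unit_sphere R d); first exact/continuous_subspaceT.
exists (g p).
  have gp0 : 0 <= g p by apply: sphere_int_ge0 => u _.
  rewrite lt0r gp0 andbT; apply/eqP => g0.
  have := sphere_int_eq0 d0 (cd p) (fun u _ => normr_ge0 _) g0 p1.
  move/eqP; rewrite normr_eq0 -sqr_enorm p1 expr1n => /eqP/eqP.
  by rewrite oner_eq0.
move=> q; have [->|q0] := eqVneq q 0.
  by rewrite enorm0 mulr0; apply: sphere_int_ge0.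
have qn : 0 < enorm q by rewrite lt0r enorm_ge0 andbT; apply: contra_neq q0; exact: enorm_eq0.
have /(ler_wpM2r (ltW qn)) h := pmin _ (mem_set (unit_sphere_normalize q0)).
apply: le_trans h _; rewrite mulrC -sphere_intZ //; apply: le_sphere_int => //.
  by apply: continuous_mulf => //; exact: continuous_cstf.
move=> u _; rewrite dotZr normrM gtr0_norm ?invr_gt0 //.
by rewrite mulrA divff ?mul1r // gt_eqF.
Qed.

(** A summand [B] of [K] is contained in a ball of radius [2 * M] around any point
    [p] of its core; orthogonality of its support function to the linear function
    of [p] then bounds [p] itself. *)
Lemma summand_bounded : (0 < d)%N ->
  exists2 k, 0 <= k & forall (A B K : fuzzy R d) (M : R), 0 < M ->
    fuzzy_bounded K M -> is_fuzzy_sum B A K -> Steiner B = 0 ->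
    fuzzy_bounded B (k * M).
Proof.
move=> d0; have [c c0 hc] := mean_abs_dot d0; have ar := sphere_area_ge0 R d.
(* [2 * M] bounds the distance to [p], and [2 * area / c * M] bounds [p] *)
exists (2 + 2 * area / c).
  by rewrite addr_ge0 // divr_ge0 ?(ltW c0) // mulr_ge0.
move=> A B K M M0 bK hK /Steiner_eq0P B0.
have [p Bp] := fuzzy_level1 B.
have near_p a b : 0 < a <= 1 -> level B a b -> enorm (b - p) <= 2 * M.
  move=> a01 Bb; have /andP[a0 a1] := a01.
  have [[y Ay] _ _] := level_body_gt0 A a01.
  have KM := level_bounded (ltW a0) bK.
  have Kb x : level B a x -> enorm (x + y) <= M.
    by move=> Bx; apply: KM; rewrite hK ?gt0_01 //; exists x, y.
  have := ler_enormB (b + y) (p + y); rewrite opprD addrACA subrr addr0.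
  have := Kb b Bb; have := Kb p (level_anti (ltW a0) a1 Bp); lra.
pose W := sphere_int (fun u => `|dot u p|).
have cW : continuous (fun u => `|dot u p|) by apply: continuous_normf; exact: continuous_dotl.
(* with [t = dot u p], the integrand is at least [t^2 - 2 * M * `|t|], which is at
   least [2 * M * `|t| - 4 * M^2] *)
have low a : 0 < a <= 1 -> 2 * M * W - 4 * M ^+ 2 * area <= pairing (level B a) [set p].
  move=> a01; have bB := level_body_gt0 B a01.
  have cs := continuous_mulf (continuous_support bB) (@continuous_dotl p).
  have E : pairing (level B a) [set p] = sphere_int (fun u => support_set (level B a) u * dot u p).
    by apply: eq_sphere_int => u _; rewrite support_point.
  have c1 := continuous_mulf (@continuous_cstf R d (2 * M)) cW.
  have c2 := @continuous_cstf R d (- (4 * M ^+ 2)).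
  rewrite E -mulNr -sphere_int_cst /W -sphere_intZ // -sphere_intD //.
  apply: le_sphere_int => //; first exact: continuous_addf.
  move=> u u1; have [b Bb ->] := support_attained u bB.
  have := dot_sphere_le (b - p) u1; rewrite dotBr => h.
  have {h} h := le_trans h (near_p a b a01 Bb).
  have -> : dot u b * dot u p = (dot u b - dot u p) * dot u p + dot u p * dot u p.
    by rewrite -mulrDl subrK.
  move: h; move: (dot u b - dot u p) => r; move: (dot u p) => t h.
  have h1 : - (2 * M * `|t|) <= r * t.
    rewrite lerNl; apply: le_trans (ler_norm _) _; rewrite normrN normrM.
    by rewrite ler_wpM2r.
  have h2 : t * t = `|t| * `|t| by rewrite -normrM ger0_norm // -expr2 sqr_ge0.
  have := sqr_ge0 (`|t| - 2 * M); rewrite h2; move: h1; move: `|t| (r * t) => x y; lra.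
have Wle : W <= 2 * M * area.
  have mdp := monotone_difference_pairing B (point p).
  have := B0 p; rewrite fuzzy_pairingE => I0.
  have : 2 * M * W - 4 * M ^+ 2 * area <= 0.
    (* [low] holds at positive levels, the only ones that Riemann sums see *)
    have cvR := riemann_cvg mdp; rewrite I0 in cvR.
    apply: (cvgr_to_ge cvR); apply: nearW => N.
    have N0 : 0 < N.+1%:R :> R by rewrite ltr0n.
    rewrite /riemann ler_pdivlMl //.
    apply: (@le_trans _ _ (\sum_(0 <= k < N.+1) (2 * M * W - 4 * M ^+ 2 * area))).
      by rewrite sumr_const_nat subn0 -[leRHS]mulr_natl.
    rewrite !big_nat; apply: ler_sum => k /andP[_ kN].
    have k01 : 0 < (k.+1%:R / N.+1%:R : R) <= 1.
      by rewrite divr_gt0 //= ler_pdivrMr // mul1r ler_nat.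
    by rewrite level_point ?gt0_01 //; exact: low.
  have -> : 2 * M * W - 4 * M ^+ 2 * area = (2 * M) * (W - 2 * M * area) by ring.
  by rewrite pmulr_rle0 ?subr_le0 // mulr_gt0.
have pM : enorm p <= 2 * M * area / c.
  by rewrite ler_pdivlMr // mulrC; apply: le_trans (hc p) _.
apply: fuzzy_bounded_gt0 => a a01 b Bb; rewrite /eball /=.
rewrite -(subrK p b); apply: le_trans (ler_enormD _ _) _.
have -> : (2 + 2 * area / c) * M = 2 * M + 2 * M * area / c by ring.
by apply: lerD => //; exact: near_p Bb.
Qed.

End summand_bound.

(** * Comparison estimates for the metric *)

Section estimates.
Context {R : realType} {d : nat}.
Implicit Types (A B C H K Y Z : fuzzy R d).
Local Notation S := (@unit_sphere R d).
Local Notation area := (sphere_area R d).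

Lemma continuous_level_sqdist A B a : 0 <= a <= 1 ->
  continuous (fun u => `|support A u a - support B u a| ^+ 2).
Proof.
move=> a01; have bA := level_body A a01; have bB := level_body B a01.
have c := continuous_normf (continuous_addf (continuous_support bA)
  (continuous_mulf (@continuous_cstf R d (-1)) (continuous_support bB))).
have := continuous_mulf c c.
by rewrite /support; under eq_fun do rewrite mulN1r -expr2.
Qed.

Lemma le_sqdist A B C K :
  (forall a u, 0 <= a <= 1 -> S u ->
     `|support A u a - support B u a| <= `|support C u a - support K u a|) ->
  sqdist A B <= sqdist C K.
Proof.
move=> h; rewrite !sqdistE; apply: le_int01.
- exact: monotone_difference_level_sqdist.
- exact: monotone_difference_level_sqdist.
- move=> a a01; apply: le_sphere_int; [exact: continuous_level_sqdist..|].
  by move=> u u1; rewrite ler_pXn2r ?nnegrE //; exact: h.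
Qed.

Lemma sqdist_bounded A B (M : R) : 0 <= M -> fuzzy_bounded A M -> fuzzy_bounded B M ->
  sqdist A B <= 4 * M ^+ 2 * area.
Proof.
move=> M0 hA hB; rewrite sqdistE -[leRHS]int01_cst; apply: le_int01.
- exact: monotone_difference_level_sqdist.
- exact: monotone_difference_cst.
- move=> a a01; have /andP[a0 _] := a01; rewrite -sphere_int_cst; apply: le_sphere_int.
  + exact: continuous_level_sqdist.
  + exact: continuous_cstf.
  + move=> u u1; have -> : 4 * M ^+ 2 = (M + M) ^+ 2 by ring.
    rewrite ler_pXn2r ?nnegrE ?addr_ge0 //; apply: le_trans (ler_normB _ _) _.
    by apply: lerD; apply: support_norm => //; [exact: level_body|exact: level_bounded|
      exact: level_body|exact: level_bounded].
Qed.

(** The triangle inequality in the form that survives squaring, integrated from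
    [(x + y)^2 <= (1 + e) * x^2 + (1 + 1/e) * y^2]. *)
Lemma sqdist_triangle A B C (e : R) : 0 < e ->
  sqdist A C <= (1 + e) * sqdist A B + (1 + e^-1) * sqdist B C.
Proof.
move=> e0; rewrite !sqdistE.
have hAB := monotone_difference_level_sqdist A B.
have hBC := monotone_difference_level_sqdist B C.
have h1 := monotone_differenceZ (1 + e) hAB.
have h2 := monotone_differenceZ (1 + e^-1) hBC.
rewrite -!int01Z // -int01D //; apply: le_int01.
- exact: monotone_difference_level_sqdist.
- exact: monotone_differenceD.
- move=> a a01; have cAC := @continuous_level_sqdist A C a a01.
  have cAB := @continuous_level_sqdist A B a a01.
  have cBC := @continuous_level_sqdist B C a a01.
  have c1 := continuous_mulf (@continuous_cstf R d (1 + e)) cAB.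
  have c2 := continuous_mulf (@continuous_cstf R d (1 + e^-1)) cBC.
  rewrite /level_sqdist -!sphere_intZ // -sphere_intD //; apply: le_sphere_int => //.
    exact: continuous_addf.
  move=> u _; rewrite !real_normK ?num_real //.
  have -> : support A u a - support C u a =
    (support A u a - support B u a) + (support B u a - support C u a).
    by rewrite addrA subrK.
  move: (support A u a - support B u a) => x; move: (support B u a - support C u a) => y.
  rewrite -subr_ge0.
  have -> : (1 + e) * x ^+ 2 + (1 + e^-1) * y ^+ 2 - (x + y) ^+ 2 =
     e^-1 * (e * x - y) ^+ 2.
    by field; rewrite gt_eqF.
  by rewrite mulr_ge0 ?sqr_ge0 // invr_ge0 ltW.
Qed.

Lemma sqdistxx A : sqdist A A = 0.
Proof.
rewrite /sqdist; move: (fuzzy_pairing A A) => p; ring.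
Qed.

Lemma sqdist_summand A B K : is_fuzzy_sum A B K -> sqdist K A = fuzzy_pairing B B.
Proof.
move=> h; rewrite /sqdist (fuzzy_pairing_sum K h) !(fuzzy_pairingC _ K).
rewrite !(fuzzy_pairing_sum _ h) (fuzzy_pairingC B A).
move: (fuzzy_pairing A A) (fuzzy_pairing A B) (fuzzy_pairing B B) => p q r; ring.
Qed.

(** If [p] lies in the core of the remainder [Z], then the support functions of
    [Z - p] and [Y - p] satisfy [0 <= s_{Z - p} <= s_{Y - p}]; and the shift adds
    the same quantity to both squared norms, the Steiner points of [Y] and [Z]
    being [0]. *)
Lemma sqdist_summand_le C H K Y Z :
  is_fuzzy_sum H Y K -> is_fuzzy_sum C Z K -> Steiner Y = 0 -> Steiner Z = 0 ->
  (forall a, 0 <= a <= 1 -> level H a `<=` level C a) ->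
  sqdist K C <= sqdist K H.
Proof.
move=> hY hZ /Steiner_eq0P Y0 /Steiner_eq0P Z0 HC.
rewrite (sqdist_summand hY) (sqdist_summand hZ).
have [p Zp] := fuzzy_level1 Z.
have : sqdist Z (point p) <= sqdist Y (point p).
  apply: le_sqdist => a u a01 u1; rewrite !support_point_fuzzy //.
  have /andP[a0 a1] := a01.
  have pZ : dot u p <= support Z u a.
    by apply: support_ub; [exact: level_body|exact: (level_anti a0 a1)].
  have ZY : support Z u a <= support Y u a.
    have := support_fuzzy_sum u hY a01; rewrite (support_fuzzy_sum u hZ a01).
    have : support H u a <= support C u a.
      by apply: support_subset; [exact: level_body|exact: level_body|exact: HC].
    lra.
  by rewrite !ger0_norm; lra.
rewrite /sqdist Y0 Z0; lra.
Qed.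

Lemma midpoint_sum A B C A' B' C' K :
  is_fuzzy_sum A A' K -> is_fuzzy_sum B B' K ->
  (forall a u, 0 < a <= 1 -> S u ->
     support C u a = 2^-1 * support A u a + 2^-1 * support B u a) ->
  (forall a u, 0 < a <= 1 -> S u ->
     support C' u a = 2^-1 * support A' u a + 2^-1 * support B' u a) ->
  is_fuzzy_sum C C' K.
Proof.
move=> hA hB hC hC'; apply: is_fuzzy_sum_support => a u a01 u1.
rewrite hC // hC' //; have := support_fuzzy_sum u hA (gt0_01 a01).
have := support_fuzzy_sum u hB (gt0_01 a01); lra.
Qed.

Lemma Steiner_midpoint A B C : Steiner A = 0 -> Steiner B = 0 ->
  (forall a u, 0 < a <= 1 -> S u ->
     support C u a = 2^-1 * support A u a + 2^-1 * support B u a) ->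
  Steiner C = 0.
Proof.
move=> /Steiner_eq0P A0 /Steiner_eq0P B0 h; apply/Steiner_eq0P => p.
by rewrite (fuzzy_pairing_linear _ h) A0 B0 !mulr0 addr0.
Qed.

End estimates.

(** * Measurability of functionals of fuzzy random variables *)

Section set_functionals.
Context {R : realType} {d : nat}.
Implicit Types (A B C : set 'rV[R]_d).
Local Notation S := (@unit_sphere R d).
Local Notation area := (sphere_area R d).

(** Support functions metrize the Hausdorff distance, so this is lower
    semicontinuity on the space of convex bodies. *)
Definition lower_semicontinuous (phi : set 'rV[R]_d -> R) : Prop :=
  forall A c, convex_body A -> c < phi A ->
    exists2 e, 0 < e & forall B, convex_body B ->
      (forall u, S u -> `|support_set A u - support_set B u| <= e) -> c < phi B.

Lemma support_le_eball B (M : R) : convex_body B -> 0 <= M ->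
  (forall u, S u -> support_set B u <= M) -> B `<=` eball M.
Proof.
move=> bB M0 h x Bx; rewrite /eball /=; have [->|x0] := eqVneq x 0.
  by rewrite enorm0.
have u1 := unit_sphere_normalize x0; apply: le_trans (h _ u1).
apply: le_trans (support_ub _ bB Bx); rewrite dotZl -sqr_enorm expr2 mulrA mulVf ?mul1r //.
by apply: contra_neq x0; exact: enorm_eq0.
Qed.

Lemma close_eball A B (M e : R) : convex_body A -> convex_body B -> 0 <= M -> 0 <= e ->
  A `<=` eball M ->
  (forall u, S u -> `|support_set A u - support_set B u| <= e) -> B `<=` eball (M + e).
Proof.
move=> bA bB M0 e0 AM h; apply: support_le_eball => // [|u u1]; first exact: addr_ge0.
have := h u u1; have := support_norm bA AM u1.
by rewrite !ler_norml => /andP[_ h1] /andP[h2 _]; lra.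
Qed.

Lemma lipschitz_lower_semicontinuous (phi : set 'rV[R]_d -> R) :
  (forall A, convex_body A -> exists2 k, 0 <= k & forall B e, convex_body B ->
     0 <= e <= 1 -> (forall u, S u -> `|support_set A u - support_set B u| <= e) ->
     phi A <= phi B + k * e) ->
  lower_semicontinuous phi.
Proof.
move=> h A c bA cA; have [k k0 hk] := h A bA.
have g0 : 0 < phi A - c by rewrite subr_gt0.
have kg : 0 < k + (phi A - c) + 1 by lra.
pose e := (phi A - c) / (k + (phi A - c) + 1).
have e0 : 0 < e by rewrite divr_gt0.
have e1 : e <= 1 by rewrite ler_pdivrMr // mul1r; lra.
exists e => // B bB hAB; have := hk B e bB _ hAB; rewrite (ltW e0) e1 => /(_ isT).
have : k * e < phi A - c.
  by rewrite mulrCA gtr_pMr // ltr_pdivrMr // mul1r; lra.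
lra.
Qed.

Lemma pairing_lower_semicontinuous C : convex_body C ->
  lower_semicontinuous (fun A => pairing A C).
Proof.
move=> bC; apply: lipschitz_lower_semicontinuous => A bA.
have [M M0 AM] := body_bounded bA; have [N N0 CN] := body_bounded bC.
exists (2 * (M + N) * area).
  by rewrite !mulr_ge0 ?addr_ge0 // sphere_area_ge0.
move=> B e bB /andP[e0 e1] h; rewrite mulrAC -lerBlDl; apply: le_trans (ler_norm _) _.
apply: pairing_lipschitz => //.
- by move=> x /AM; rewrite /eball /= => xM; apply: le_trans xM _; rewrite lerDl.
- by move=> x /CN; rewrite /eball /= => xN; apply: le_trans xN _; rewrite lerDr.
- by move=> u u1; rewrite subrr normr0.
Qed.

Lemma pairing_self_lower_semicontinuous :
  lower_semicontinuous (fun A => pairing A A).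
Proof.
apply: lipschitz_lower_semicontinuous => A bA; have [M M0 AM] := body_bounded bA.
exists (2 * (M + 1) * area).
  by rewrite !mulr_ge0 ?addr_ge0 // sphere_area_ge0.
move=> B e bB /andP[e0 e1] h; rewrite mulrAC -lerBlDl; apply: le_trans (ler_norm _) _.
apply: pairing_lipschitz => //.
- by move=> x /AM; rewrite /eball /= => xM; apply: le_trans xM _; rewrite lerDl.
- move=> x /(close_eball bA bB M0 e0 AM h); rewrite /eball /= => xM.
  by apply: le_trans xM _; rewrite lerD2l.
Qed.

Definition radius A : R := sup [set enorm x | x in A].

Lemma radius_ub A x : convex_body A -> A x -> enorm x <= radius A.
Proof.
move=> bA Ax; apply: ub_le_sup; last by exists x.
by have [M _ hM] := body_bounded bA; exists M => _ [y /hM yM <-].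
Qed.

Lemma radius_le A M : convex_body A -> A `<=` eball M -> radius A <= M.
Proof.
move=> [[a Aa] _ _] AM; apply: ge_sup; first by exists (enorm a), a.
by move=> _ [x /AM xM <-].
Qed.

Lemma radius_ge0 A : convex_body A -> 0 <= radius A.
Proof.
by move=> bA; have [[a Aa] _ _] := bA; apply: le_trans (enorm_ge0 a) _; exact: radius_ub.
Qed.

Lemma radius_lower_semicontinuous : lower_semicontinuous radius.
Proof.
apply: lipschitz_lower_semicontinuous => A bA; exists 1 => // B e bB /andP[e0 _] h.
rewrite mul1r; apply: radius_le => // x Ax.
have [u u1|b Bb xb] := @support_near _ _ B x e bB e0.
  have := support_ub u bA Ax; have := h u u1; rewrite ler_norml => /andP[_]; lra.
rewrite /eball /= -(subrK b x); apply: le_trans (ler_enormD _ _) _.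
by rewrite addrC; apply: lerD => //; exact: radius_ub.
Qed.

Lemma hausdorff_dist_ge0 A B : (0 < d)%N -> convex_body A -> convex_body B ->
  0 <= hausdorff_dist A B.
Proof.
move=> d0 bA bB; have [u u1] := unit_sphere_nonempty R d0.
exact: le_trans (normr_ge0 _) (support_hausdorff_dist bA bB u1).
Qed.

Lemma hausdorff_dist_triangle A B C : (0 < d)%N ->
  convex_body A -> convex_body B -> convex_body C ->
  hausdorff_dist A C <= hausdorff_dist A B + hausdorff_dist B C.
Proof.
move=> d0 bA bB bC; apply: hausdorff_dist_le => //.
  by rewrite addr_ge0 // hausdorff_dist_ge0.
move=> u u1; have -> : support_set A u - support_set C u =
  (support_set A u - support_set B u) + (support_set B u - support_set C u).
  by rewrite addrA subrK.
by apply: le_trans (ler_normD _ _) _; apply: lerD; exact: support_hausdorff_dist.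
Qed.

(** Support functions are additive, so that the common summand cancels. *)
Lemma hausdorff_dist_sum A B C : (0 < d)%N ->
  convex_body A -> convex_body B -> convex_body C ->
  hausdorff_dist A B <= hausdorff_dist (minkowski_sum C A) (minkowski_sum C B).
Proof.
move=> d0 bA bB bC; have bCA := body_sum bC bA; have bCB := body_sum bC bB.
apply: hausdorff_dist_le => // [|u u1]; first exact: hausdorff_dist_ge0.
have := support_hausdorff_dist bCA bCB u1.
by rewrite !support_sum // opprD addrACA subrr add0r.
Qed.

End set_functionals.

Section frv.
Context {R : realType} {d : nat} {dO : measure_display}
  {Omega : measurableType dO} (P : probability Omega R).
Implicit Types (X Y : Omega -> fuzzy R d) (H B : fuzzy R d).
Local Notation area := (sphere_area R d).

(** The sets where a lower semicontinuous functional exceeds a constant are open for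
    the Hausdorff distance. *)
Lemma measurable_level_functional X phi a : is_frv X -> 0 < a <= 1 ->
  lower_semicontinuous phi -> measurable_fun setT (fun w => phi (level (X w) a)).
Proof.
move=> hX a01 lsc; apply: (measurability _ (RGenOInfty.measurableE R)).
move=> _ [_ [c ->] <-]; rewrite setTI.
pose V : set (set 'rV[R]_d) := [set A | convex_body A /\ c < phi A].
have VE : (fun w => phi (level (X w) a)) @^-1` `]c, +oo[%classic =
    [set w | V (level (X w) a)].
  apply/seteqP; split => w; rewrite /V /= in_itv /= andbT; last by case.
  by move=> h; split => //; exact: level_body_gt0.
rewrite VE; apply: hX => //; apply: sub_sigma_algebra.
split => [A []//|A [bA cA]]; have [e e0 he] := lsc A c bA cA.
exists e => // B bB AB; split => //; apply: he => // u u1.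
by apply: le_trans (ltW AB); exact: support_hausdorff_dist.
Qed.

(** Riemann sums involve finitely many levels only, so that measurability at each
    level suffices. *)
Lemma measurable_fuzzy_functional X (F : fuzzy R d -> R) (f : fuzzy R d -> R -> R) :
  (forall w, monotone_difference (f (X w))) ->
  (forall a, 0 < a <= 1 -> measurable_fun setT (fun w => f (X w) a)) ->
  (forall w, F (X w) = int01 (f (X w))) ->
  measurable_fun setT (fun w => F (X w)).
Proof.
move=> hf mf hF; apply: (@measurable_fun_cvg _ _ _ _ (fun N w => riemann N (f (X w)))).
  move=> N; rewrite /riemann; apply: measurable_funM; first exact: measurable_cst.
  under eq_fun do rewrite big_mkord; apply: measurable_sum => k; apply: mf.
  by rewrite divr_gt0 ?ltr0n //= ler_pdivrMr ?ltr0n // mul1r ler_nat.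
by move=> w _; rewrite hF; exact: riemann_cvg.
Qed.

Lemma measurable_sqdist X B : is_frv X -> measurable_fun setT (fun w => sqdist (X w) B).
Proof.
move=> hX; rewrite /sqdist; apply: measurable_funD; last exact: measurable_cst.
apply: measurable_funB; last first.
  apply: measurable_funM; first exact: measurable_cst.
  apply: (@measurable_fuzzy_functional X (fun A => fuzzy_pairing A B)
    (fun A a => pairing (level A a) (level B a))).
  - by move=> w; exact: monotone_difference_pairing.
  - move=> a a01; apply: (@measurable_level_functional X (fun A => pairing A (level B a))) => //.
    by apply: pairing_lower_semicontinuous; exact: level_body_gt0.
  - by move=> w; exact: fuzzy_pairingE.
apply: (@measurable_fuzzy_functional X (fun A => fuzzy_pairing A A)
    (fun A a => pairing (level A a) (level A a))).
- by move=> w; exact: monotone_difference_pairing.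
- move=> a a01; apply: (@measurable_level_functional X (fun A => pairing A A)) => //.
  exact: pairing_self_lower_semicontinuous.
- by move=> w; exact: fuzzy_pairingE.
Qed.

Definition fuzzy_radius B : R := radius (level B 0).

Let body0 B : convex_body (level B 0).
Proof. by apply: level_body; rewrite lexx ler01. Qed.

Let inv01 k : 0 < (k.+1%:R^-1 : R) <= 1.
Proof. by rewrite invr_gt0 ltr0n /= invf_le1 ?ltr0n // ler1n. Qed.

Lemma fuzzy_radius_ge0 B : 0 <= fuzzy_radius B.
Proof. exact: radius_ge0. Qed.

Lemma fuzzy_radiusP B : fuzzy_bounded B (fuzzy_radius B).
Proof. by move=> x; exact: radius_ub. Qed.

(** Measurability is only known at positive levels; the radius of the level [0] is the
    supremum of those of the levels [1 / (k + 1)]. *)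
Lemma measurable_fuzzy_radius X : is_frv X ->
  measurable_fun setT (fun w => fuzzy_radius (X w)).
Proof.
move=> hX; apply: (measurability _ (RGenOInfty.measurableE R)).
move=> _ [_ [c ->] <-]; rewrite setTI.
have VE : (fun w => fuzzy_radius (X w)) @^-1` `]c, +oo[%classic =
    \bigcup_k ((fun w => radius (level (X w) k.+1%:R^-1)) @^-1` `]c, +oo[%classic).
  apply/seteqP; split => w.
    rewrite /= in_itv /= andbT /fuzzy_radius => cw.
    have [_ [x Xx <-] cx] := sup_gt (image_nonempty _ (let: And3 h _ _ := body0 (X w) in h)) cw.
    have e0 : 0 < enorm x - c by rewrite subr_gt0.
    move: Xx; rewrite level0E => /closure_enormP /(_ _ e0) [y /= y0 yx].
    have [k ky] : exists k, k.+1%:R^-1 < X w y.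
      by have [k] := ltr_add_invr y0; rewrite add0r; exists k.
    exists k => //=; rewrite in_itv /= andbT.
    apply: lt_le_trans (radius_ub (level_body_gt0 _ (inv01 k)) (_ : level (X w) _ y)).
      have := ler_enormB y (y - x); rewrite subKr; lra.
    by rewrite level_gt0E ?invr_gt0 ?ltr0n //= ltW.
  move=> [k _]; rewrite /= !in_itv /= !andbT => ck; apply: lt_le_trans ck _.
  apply: radius_le; first by apply: level_body_gt0; exact: inv01.
  move=> x xk; apply: radius_ub; first exact: body0.
  by have /andP[/ltW k0 _] := inv01 k; exact: (level_anti (lexx 0) k0 xk).
rewrite VE; apply: bigcup_measurable => k _; rewrite -[X in measurable X]setTI.
exact: (measurable_level_functional hX (inv01 k) (@radius_lower_semicontinuous R d)).
Qed.

Lemma fuzzy_radius_summand A B K : is_fuzzy_sum A B K ->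
  fuzzy_radius B <= fuzzy_radius K + fuzzy_radius A.
Proof.
move=> h; have z01 : 0 <= (0 : R) <= 1 by rewrite lexx ler01.
apply: radius_le => // x Bx; have [[y Ay] _ _] := body0 A.
rewrite /eball /= -(addrK y x); apply: le_trans (ler_enormB _ _) _; apply: lerD.
  by apply: fuzzy_radiusP; rewrite h //; exists y, x; split => //; rewrite addrC.
exact: fuzzy_radiusP.
Qed.

(** ** Almost everywhere statements on a complete probability space *)

Lemma measurable_ae_iff (E F : set Omega) : measure_is_complete P -> measurable F ->
  {ae P, forall w, E w <-> F w} -> measurable E.
Proof.
move=> cP mF EF; set N := ~` [set w | E w <-> F w].
have mN : measurable N by exact: cP.
have -> : E = (F `\` N) `|` (E `&` N).
  apply/seteqP; split => w; last by move=> [[Fw /contrapT [_ h]]|[]//]; exact: h.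
  move=> Ew; have [Nw|nN] := pselect (N w); [by right|left].
  by split => //; have /contrapT [h _] := nN; exact: h.
apply: measurableU; first exact: measurableD.
by apply: cP; apply: negligibleS EF => w [].
Qed.

Lemma ae_probability1 (Q : Omega -> Prop) : measure_is_complete P ->
  {ae P, forall w, Q w} <-> measurable [set w | Q w] /\ P [set w | Q w] = 1%E.
Proof.
move=> cP; split => [aQ|[mQ PQ]].
  have mC : measurable (~` [set w | Q w]) by exact: cP.
  have mQ : measurable [set w | Q w] by rewrite -[X in measurable X]setCK; exact: measurableC.
  split => //; have PC : P (~` [set w | Q w]) = 0%E by exact: measure_negligible.
  by rewrite -[X in P X]setCK probability_setC // PC sube0.
have PC : P (~` [set w | Q w]) = 0%E by rewrite probability_setC // PQ subee.
by apply/negligibleP; first exact: measurableC.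
Qed.

Lemma ae_exists (Q : Omega -> Prop) : {ae P, forall w, Q w} -> exists w, Q w.
Proof.
move=> aQ; apply: contrapT => nQ.
have : P.-negligible setT by apply: negligibleS aQ => w _ Qw; apply: nQ; exists w.
move=> /(measure_negligible measurableT) PT; have := probability_setT P.
by rewrite [LHS]PT => /eqP; rewrite eq_sym onee_eq0.
Qed.

(** A body is recovered from its sum with a fixed body by an isometry, so that an
    open set [V] of remainders corresponds to an open set of sums: the bodies close
    to [C + B] for some [B] in [V]. *)
Lemma frv_summand H X Y : (0 < d)%N -> measure_is_complete P -> is_frv X ->
  {ae P, forall w, is_fuzzy_sum H (Y w) (X w)} -> is_frv Y.
Proof.
move=> d0 cP hX hs a a01; have bH := level_body_gt0 H a01.
pose C := level H a.
suff : hausdorff_borel `<=` [set V | measurable [set w | V (level (Y w) a)]] by exact.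
apply: smallest_sub.
  split.
  - exact: measurable0.
  - move=> V mV /=; rewrite (_ : [set w | _] = ~` [set w | V (level (Y w) a)]).
      exact: measurableC.
    by apply/seteqP; split => [w []//|w nV]; split => //; exact: level_body_gt0.
  - by move=> F mF; exact: (@bigcupT_measurable _ _ (fun k => [set w | F k (level (Y w) a)])).
move=> V [Vbody Vopen] /=.
pose W : set (set 'rV[R]_d) := [set A | convex_body A /\ exists (B : set 'rV[R]_d) (e : R),
  [/\ V B, 0 < e, forall B' : set 'rV[R]_d, convex_body B' -> hausdorff_dist B B' < e -> V B' &
     hausdorff_dist (minkowski_sum C B) A < e]].
apply: (@measurable_ae_iff _ [set w | W (level (X w) a)]) => //.
  apply: hX => //; apply: sub_sigma_algebra; split => [A []//|].
  move=> A [bA [B [e [VB e0 hB BA]]]].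
  have bB := Vbody B VB; have bCB := body_sum bH bB.
  exists (e - hausdorff_dist (minkowski_sum C B) A); first by rewrite subr_gt0.
  move=> A' bA' AA'; split => //; exists B, e; split => //.
  by apply: le_lt_trans (hausdorff_dist_triangle d0 bCB bA bA') _; rewrite -ltrBrDl.
apply: filterS hs => w hw /=; have bY := level_body_gt0 (Y w) a01.
have E : level (X w) a = minkowski_sum C (level (Y w) a) by rewrite hw // gt0_01.
split => [VY|[_ [B [e [VB e0 hB BX]]]]].
  split; first exact: level_body_gt0.
  have [e e0 he] := Vopen _ VY; exists (level (Y w) a), e; split => //.
  rewrite -E; apply: le_lt_trans e0; apply: hausdorff_dist_le => //.
  - exact: level_body_gt0.
  - exact: level_body_gt0.
  - by move=> u _; rewrite subrr normr0.
apply: hB => //; apply: le_lt_trans BX; rewrite E.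
by apply: hausdorff_dist_sum => //; exact: Vbody.
Qed.

End frv.

(** * The Hukuhara set *)

Section hukuhara.
Context {R : realType} {d : nat} (d0 : (0 < d)%N) {dO : measure_display}
  {Omega : measurableType dO} (P : probability Omega R)
  (cP : measure_is_complete P) (X : Omega -> fuzzy R d).
Implicit Types (Y : Omega -> fuzzy R d) (A B C H : fuzzy R d).
Local Notation S := (@unit_sphere R d).
Local Notation area := (sphere_area R d).
Local Notation E2 := (fun A B : fuzzy R d => area^-1 * sqdist A B).

Lemma integrable_sqr_radius Y : in_L2 P Y ->
  P.-integrable setT (EFin \o (fun w => fuzzy_radius (Y w) ^+ 2)).
Proof.
move=> [mY]; rewrite unlock => Yfin; apply/integrableP; split.
  by apply/measurable_EFinP; apply: measurable_funX; exact: measurable_fuzzy_radius.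
apply: le_lt_trans Yfin; rewrite le_eqVlt; apply/orP; left; apply/eqP.
by apply: eq_integral => w _; rewrite /= ger0_norm // sqr_ge0.
Qed.

Lemma integrable_double_sqr Y (N : R) : in_L2 P Y ->
  P.-integrable setT (EFin \o (fun w => 8 * fuzzy_radius (Y w) ^+ 2 + 8 * N ^+ 2)).
Proof.
move=> hY; rewrite (_ : _ \o _ = ((fun w => 8%:E * (fuzzy_radius (Y w) ^+ 2)%:E) \+
   cst (8 * N ^+ 2)%:E)%E); last by apply/funext => w /=; rewrite EFinD EFinM.
apply: integrableD => //; last exact: finite_measure_integrable_cst.
by apply: integrableZl => //; exact: integrable_sqr_radius.
Qed.

Lemma sqr_le_double (z x n : R) : 0 <= z -> 0 <= x -> 0 <= n -> z <= x + n ->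
  z ^+ 2 <= 8 * x ^+ 2 + 8 * n ^+ 2.
Proof.
move=> z0 x0 n0 zxn.
have : z ^+ 2 <= (x + n) ^+ 2 by rewrite ler_pXn2r ?nnegrE ?addr_ge0.
have := sqr_ge0 (x - n); have := sqr_ge0 x; have := sqr_ge0 n; lra.
Qed.

Hypothesis hX : in_L2 P X.

Lemma sqdist_normalized_ge0 A B : 0 <= E2 A B.
Proof. by rewrite mulr_ge0 ?invr_ge0 ?sphere_area_ge0 ?sqdist_ge0. Qed.

Lemma integrable_sqdist B : P.-integrable setT (EFin \o (fun w => E2 (X w) B)).
Proof.
have [N N0 bB] := fuzzy_boundedP B.
apply: (le_integrable _ _ _ (integrable_double_sqr N hX)) => //.
  apply/measurable_EFinP; apply: measurable_funM; first exact: measurable_cst.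
  by apply: measurable_sqdist; have [] := hX.
move=> w _; rewrite /= lee_fin ger0_norm ?sqdist_normalized_ge0 //.
set r := fuzzy_radius (X w); have r0 : 0 <= r := fuzzy_radius_ge0 (X w).
apply: le_trans (ler_norm _).
have rN : 0 <= r + N by exact: addr_ge0.
have bX : fuzzy_bounded (X w) (r + N).
  by apply: fuzzy_bounded_le (@fuzzy_radiusP R d (X w)); rewrite lerDl.
have bB' : fuzzy_bounded B (r + N) by apply: fuzzy_bounded_le bB; rewrite lerDr.
have ar := sphere_area_gt0 R d0.
rewrite ler_pdivrMl //; apply: le_trans (sqdist_bounded rN bX bB') _.
rewrite mulrC ler_wpM2l ?(ltW ar) //.
have := sqr_ge0 (r - N); lra.
Qed.

Definition mean_sqdist B : R := \int[P]_w (E2 (X w) B).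

Lemma mean_sq_distE B : mean_sq_dist P X B = (mean_sqdist B)%:E.
Proof.
rewrite /mean_sq_dist unlock /mean_sqdist /Rintegral fineK; last first.
  exact: integrable_fin_num (integrable_sqdist B).
by apply: eq_integral => w _; rewrite sqr_d2.
Qed.

Lemma mean_sqdist_ge0 B : 0 <= mean_sqdist B.
Proof. by apply: Rintegral_ge0 => w _; exact: sqdist_normalized_ge0. Qed.

Let integrable_cst (c : R) : P.-integrable setT (EFin \o (fun=> c)).
Proof. exact: finite_measure_integrable_cst. Qed.

Let Rintegral_cst1 (c : R) : \int[P]_w c = c.
Proof. by rewrite Rintegral_cst // [X in _ * fine X]probability_setT mulr1. Qed.

Let integrableZ (c : R) B : P.-integrable setT (EFin \o (fun w => c * E2 (X w) B)).
Proof.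
rewrite (_ : _ \o _ = (fun w => c%:E * (E2 (X w) B)%:E)%E) //.
by apply: integrableZl => //; exact: integrable_sqdist.
Qed.

Let integrableZD (c e : R) A B :
  P.-integrable setT (EFin \o (fun w => c * E2 (X w) A + e * E2 (X w) B)).
Proof.
rewrite (_ : _ \o _ = ((fun w => (c * E2 (X w) A)%:E) \+ (fun w => (e * E2 (X w) B)%:E))%E) //.
by apply: integrableD => //; exact: integrableZ.
Qed.

Let mean_linear (c e k : R) A B :
  \int[P]_w (c * E2 (X w) A + e * E2 (X w) B + k) =
  c * mean_sqdist A + e * mean_sqdist B + k.
Proof.
rewrite RintegralD // RintegralD // Rintegral_cst1.
congr (_ + _ + _); apply: RintegralZl => //; exact: integrable_sqdist.
Qed.

Let integrable_affine (c e k : R) A B :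
  P.-integrable setT (EFin \o (fun w => c * E2 (X w) A + e * E2 (X w) B + k)).
Proof.
rewrite (_ : _ \o _ = ((fun w => (c * E2 (X w) A + e * E2 (X w) B)%:E) \+ cst k%:E)%E) //.
by apply: integrableD; [|exact: integrableZD|exact: integrable_cst].
Qed.

Lemma mean_sqdist_midpoint A B C :
  (forall a u, 0 < a <= 1 -> S u ->
     support C u a = 2^-1 * support A u a + 2^-1 * support B u a) ->
  mean_sqdist C = 2^-1 * mean_sqdist A + 2^-1 * mean_sqdist B - 4^-1 * E2 A B.
Proof.
move=> h; rewrite -mean_linear; apply: eq_Rintegral => w _.
rewrite (sqdist_midpoint _ h).
move: (sqdist (X w) A) (sqdist (X w) B) (sqdist A B) => p q r; ring.
Qed.

Lemma mean_sqdist_triangle B H (e : R) : 0 < e ->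
  mean_sqdist H <= (1 + e) * mean_sqdist B + (1 + e^-1) * E2 B H.
Proof.
move=> e0; have -> : (1 + e) * mean_sqdist B + (1 + e^-1) * E2 B H =
    (1 + e) * mean_sqdist B + 0 * mean_sqdist B + (1 + e^-1) * E2 B H.
  by rewrite mul0r addr0.
rewrite -mean_linear; apply: le_Rintegral => //; first exact: integrable_sqdist.
move=> w _; rewrite mul0r addr0 !(mulrCA _ area^-1) -mulrDr.
by rewrite ler_wpM2l ?invr_ge0 ?sphere_area_ge0 //; exact: sqdist_triangle.
Qed.

Lemma le_mean_sqdist_ae A B :
  {ae P, forall w, sqdist (X w) A <= sqdist (X w) B} ->
  (mean_sq_dist P X A <= mean_sq_dist P X B)%E.
Proof.
move=> h.
have msE C : mean_sq_dist P X C = (\int[P]_w (E2 (X w) C)%:E)%E.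
  by rewrite /mean_sq_dist unlock; apply: eq_integral => w _; rewrite sqr_d2.
rewrite !msE; apply: ae_ge0_le_integral.
- by [].
- by move=> w _; rewrite lee_fin; exact: sqdist_normalized_ge0.
- exact: measurable_int (integrable_sqdist A).
- by move=> w _; rewrite lee_fin; exact: sqdist_normalized_ge0.
- exact: measurable_int (integrable_sqdist B).
- apply: filterS h => w hw _; rewrite lee_fin.
  by rewrite ler_wpM2l // invr_ge0 sphere_area_ge0.
Qed.

Lemma Theta_ae B : Theta P X B <-> {ae P, forall w, theta (X w) B}.
Proof.
have [h1 h2] := ae_probability1 (fun w => theta (X w) B) cP.
by split; [exact: h2|exact: h1].
Qed.

Lemma Theta_Steiner B : Theta P X B -> Steiner B = 0.
Proof. by move=> /Theta_ae /ae_exists [w []]. Qed.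

(** The remainders are chosen separately for each [w]; cancellation makes them
    measurable ([frv_summand]), and they are bounded by [X] and [B]. *)
Lemma Theta_decomposes B :
  Theta P X B <-> Steiner B = 0 /\ exists Z, decomposes P X B Z.
Proof.
split => [hB|[B0 [Z [_ hZ]]]]; last first.
  by apply/Theta_ae; apply: filterS hZ => w hw; split => //; exists (Z w).
split; first exact: Theta_Steiner.
have /choice [Z hZ] : forall w, exists A, theta (X w) B -> is_fuzzy_sum B A (X w).
  move=> w; have [[_ [A hA]]|h] := pselect (theta (X w) B); first by exists A.
  by exists (point 0).
have aeZ : {ae P, forall w, is_fuzzy_sum B (Z w) (X w)}.
  by move/Theta_ae : hB; apply: filterS => w /hZ.
have mZ : is_frv Z by apply: frv_summand aeZ => //; have [] := hX.
exists Z; split => //; split => //; rewrite unlock.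
have := integrable_double_sqr (fuzzy_radius B) hX.
move=> /integrableP [m8]; apply: le_lt_trans; apply: ae_ge0_le_integral => //.
- by move=> w _; rewrite lee_fin sqr_ge0.
- by apply/measurable_EFinP; apply: measurable_funX; exact: (measurable_fuzzy_radius mZ).
- exact: measurableT_comp m8.
- apply: filterS aeZ => w hw _; rewrite /= lee_fin; apply: le_trans (ler_norm _).
  by apply: sqr_le_double (fuzzy_radius_summand hw); exact: fuzzy_radius_ge0.
Qed.

Lemma Theta_midpoint A B C : Theta P X A -> Theta P X B ->
  (forall a u, 0 < a <= 1 -> S u ->
     support C u a = 2^-1 * support A u a + 2^-1 * support B u a) ->
  Theta P X C.
Proof.
move=> /Theta_ae hA /Theta_ae hB hC; apply/Theta_ae.
apply: filterS2 hA hB => w [A0 [A' hA']] [B0 [B' hB']].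
split; first exact: Steiner_midpoint hC.
have [C' hC'] := fuzzy_midpoint A' B'.
by exists C'; exact: (midpoint_sum hA' hB' hC hC').
Qed.

Lemma Theta_zero : (forall w, Steiner (X w) = 0) -> Theta P X (point 0).
Proof.
move=> X0; apply/Theta_ae/aeW => w; split; last by exists (X w); exact: is_fuzzy_sum_zero.
apply/Steiner_eq0P => p; rewrite -(scale0r 0) pairing_pointZ mul0r //.
Qed.

(** The midpoint of [A] and [B] is an element as well, and by the parallelogram
    identity it would be strictly better if [A] and [B] differed. *)
Lemma Theta_minimizer_unique A B : Theta P X A -> Theta P X B ->
  (forall C, Theta P X C -> mean_sqdist A <= mean_sqdist C) ->
  (forall C, Theta P X C -> mean_sqdist B <= mean_sqdist C) -> A = B.
Proof.
move=> tA tB minA minB; have [C hC] := fuzzy_midpoint A B.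
have AC := minA C (Theta_midpoint tA tB hC); rewrite (mean_sqdist_midpoint hC) in AC.
have AB := minA B tB; have BA := minB A tA.
apply: (sqdist_eq0 d0); apply/le_anti; rewrite sqdist_ge0 andbT.
have ar : 0 < area^-1 by rewrite invr_gt0 sphere_area_gt0.
rewrite -(pmulr_rle0 _ ar); move: AC AB BA; move: (area^-1 * _) => e.
move: (mean_sqdist A) (mean_sqdist B) => p q; lra.
Qed.

(** Any minimizing sequence is bounded, since all its terms are summands of one
    and the same [X w]; its limit along an ultrafilter is a minimizer. *)
Lemma Theta_minimizer_exists : (forall w, Steiner (X w) = 0) ->
  exists2 H, Theta P X H & forall B, Theta P X B -> mean_sqdist H <= mean_sqdist B.
Proof.
move=> X0; pose V := [set mean_sqdist B | B in Theta P X]; pose m := inf V.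
have V0 : V !=set0 by exists (mean_sqdist (point 0)), (point 0) => //; exact: Theta_zero.
have lV : has_lbound V by exists 0 => _ [B _ <-]; exact: mean_sqdist_ge0.
have mV B : Theta P X B -> m <= mean_sqdist B by move=> tB; apply: ge_inf => //; exists B.
have /choice [B hB] : forall n, exists B, Theta P X B /\ mean_sqdist B < m + n.+1%:R^-1.
  move=> n; have n0 : 0 < n.+1%:R^-1 :> R by rewrite invr_gt0 ltr0n.
  by have [_ [B tB <-] hB] := inf_adherent n0 (conj V0 lV); exists B.
have tB n : Theta P X (B n) by have [] := hB n.
have good : {ae P, forall w, forall n, theta (X w) (B n)}.
  by apply: ae_foralln => n; apply/Theta_ae.
have [w0 hw0] := ae_exists good.
have [k k0 hk] := summand_bounded R d0.
pose M0 := fuzzy_radius (X w0) + 1; have M00 : 0 < M0.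
  by rewrite ltr_wpDl // fuzzy_radius_ge0.
have bB n : fuzzy_bounded (B n) (k * M0).
  have [B0 [A hA]] := hw0 n; apply: hk hA B0 => //.
  by apply: fuzzy_bounded_le (@fuzzy_radiusP R d (X w0)); rewrite lerDl.
have kM0 : 0 <= k * M0 by rewrite mulr_ge0 // ltW.
have [U [UU ooU]] := ultra_oo.
have [H lH bH] := fuzzy_limit_exists (UU := UU) bB.
have H0 : Steiner H = 0.
  by apply: (Steiner_limit (UU := UU) kM0 bB bH lH) => n; exact: Theta_Steiner.
exists H => [|C tC].
  apply/Theta_ae; apply: filterS good => w hw; split => //.
  have /choice [A hA] : forall n, exists A, is_fuzzy_sum (B n) A (X w).
    by move=> n; have [_] := hw n.
  pose M := fuzzy_radius (X w) + k * M0.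
  have bA n : fuzzy_bounded (A n) M.
    have bR : fuzzy_radius (B n) <= k * M0.
      by apply: radius_le; [apply: level_body; rewrite lexx ler01|exact: bB].
    apply: fuzzy_bounded_le (@fuzzy_radiusP R d (A n)).
    by apply: le_trans (fuzzy_radius_summand (hA n)) _; rewrite lerD2l.
  have [H' lH' _] := fuzzy_limit_exists (UU := UU) bA.
  exists H'; apply: (fuzzy_limit_sum (UU := UU) _ bA lH lH' hA) => n.
  by apply: fuzzy_bounded_le (bB n); rewrite lerDr fuzzy_radius_ge0.
apply: le_trans (mV C tC); apply/ler_addgt0Pr => e e0.
have m0 : 0 <= m by apply: lb_le_inf => // _ [D _ <-]; exact: mean_sqdist_ge0.
(* chosen so that [t * m <= e] *)
pose t := e / (m + 1); have m1 : 0 < m + 1 by rewrite ltr_wpDl.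
have t0 : 0 < t by rewrite divr_gt0.
have cD : E2 (B n) H @[n --> U] --> (0 : R).
  rewrite -[X in _ --> X](mulr0 area^-1); apply: cvgMl_tmp.
  rewrite -(sqdistxx H); have := sqdist_cvg (UU := UU) (K := H) kM0 bB bH lH.
  by under eq_cvg do rewrite sqdistC.
have cm : (1 + t) * (m + n.+1%:R^-1) + (1 + t^-1) * E2 (B n) H @[n --> U] -->
    (1 + t) * (m + 0) + (1 + t^-1) * 0.
  apply: cvgD; apply: cvgMl_tmp => //; apply: cvgD; first exact: cvg_cst.
  by apply: cvg_trans cvg_harmonic; apply: cvg_app.
have : mean_sqdist H <= (1 + t) * (m + 0) + (1 + t^-1) * 0.
  apply: (cvgr_to_ge cm); apply: nearW => n.
  apply: le_trans (mean_sqdist_triangle (B n) H t0) _; rewrite lerD2r.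
  by rewrite ler_wpM2l ?addr_ge0 ?(ltW t0) //; have [_ /ltW] := hB n.
rewrite addr0 mulr0 addr0 => /le_trans; apply; rewrite mulrDl mul1r lerD2l.
by rewrite /t mulrAC ler_pdivrMr // ler_wpM2l ?(ltW e0) // lerDl.
Qed.

Lemma Theta_enlarge H C : (forall w, Steiner (X w) = 0) ->
  Theta P X H -> Theta P X C ->
  (forall a, 0 <= a <= 1 -> level H a `<=` level C a) ->
  (mean_sq_dist P X C <= mean_sq_dist P X H)%E.
Proof.
move=> X0 /Theta_ae tH /Theta_ae tC HC; apply: le_mean_sqdist_ae.
apply: filterS2 tH tC => w [H0 [Y hY]] [C0 [Z hZ]].
exact: (sqdist_summand_le hY hZ (Steiner_sum hY H0 (X0 w)) (Steiner_sum hZ C0 (X0 w)) HC).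
Qed.

End hukuhara.

Theorem theorem6 (R : realType) (d : nat) (hd : (1 <= d)%N)
    (dO : measure_display) (Omega : measurableType dO)
    (P : probability Omega R) (hP : measure_is_complete P)
    (X : Omega -> fuzzy R d) (hX : in_L2 P X)
    (hSte : forall w, Steiner (X w) = 0) :
  exists (H : fuzzy R d) (Y : Omega -> fuzzy R d),
    [/\ Steiner H = 0 /\ decomposes P X H Y,
        unique_argmin
          [set B | Steiner B = 0 /\ exists Z, decomposes P X B Z]
          (mean_sq_dist P X) H,
        unique_argmin (Theta P X) (mean_sq_dist P X) H,
        support_difference P X H Y /\
          (forall Z : Omega -> fuzzy R d, is_frv Z ->
             support_difference P X H Z -> {ae P, forall w, Z w = Y w}) &
        forall C : fuzzy R d, Theta P X C ->
          (forall a, 0 <= a <= 1 -> level H a `<=` level C a) -> H = C].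
Proof.
have [H tH minH] := Theta_minimizer_exists hd hP hX hSte.
have msE := mean_sq_distE hd hX.
have argmin : unique_argmin (Theta P X) (mean_sq_dist P X) H.
  split; [exact: tH|move=> B tB|move=> C tC minC].
    by rewrite !msE lee_fin; exact: minH.
  apply: (Theta_minimizer_unique hd hP hX tC tH _ minH) => D tD.
  by have := minC D tD; rewrite !msE lee_fin.
have [H0 [Y dY]] := (Theta_decomposes hd hP hX H).1 tH.
have [_ hY] := dY.
have sY : support_difference P X H Y.
  apply: filterS hY => w hw u a _ a01.
  by rewrite (support_fuzzy_sum u hw a01) addrAC subrr add0r.
exists H, Y; split.
- by [].
- have -> : [set B | Steiner B = 0 /\ exists Z, decomposes P X B Z] = Theta P X.
    by apply/seteqP; split => B /(Theta_decomposes hd hP hX B).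
  exact: argmin.
- exact: argmin.
- split=> // Z _ sZ; apply: filterS2 sY sZ => w hw hw'.
  by apply: fuzzy_support_ext => a u /gt0_01 a01 u1; rewrite hw // hw'.
- move=> C tC HC; have [_ minH' uniq] := argmin; apply: esym; apply: uniq; [exact: tC|move=> B tB].
  exact: le_trans (Theta_enlarge hd hP hX hSte tH tC HC) (minH' B tB).
Qed.
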